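(* Suppose that $\Psi(\Sigma^* )=G$ and let $\varphi:\Sigma\to\mathbb{R}$ be $\mathcal{C}(k)$-measurable for some $k\in\mathbb{N}_0$. The following holds for all $j\in\mathbb{N}$ with $j\ge k-1$. We have $$\mathcal{P}\left(\varphi,\Psi^{-1}\{\mathrm{id}\}\cap\Sigma^*\right)\le\log\rho\left(\mathcal{L}_{\varphi\circ\pi_1}|_{V_j}\right)\le\log\rho\left(\mathcal{L}_{\varphi\circ\pi_1}\right)=\mathcal{P}(\varphi),$$ with equality in the second inequality if and only if $G$ is amenable. Moreover, if $\varphi$ is asymptotically symmetric with respect to $\Psi$, then $$\mathcal{P}\left(\varphi,\Psi^{-1}\{\mathrm{id}\}\cap\Sigma^*\right)=\log\rho\left(\mathcal{L}_{\varphi\circ\pi_1}|_{V_j}\right),$$ and so $G$ is amenable if and only if $\mathcal{P}(\varphi,\Psi^{-1}\{\mathrm{id}\}\cap\Sigma^* )=\mathcal{P}(\varphi)$.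
   Context: Symbolic space. $I$ is a finite alphabet, $(a(i,j))\in\{0,1\}^{I\times I}$ is an incidence matrix such that for each $i\in I$ there is $j\in I$ with $a(i,j)=1$, $\Sigma:=\{\omega\in I^{\mathbb{N}}:a(\omega_i,\omega_{i+1})=1\ \forall i\ge1\}$ with the product topology and shift $\sigma$. $\Sigma^n$ ($n\ge1$) is the set of admissible words of length $n$, $\Sigma^0=\{\emptyset\}$ (empty word), $\Sigma^*=\bigcup_{n\ge1}\Sigma^n$; $I^*$ is the free semigroup of nonempty finite words over $I$. $[\omega]\subset\Sigma$ is the cylinder of $\omega$. $\mathcal{C}(k)$ is the $\sigma$-algebra generated by $\{[\omega]:\omega\in\Sigma^k\}$. Standing assumptions. $G$ is a countable discrete group with counting measure $\lambda$; $\Psi:I^*\to G$ is a semigroup homomorphism such that for all $a,b\in I$ there is $\gamma\in(\Psi^{-1}\{\mathrm{id}\}\cap\Sigma^* )\cup\{\emptyset\}$ with $a\gamma b\in\Sigma^*$; $\varphi:\Sigma\to\mathbb{R}$ is Hölder continuous (automatic if $\mathcal{C}(k)$-measurable). Pressure. $S_n\varphi=\sum_{i=0}^{n-1}\varphi\circ\sigma^i$ and $S_\omega\varphi=\sup_{\tau\in[\omega]}S_{|\omega|}\varphi(\tau)$. For $\mathcal{C}\subset\Sigma^*$, $\mathcal{P}(\varphi,\mathcal{C}):=\limsup_{n\to\infty}\frac1n\log\sum_{\omega\in\mathcal{C}\cap\Sigma^n}e^{S_\omega\varphi}$ (with $\log0=-\infty$), and $\mathcal{P}(\varphi):=\mathcal{P}(\varphi,\Sigma^*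 )$. Gibbs measure. $\mathcal{L}_\varphi f(x)=\sum_{y\in\sigma^{-1}\{x\}}e^{\varphi(y)}f(y)$ on $C_b(\Sigma)$. There are a unique Borel probability measure $\mu$ with $\int\mathcal{L}_\varphi f\,d\mu=e^{\mathcal{P}(\varphi)}\int f\,d\mu$ for all $f\in C_b(\Sigma)$ and a unique Hölder continuous $h:\Sigma\to(0,\infty)$ with $\int h\,d\mu=1$, $\mathcal{L}_\varphi h=e^{\mathcal{P}(\varphi)}h$; $\mu_\varphi:=h\,d\mu$ is the unique $\sigma$-invariant Gibbs measure for $\varphi$. Group extension. $(\sigma\rtimes\Psi)(\omega,g):=(\sigma(\omega),g\Psi(\omega_1))$ on $\Sigma\times G$; $\pi_1,\pi_2$ are the projections to $\Sigma$ and $G$. On the real Hilbert space $L^2(\Sigma\times G,\mu_\varphi\times\lambda)$ let $Uf:=f\circ(\sigma\rtimes\Psi)$ and $\mathcal{L}_{\varphi\circ\pi_1}:=e^{\mathcal{P}(\varphi)}M\,U^*M^{-1}$, where $Mf=f\cdot(h\circ\pi_1)$. Explicitly, a.e., $\mathcal{L}_{\varphi\circ\pi_1}(f)(\omega,g)=\sum_{i\in I:\,i\omega_1\in\Sigma^2}e^{\varphi(i\omega)}f(i\omega,g\Psi(i)^{-1})$. $\rho(T)$ is the spectral radius ($=\lim_n\|T^n\|^{1/n}$). $V_j$ is the closed subspace of all $f\in L^2(\Sigma\times G,\mu_\varphi\times\lambda)$ having a $\mathcal{C}(j)\otimes\mathcal{B}(G)$-measurable representative, where $\mathcal B(G)$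 is the Borel $\sigma$-algebra on $G$. When $\varphi$ is $\mathcal{C}(k)$-measurable, $V_j$ is $\mathcal{L}_{\varphi\circ\pi_1}$-invariant for $j\in\mathbb N$, $j\ge k-1$. Asymptotic symmetry. $\varphi$ is asymptotically symmetric with respect to $\Psi$ if there are sequences $(c_m)_{m\in\mathbb{N}}$ in $(0,\infty)$ and $(N_m)_{m\in\mathbb{N}}$ in $\mathbb{N}_0$ with $c_m^{1/m}\to1$, $N_m/m\to0$ such that for all $g\in G$, $n\in\mathbb{N}$: $$\sum_{\omega\in\Sigma^n:\Psi(\omega)=g}e^{S_\omega\varphi}\le c_n\sum_{i=0}^{N_n}\ \sum_{\tau\in\Sigma^{n+i}:\Psi(\tau)=g^{-1}}e^{S_\tau\varphi}.$$ *)

(* Defs.v *)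
From HB Require Import structures.
From mathcomp Require Import all_boot all_order all_algebra.
From mathcomp Require Import all_classical all_reals all_analysis.

Set Implicit Arguments.
Unset Strict Implicit.
Unset Printing Implicit Defensive.

Import Order.TTheory GRing.Theory Num.Theory.
Import numFieldNormedType.Exports.

Local Open Scope classical_set_scope.
Local Open Scope ring_scope.

(** Sequences and words are indexed from 0, so the first letter of [x] is [x 0]. *)

(* Measurable types are pointed in the library, whence [alphabet_gt0]. *)
Record incidence_matrix (I : finType) := IncidenceMatrix {
  incidence :> rel I;
  incidence_succ : forall i, exists j, incidence i j;
  alphabet_gt0 : (0 < #|I|)%N
}.

Definition admissible (I : finType) (A : incidence_matrix I) :
    set (prod_topology (fun _ : nat => discrete_topology I)) :=
  [set x | forall n, A (x n) (x n.+1)].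

Definition shift_space (I : finType) (A : incidence_matrix I) : Type :=
  set_type (admissible A).

HB.instance Definition _ (I : finType) (A : incidence_matrix I) :=
  Topological.copy (shift_space A) (set_type (admissible A)).

Section shift_space_measurable.
Variables (I : finType) (A : incidence_matrix I).

Lemma shift_space_inhabited : exists x : shift_space A, True.
Proof.
have /card_gt0P[i0 _] := alphabet_gt0 A.
pose f (i : I) : I := xchoose (incidence_succ A i).
pose x : prod_topology (fun _ : nat => discrete_topology I) :=
  fun n => iter n f i0.
suff Ax : x \in admissible A by exists (exist (fun y => y \in admissible A) x Ax).
by apply/mem_set => n /=; exact: (xchooseP (incidence_succ A _)).
Qed.

HB.instance Definition _ :=
  isPointed.Build (shift_space A) (projT1 (cid shift_space_inhabited)).

HB.instance Definition _ := Measurable.copy (shift_space A)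
  (g_sigma_algebraType (@open (shift_space A))).

End shift_space_measurable.

Definition letter (I : finType) (A : incidence_matrix I) (x : shift_space A)
  (n : nat) : I := set_val x n.

Lemma shift_subproof (I : finType) (A : incidence_matrix I)
  (x : shift_space A) :
  (fun n => letter x n.+1) \in admissible A.
Proof. by apply/mem_set => n; exact: (set_mem (valP x)). Qed.

Definition shift (I : finType) (A : incidence_matrix I) (x : shift_space A) :
  shift_space A := exist (fun y => y \in admissible A) _ (shift_subproof x).

Definition words (I : finType) (A : incidence_matrix I) : set (seq I) :=
  [set w | w <> [::] /\ sorted A w].

Definition cylinder (I : finType) (A : incidence_matrix I) (w : seq I) :
  set (shift_space A) := [set x | mkseq (letter x) (size w) = w].

Arguments cylinder {I} A w.

Definition cylinder_algebra (I : finType) (A : incidence_matrix I) (k : nat) :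
    set (set (shift_space A)) :=
  <<s [set cylinder A w | w in [set w | size w = k /\ sorted A w]] >>.

Arguments cylinder_algebra {I} A k.

Definition measurable_wrt (T : Type) (R : realType) (F : set (set T))
  (f : T -> R) := forall B : set R, measurable B -> F (f @^-1` B).

Section potentials.
Context (R : realType) (I : finType) (A : incidence_matrix I).
Implicit Types (phi f h : shift_space A -> R).

Definition hoelder_continuous f :=
  exists C alpha : R, 0 < alpha /\ forall (n : nat) (x y : shift_space A),
    (forall i, (i < n)%N -> letter x i = letter y i) ->
    `|f x - f y| <= C * expR (- alpha * n%:R).

Definition birkhoff_sum phi (n : nat) (x : shift_space A) : R :=
  \sum_(i < n) phi (iter i (@shift I A) x).

Definition word_sum phi (w : seq I) : R :=
  sup [set birkhoff_sum phi (size w) x | x in cylinder A w].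

Definition pressure phi (C : set (seq I)) : \bar R :=
  limn_esup (fun n : nat =>
    ((n%:R^-1)%:E *
      lne (\sum_(w : n.-tuple I | (w : seq I) \in C)
             expR (word_sum phi w))%R%:E)%E).

(* The pressure of [words A], as a real number: it is finite as soon as [phi]
   is bounded. *)
Definition topological_pressure phi : R := fine (pressure phi (words A)).

Definition transfer phi f (x : shift_space A) : R :=
  \sum_(y \in (@shift I A) @^-1` [set x]) (expR (phi y) * f y).

Definition conformal phi (mu : probability (shift_space A) R) :=
  forall f, continuous f -> bounded_fun f ->
    (\int[mu]_x (transfer phi f x)%:E =
     (expR (topological_pressure phi))%:E * \int[mu]_x (f x)%:E)%E.

Definition normalized_eigenfunction phi (mu : probability (shift_space A) R)
    h :=
  [/\ forall x, 0 < h x,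
      hoelder_continuous h,
      (\int[mu]_x (h x)%:E = 1)%E
    & forall x, transfer phi h x = expR (topological_pressure phi) * h x].

(* [mu_phi] is the invariant Gibbs measure [h dmu]. *)
Definition gibbs_measure phi (mu : probability (shift_space A) R) h
    (mu_phi : probability (shift_space A) R) :=
  [/\ conformal phi mu, normalized_eigenfunction phi mu h
    & forall B, measurable B -> mu_phi B = (\int[mu]_(x in B) (h x)%:E)%E].

End potentials.

(* A group with the Borel sigma-algebra of its discrete topology. *)
Definition discrete_group (G : groupType) : Type := G.

HB.instance Definition _ (G : groupType) := Group.on (discrete_group G).
HB.instance Definition _ (G : groupType) :=
  isPointed.Build (discrete_group G) (1%g : G).

Section discrete_group_measurable.
Variable G : groupType.
Let D : set (set (discrete_group G)) := setT.
Let D0 : D set0. Proof. by []. Qed.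
Let DC B : D B -> D (~` B). Proof. by []. Qed.
Let DU (F : (set (discrete_group G))^nat) :
  (forall i, D (F i)) -> D (\bigcup_i F i).
Proof. by []. Qed.
HB.instance Definition _ :=
  @isMeasurable.Build default_measure_display (discrete_group G) D D0 DC DU.
End discrete_group_measurable.

Definition amenable (R : realType) (G : groupType) :=
  exists m : set G -> R,
    [/\ forall B, 0 <= m B,
        m setT = 1,
        forall B C, B `&` C = set0 -> m (B `|` C) = m B + m C
      & forall (g : G) B, m [set (g * x)%g | x in B] = m B].

(** Operators act on functions; on L2 functions, those below are compatible
    with almost everywhere equality. *)

Section operators.
Context d (X : measurableType d) (R : realType).
Variable m : {measure set X -> \bar R}.
Implicit Types (T : (X -> R) -> X -> R) (V : set (X -> R)).

Definition L2 : set (X -> R) := [set f | f \in Lfun m 2%:E].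

(* Characterizes [adjoint T f] up to almost everywhere equality; if [T] is
   bounded on L2, existence is the Riesz representation theorem. *)
Definition adjoint T (f : X -> R) : X -> R :=
  get [set g | L2 g /\ forall u, L2 u ->
    (\int[m]_x (T u x * f x)%:E = \int[m]_x (u x * g x)%:E)%E].

Definition operator_norm V T : \bar R :=
  ereal_sup [set ('N[m]_2%:E[EFin \o T f])%E
            | f in [set f | V f /\ ('N[m]_2%:E[EFin \o f] <= 1)%E]].

(* The spectral radius of the restriction of [T] to the [T]-invariant subspace
   [V] of L2, by Gelfand's formula. *)
Definition spectral_radius V T : \bar R :=
  limn (fun n : nat => (operator_norm V (iter n T) `^ n%:R^-1)%E).

End operators.

Section group_extension.
Context (R : realType) (I : finType) (A : incidence_matrix I) (G : groupType).
Implicit Types (Psi : seq I -> G) (phi h : shift_space A -> R).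

(* The free semigroup on [I] consists of the nonempty words; the value of
   [Psi] at [[::]] is unconstrained. *)
Definition semigroup_hom Psi :=
  forall u v, u <> [::] -> v <> [::] -> Psi (u ++ v) = (Psi u * Psi v)%g.

Definition kernel_words Psi : set (seq I) :=
  Psi @^-1` [set 1%g] `&` words A.

Definition linked Psi :=
  forall a b : I, exists gamma : seq I,
    (kernel_words Psi gamma \/ gamma = [::]) /\
    words A (a :: gamma ++ [:: b]).

Definition asymptotically_symmetric Psi phi :=
  exists (c : nat -> R) (N : nat -> nat),
  [/\ forall n, (0 < n)%N -> 0 < c n,
      (fun n : nat => c n `^ n%:R^-1) @ \oo --> (1 : R),
      (fun n : nat => (N n)%:R / n%:R) @ \oo --> (0 : R)
    & forall (g : G) (n : nat), (0 < n)%N ->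
      \sum_(w : n.-tuple I | (sorted A w) && (Psi w == g))
         expR (word_sum phi w)
      <= c n * \sum_(0 <= i < (N n).+1)
           \sum_(t : (n + i).-tuple I | (sorted A t) && (Psi t == g^-1%g))
              expR (word_sum phi t)].

Let X : Type := (shift_space A * discrete_group G)%type.

Definition skew_product Psi (p : X) : X :=
  (shift p.1, ((p.2 : G) * Psi [:: letter p.1 0])%g).

Definition koopman Psi (f : X -> R) : X -> R := f \o skew_product Psi.

(* The product of [mu_phi] and the counting measure. Unlike [\x], the product
   [\x^] requires sigma-finiteness of its first factor only. *)
Definition extension_measure (mu_phi : probability (shift_space A) R) :
    {measure set (shift_space A * discrete_group G) -> \bar R} :=
  (mu_phi \x^ (@counting (discrete_group G) R))%E.

Definition extension_operator Psi phi h
    (mu_phi : probability (shift_space A) R) (f : X -> R) : X -> R :=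
  fun p => expR (topological_pressure phi) *
    (adjoint (extension_measure mu_phi) (koopman Psi)
       (fun q => f q / h q.1) p * h p.1).

Definition cylinder_space (mu_phi : probability (shift_space A) R) (j : nat) :
    set (X -> R) :=
  [set f | L2 (extension_measure mu_phi) f /\
    exists f' : X -> R,
      ae_eq (extension_measure mu_phi) setT f f' /\
      measurable_wrt
        <<s [set B `*` D | B in cylinder_algebra A j
                         & D in @measurable _ (discrete_group G)] >> f'].

End group_extension.

Arguments cylinder_space {R I A} G mu_phi j.

(* Main.v *)
(* On functions of finitely many letters, the transfer operator becomes a nonnegative operator T
   on (states) x G that commutes with the left translations of G, a state being an admissible
   word of length j.  On the whole of L2, invariance of mu_phi conjugates L to lambda times the
   adjoint of an isometry, lambda = exp P(phi), so that rho(L) = lambda; the return weights of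
   T bound |T^n| from below, which gives the first inequality.

   If G is amenable, then by Hall's marriage theorem an invariant mean excludes doubling, so there
   are finite sets K with |K E| < 2 |K|, and the Perron eigenvector carried by K shows that |T^n|
   grows like lambda^n.  Conversely, the Perron eigenvectors turn T / lambda into a Markov chain;
   if no power of it contracts the norm, orbit sums are almost invariant vectors and a limit of
   their square masses is an invariant mean.

   Under asymptotic symmetry the adjoint of T^n is dominated by later powers of T.  The norm of
   B = (T^n)* T^n is governed by its return weights, because k |-> |B^k f| is log-convex, and these
   are dominated by sums over kernel words, hence by exp (2 n P_ker) up to subexponential factors. *)

Require Import Defs.
From HB Require Import structures.
From mathcomp Require Import all_boot all_order all_algebra.
From mathcomp Require Import finmap.
From mathcomp Require Import all_classical all_reals all_analysis.
From mathcomp Require Import measurable_realfun.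
From mathcomp Require Import ring lra zify.

Set Implicit Arguments.
Unset Strict Implicit.
Unset Printing Implicit Defensive.

Import Order.TTheory GRing.Theory Num.Theory.
Import numFieldNormedType.Exports.

Local Open Scope classical_set_scope.
Local Open Scope ring_scope.

(** * Finitely supported functions *)

(** Norms are only compared up to factors that are constant or subexponential in n, since these
    disappear in nth roots. This pays for three replacements: suprema over cylinders by values at
    one point (bounded distortion), functions on states times G by functions on G alone, and
    concatenation by gluing. Gluing rests on the link words of [linked]: their value in G is trivial
    and their length is bounded, so words can be joined while their values simply multiply. The
    links make all states communicate, bound [h] away from 0, and compare compositions of word
    weights with weights of longer words. Two obstacles shape the rest. [adjoint] is a choice among
    almost everywhere equal functions, so iterates of the operator have no pointwise formula; they
    are matched almost everywhere with the explicit [transfer_ext]. And [h] is only given as a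
    Hölder function of the whole sequence; its suprema over cylinders serve as the right eigenvector
    on states, and the [mu]-masses of cylinders as the left one. *)

Lemma sqr_le_discriminant (R : realFieldType) (a b c : R) :
  (forall s t, 0 <= s ^+ 2 * a + s * t * b *+ 2 + t ^+ 2 * c) -> b ^+ 2 <= a * c.
Proof.
move=> H; have c0 : 0 <= c.
  by have := H 0 1; rewrite expr0n /= !mul0r mul0rn expr1n mul1r !add0r.
have [c_eq0|c_neq0] := eqVneq c 0.
  suff -> : b = 0 by rewrite c_eq0 expr0n mulr0.
  apply/eqP; apply: contraT => b0.
  (* With c = 0 and s = 1 the form is affine in t, and this t gives it the value -1. *)
  have := H 1 (- (a + 1) / (b *+ 2)); rewrite c_eq0.
  have b2 : b *+ 2 != 0 by rewrite mulrn_eq0.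
  have -> : 1 ^+ 2 * a + 1 * (- (a + 1) / (b *+ 2)) * b *+ 2 +
     (- (a + 1) / (b *+ 2)) ^+ 2 * 0 = -1 by field.
  by rewrite lerNr oppr0 ler10.
have cp : 0 < c by rewrite lt_neqAle eq_sym c_neq0.
have := H c (- b).
have -> : c ^+ 2 * a + c * - b * b *+ 2 + (- b) ^+ 2 * c = c * (a * c - b ^+ 2).
  by ring.
by rewrite pmulr_rge0 // subr_ge0.
Qed.

Section finitely_supported.
Context (R : realType) (X : choiceType).
Implicit Types (f g : X -> R) (A : {fset X}).

(** The value is 0 by convention when the support is infinite, so additivity and monotonicity
    require [fsupp], while scaling and reindexing hold for all functions. *)
Definition fsum f : R := \sum_(i \in [set: X]) f i.
Definition fsupp f := exists A, forall i, i \notin A -> f i = 0.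

Lemma fsumE A f : (forall i, i \notin A -> f i = 0) -> fsum f = \sum_(i <- A) f i.
Proof. exact: fsbigTE. Qed.

Lemma eq_fsum f g : f =1 g -> fsum f = fsum g.
Proof. by move=> fg; apply: eq_fsbigr => i _; exact: fg. Qed.

Lemma eq_fsupp f g : f =1 g -> fsupp f -> fsupp g.
Proof. by move=> fg [A Af]; exists A => i /Af <-. Qed.

Lemma fsupp_common (J : finType) (F : J -> X -> R) : (forall j, fsupp (F j)) ->
  exists A, forall j i, i \notin A -> F j i = 0.
Proof.
move=> /choice[B FB]; exists [fset i | j in J, i in B j]%fset => j i.
move=> Ai; apply: FB; apply: contra Ai => Bi.
by apply/imfset2P; exists j; rewrite ?inE//; exists i.
Qed.

Lemma fsupp_common2 f g : fsupp f -> fsupp g ->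
  exists A, (forall i, i \notin A -> f i = 0) /\ (forall i, i \notin A -> g i = 0).
Proof.
move=> ff fg; have [|A HA] := @fsupp_common _ (fun b : bool => if b then f else g).
  by case.
by exists A; split; [exact: (HA true)|exact: (HA false)].
Qed.

Lemma fsupp0 : fsupp (fun=> 0). Proof. by exists fset0. Qed.

Lemma fsuppD f g : fsupp f -> fsupp g -> fsupp (fun i => f i + g i).
Proof.
move=> ff fg; have [A [fA gA]] := fsupp_common2 ff fg.
by exists A => i Ai; rewrite fA ?gA ?addr0.
Qed.

Lemma fsuppMl f g : fsupp f -> fsupp (fun i => f i * g i).
Proof. by move=> [A Af]; exists A => i /Af ->; rewrite mul0r. Qed.

Lemma fsuppMr f g : fsupp f -> fsupp (fun i => g i * f i).
Proof. by move=> [A Af]; exists A => i /Af ->; rewrite mulr0. Qed.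

Lemma fsuppB f g : fsupp f -> fsupp g -> fsupp (fun i => f i - g i).
Proof.
move=> ff fg; apply: fsuppD => //.
by apply: eq_fsupp (fsuppMr (fun=> -1) fg) => i; rewrite mulN1r.
Qed.

Lemma fsuppX f : fsupp f -> fsupp (fun i => f i ^+ 2).
Proof. by move=> ff; apply: eq_fsupp (fsuppMl f ff) => i; rewrite expr2. Qed.

Lemma fsupp_norm f : fsupp f -> fsupp (fun i => `|f i|).
Proof. by move=> [A Af]; exists A => i /Af ->; rewrite normr0. Qed.

Lemma fsupp_sum (J : Type) (r : seq J) (P : pred J) (F : J -> X -> R) :
  (forall j, P j -> fsupp (F j)) -> fsupp (fun i => \sum_(j <- r | P j) F j i).
Proof.
move=> H; elim: r => [|j r IH]; first by apply: eq_fsupp fsupp0 => i; rewrite big_nil.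
case Pj: (P j); last by apply: eq_fsupp IH => i; rewrite big_cons Pj.
by apply: eq_fsupp (fsuppD (H _ Pj) IH) => i; rewrite big_cons Pj.
Qed.

Lemma fsupp_comp (s t : X -> X) f : cancel s t -> fsupp f -> fsupp (f \o s).
Proof.
move=> st [A Af]; exists (t @` A)%fset => i iA; apply: Af.
by apply: contra iA => sA; apply/imfsetP; exists (s i); rewrite ?st.
Qed.

Lemma fsum0 : fsum (fun=> 0) = 0. Proof. exact: fsbig1. Qed.

Lemma fsumD f g : fsupp f -> fsupp g -> fsum (fun i => f i + g i) = fsum f + fsum g.
Proof.
move=> ff fg; have [A [fA gA]] := fsupp_common2 ff fg.
rewrite !(@fsumE A) ?big_split//= => i Ai; by rewrite fA ?gA ?addr0.
Qed.

Lemma fsumZ c f : fsum (fun i => c * f i) = c * fsum f.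
Proof.
have [->|c0] := eqVneq c 0.
  by rewrite mul0r -[RHS]fsum0; apply: eq_fsum => i; rewrite mul0r.
by rewrite /fsum mulr_fsumr.
Qed.

Lemma fsumB f g : fsupp f -> fsupp g -> fsum (fun i => f i - g i) = fsum f - fsum g.
Proof.
move=> ff fg; rewrite -[- fsum g]mulN1r -fsumZ -fsumD//.
  by apply: eq_fsum => i; rewrite mulN1r.
exact: fsuppMr.
Qed.

Lemma fsum_sum (J : Type) (r : seq J) (P : pred J) (F : J -> X -> R) :
  (forall j, P j -> fsupp (F j)) ->
  fsum (fun i => \sum_(j <- r | P j) F j i) = \sum_(j <- r | P j) fsum (F j).
Proof.
move=> H; elim: r => [|j r IH].
  by rewrite big_nil -[RHS]fsum0; apply: eq_fsum => i; rewrite big_nil.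
case Pj: (P j); last first.
  by rewrite big_cons Pj -IH; apply: eq_fsum => i; rewrite big_cons Pj.
rewrite big_cons Pj -IH -fsumD; [|exact: H|exact: fsupp_sum].
by apply: eq_fsum => i; rewrite big_cons Pj.
Qed.

Lemma fsum_ge0 f : (forall i, 0 <= f i) -> 0 <= fsum f.
Proof. by move=> f0; exact: fsumr_ge0. Qed.

Lemma le_fsum f g : fsupp f -> fsupp g -> (forall i, f i <= g i) -> fsum f <= fsum g.
Proof.
move=> ff fg fg_le; rewrite -subr_ge0 -fsumB//; apply: fsum_ge0 => i.
by rewrite subr_ge0.
Qed.

Lemma fsum_ge_seq f (s : seq X) : fsupp f -> (forall i, 0 <= f i) -> uniq s ->
  \sum_(i <- s) f i <= fsum f.
Proof.
move=> [A Af] f0 us; pose B := (A `|` [fset i in s])%fset.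
rewrite (@fsumE B); last first.
  by move=> i; rewrite /B inE negb_or => /andP[/Af].
rewrite [leRHS](bigID (fun i => i \in s))/= -[leLHS]addr0.
apply: lerD; last by apply: sumr_ge0.
rewrite -[leRHS]big_filter [leRHS](perm_big s)//=.
apply: uniq_perm => [|//|i]; first by rewrite filter_uniq.
by rewrite mem_filter /B !inE; case: (i \in s); rewrite ?orbT.
Qed.

Lemma ler_fsum_point f i : fsupp f -> (forall i, 0 <= f i) -> f i <= fsum f.
Proof.
by move=> ff f0; have := @fsum_ge_seq f [:: i] ff f0 erefl; rewrite big_seq1.
Qed.

Lemma fsum_reindex (s t : X -> X) f : cancel s t -> cancel t s ->
  fsum (f \o s) = fsum f.
Proof.
move=> st ts; rewrite /fsum [RHS](reindex_fsbigT s)//.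
by exists t.
Qed.

Lemma fsum_cauchy f g : fsupp f -> fsupp g ->
  fsum (fun i => f i * g i) ^+ 2 <=
  fsum (fun i => f i ^+ 2) * fsum (fun i => g i ^+ 2).
Proof.
move=> ff fg; apply: sqr_le_discriminant => s t.
rewrite [leRHS](_ : _ = fsum (fun i => (s * f i + t * g i) ^+ 2)).
  by apply: fsum_ge0 => i; exact: sqr_ge0.
rewrite [RHS](eq_fsum (g := fun i => (s ^+ 2 * f i ^+ 2 + s * t *+ 2 * (f i * g i))
  + t ^+ 2 * g i ^+ 2)); last by move=> i; ring.
have f2 : fsupp (fun i => s ^+ 2 * f i ^+ 2) by apply/fsuppMr/fsuppX.
have g2 : fsupp (fun i => t ^+ 2 * g i ^+ 2) by apply/fsuppMr/fsuppX.
have fg2 : fsupp (fun i => s * t *+ 2 * (f i * g i)) by apply/fsuppMr/fsuppMl.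
by rewrite fsumD ?(fsumD f2 fg2) ?fsumZ ?mulrnAl//; exact: fsuppD.
Qed.

End finitely_supported.

Section fsum_group.
Context (R : realType) (G : groupType).
Implicit Types (f : G -> R) (x : G).

Lemma fsum_mulr x f : fsum (fun g => f (g * x)%g) = fsum f.
Proof.
by apply: (fsum_reindex (s := fun g => (g * x)%g) (t := fun g => (g * x^-1)%g)) => g;
  rewrite ?mulgK ?mulgVK.
Qed.

Lemma fsum_mull x f : fsum (fun g => f (x * g)%g) = fsum f.
Proof.
by apply: (fsum_reindex (s := fun g => (x * g)%g) (t := fun g => (x^-1 * g)%g)) => g;
  rewrite ?mulKg ?mulVKg.
Qed.

Lemma fsupp_mulr x f : fsupp f -> fsupp (fun g => f (g * x)%g).
Proof.
by apply: (fsupp_comp (s := fun g => (g * x)%g) (t := fun g => (g * x^-1)%g)) => g;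
  rewrite mulgK.
Qed.

Lemma fsupp_mull x f : fsupp f -> fsupp (fun g => f (x * g)%g).
Proof.
by apply: (fsupp_comp (s := fun g => (x * g)%g) (t := fun g => (x^-1 * g)%g)) => g;
  rewrite mulKg.
Qed.

End fsum_group.

(** * Invariant means, marriage and doubling *)

Section marriage.
Context (X Y : choiceType).
Implicit Types (M N : X -> {fset Y}) (K : {fset X}) (x : X).

Definition neighbourhood N K : {fset Y} := (\bigcup_(x <- K) N x)%fset.
Definition hall N := forall K, (#|` K| <= #|` neighbourhood N K|)%N.

Lemma neighbourhoodP N K y :
  reflect (exists2 x, x \in K & y \in N x) (y \in neighbourhood N K).
Proof.
rewrite /neighbourhood; apply: (iffP (bigfcupP _ _ _ _)) => [[x /andP[xK _] yN]|[x xK yN]].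
  by exists x.
by exists x; rewrite ?xK.
Qed.

Lemma neighbourhoodS M N K :
  (forall x, x \in K -> M x `<=` N x)%fset -> (neighbourhood M K `<=` neighbourhood N K)%fset.
Proof.
move=> MN; apply/fsubsetP => y /neighbourhoodP[x xK yM].
by apply/neighbourhoodP; exists x => //; exact: (fsubsetP (MN x xK)).
Qed.

Let sub_system N := {M : X -> {fset Y} | `[< hall M /\ forall x, (M x `<=` N x)%fset >]}.
Let finer N : rel (sub_system N) :=
  fun s t => `[< forall x, (sval t x `<=` sval s x)%fset >].

(** Zorn's lemma for reverse inclusion. The intersection of a chain inherits Hall's condition
    because the sets are finite: at each x the least set is attained by a member of the chain, and
    for a finite K one member is below all the least sets at points of K. *)
Lemma hall_minimal N : hall N -> exists M, [/\ hall M, forall x, (M x `<=` N x)%fset &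
  forall M', hall M' -> (forall x, M' x `<=` M x)%fset -> M' =1 M].
Proof.
move=> hallN.
have [||||[M PM] Mmin] := @Zorn (sub_system N) (@finer N).
- by move=> t; apply/asboolP => x.
- move=> r s t /asboolP rs /asboolP st; apply/asboolP => x.
  exact: fsubset_trans (st x) (rs x).
- move=> [s Ps] [t Pt] /asboolP/= st /asboolP/= ts; apply: eq_exist.
  by apply/funext => x; apply/eqP; rewrite eqEfsubset st ts.
- move=> C Ctot; have [[s0 Cs0]|C0] := pselect (exists s, C s); last first.
    have PN : `[< hall N /\ forall x, (N x `<=` N x)%fset >] by apply/asboolP.
    by exists (exist _ N PN) => s Cs; exfalso; apply: C0; exists s.
  have min_ex x : exists s, C s /\ forall s', C s' -> (sval s x `<=` sval s' x)%fset.
    have [n [[s [Cs sn]] nmin]] : exists n, (exists s, C s /\ #|` sval s x| = n) /\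
        forall s', C s' -> (n <= #|` sval s' x|)%N.
      have ex : exists n, `[< exists s, C s /\ #|` sval s x| = n >].
        by exists #|` sval s0 x|; apply/asboolP; exists s0.
      case: (ex_minnP ex) => n /asboolP Pn nmin; exists n; split=> // s' Cs'.
      by apply: nmin; apply/asboolP; exists s'.
    exists s; split=> // s' Cs'.
    have [/asboolP/(_ x) s's|/asboolP//] := Ctot _ _ Cs Cs'.
    have := nmin _ Cs'; rewrite -sn => ss'.
    by rewrite -(eqP (_ : sval s' x == sval s x)) // eqEfcard s's.
  have [m Hm] := choice min_ex.
  pose t x := sval (m x) x.
  have Pt : `[< hall t /\ forall x, (t x `<=` N x)%fset >].
    apply/asboolP; split=> [K|x]; last first.
      by rewrite /t; case: (m x) => /= s /asboolP[_ ]; apply.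
    have [s [Cs st]] : exists s, C s /\ forall x, x \in K -> (sval s x `<=` t x)%fset.
      suff : forall r : seq X, exists s, C s /\ forall x, x \in r -> (sval s x `<=` t x)%fset.
        exact.
      elim=> [|x r [s [Cs sr]]]; first by exists s0.
      have [/asboolP ms|/asboolP ms] := Ctot _ _ Cs (Hm x).1.
        exists (m x); split=> [|y]; first exact: (Hm x).1.
        rewrite inE => /predU1P[->//|yr]; exact: fsubset_trans (ms y) (sr _ yr).
      exists s; split=> // y; rewrite inE => /predU1P[->|]; [exact: ms|exact: sr].
    have [hs _] : hall (sval s) /\ forall x, (sval s x `<=` N x)%fset.
      by case: (s) => /= ? /asboolP.
    exact: leq_trans (hs K) (fsubset_leq_card (neighbourhoodS st)).
  exists (exist _ t Pt) => s Cs; apply/asboolP => x /=.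
  exact: (Hm x).2.
have /asboolP[hM MN] := PM.
exists M; split=> // M' hM' M'M.
have PM' : `[< hall M' /\ forall x, (M' x `<=` N x)%fset >].
  by apply/asboolP; split=> // x; exact: fsubset_trans (M'M x) (MN x).
have := Mmin (exist _ M' PM'); rewrite /finer => /(_ _)/(congr1 sval)/= -> //.
exact/asboolP.
Qed.

(* Rado's proof: in a minimal system satisfying Hall's condition all sets are singletons, by
   submodularity of the cardinal of a union. *)
Lemma marriage N : hall N -> exists f : X -> Y, injective f /\ forall x, f x \in N x.
Proof.
move=> /hall_minimal[M [hM MN Mmin]].
(* By minimality, deleting a from [M x] violates Hall's condition at some finite set; that set must
   contain x, and K is what remains without x. *)
have violated x a : a \in M x -> exists K, x \notin K /\
    (#|` neighbourhood M K `|` (M x `\ a)| <= #|` K|)%N%fset.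
  move=> aM; pose M' y := if y == x then (M x `\ a)%fset else M y.
  have : ~ hall M'.
    move=> hM'.
    have M'M y : (M' y `<=` M y)%fset.
      by rewrite /M'; case: eqP => [->|//]; exact: fsubD1set.
    have := Mmin _ hM' M'M x; rewrite /M' eqxx => /fsetP/(_ a).
    by rewrite !inE eqxx aM.
  move=> /existsNP[K /negP]; rewrite -ltnNge => K_lt.
  have xK : x \in K.
    apply: contraT => xK; move: K_lt; rewrite ltnNge.
    rewrite (leq_trans (hM K))//; apply/fsubset_leq_card/neighbourhoodS => y yK.
    by rewrite /M'; case: eqP => // yx; rewrite yx (negbTE xK) in yK.
  exists (K `\ x)%fset; split; first by rewrite !inE eqxx.
  rewrite -ltnS; move: K_lt; rewrite (cardfsD1 x K) xK add1n.
  apply: leq_trans; rewrite ltnS; apply: fsubset_leq_card.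
  apply/fsubsetP => y; rewrite in_fsetU => /orP[/neighbourhoodP[z]|yM].
    rewrite !inE => /andP[zx zK] yM; apply/neighbourhoodP; exists z => //.
    by rewrite /M' (negbTE zx).
  by apply/neighbourhoodP; exists x => //; rewrite /M' eqxx.
have sing x : exists a, M x = [fset a]%fset.
  have := hM [fset x]%fset; rewrite cardfs1 /neighbourhood big_seq_fset1 cardfs_gt0.
  move=> /fset0Pn[a aM]; exists a; apply/fsetP => b; rewrite inE.
  apply/idP/eqP => [bM|->//]; apply/eqP/contraT => ab.
  have [K1 [xK1 cK1]] := violated _ _ aM; have [K2 [xK2 cK2]] := violated _ _ bM.
  (* Since a and b differ, the two enlarged neighbourhoods together contain all of [M x], so Hall's
     condition applies to the union with x added. Together with [cI] this exceeds the sum of the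
     bounds [cK1] and [cK2] by one. *)
  have cU : (#|` K1 `|` K2|.+1 <=
      #|` (neighbourhood M K1 `|` (M x `\ a)) `|` (neighbourhood M K2 `|` (M x `\ b))|)%N%fset.
    have -> : (#|` K1 `|` K2|.+1 = #|` x |` (K1 `|` K2)|)%N%fset.
      by rewrite cardfsU1 inE negb_or xK1 xK2.
    apply: leq_trans (hM _) _; apply/fsubset_leq_card/fsubsetP => y.
    move=> /neighbourhoodP[z]; rewrite in_fset1U in_fsetU => /or3P[/eqP->|zK|zK] yM.
    - rewrite !in_fsetU !in_fsetD1 yM !andbT.
      by have [->|] := eqVneq y b; rewrite ?ab ?orbT.
    - by rewrite !in_fsetU; apply/orP; left; apply/orP; left; apply/neighbourhoodP; exists z.
    - by rewrite !in_fsetU; apply/orP; right; apply/orP; left; apply/neighbourhoodP; exists z.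
  have cI : (#|` K1 `&` K2| <=
      #|` (neighbourhood M K1 `|` (M x `\ a)) `&` (neighbourhood M K2 `|` (M x `\ b))|)%N%fset.
    apply: leq_trans (hM _) _; apply/fsubset_leq_card/fsubsetP => y.
    move=> /neighbourhoodP[z]; rewrite in_fsetI => /andP[z1 z2] yM.
    rewrite in_fsetI !in_fsetU; apply/andP; split; apply/orP; left;
      by apply/neighbourhoodP; exists z.
  have := leq_add cU cI; rewrite addSn !cardfsUI => H.
  by have := leq_trans H (leq_add cK1 cK2); rewrite ltnn.
have [f fM] := choice sing; exists f; split=> [x y fxy|x]; last first.
  by apply: (fsubsetP (MN x)); rewrite fM inE.
apply/eqP/contraT => xy.
have := hM [fset x; y]%fset; rewrite cardfs2 xy.
rewrite leqNgt => /negP[]; rewrite ltnS.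
suff -> : neighbourhood M [fset x; y]%fset = [fset f x]%fset by rewrite cardfs1.
apply/fsetP => z; rewrite inE; apply/neighbourhoodP/eqP => [[w]|->].
  by rewrite !inE => /orP[] /eqP ->; rewrite fM inE => /eqP ->.
by exists x; rewrite ?inE ?eqxx// fM inE.
Qed.

End marriage.

(** * Invariant means and sets that do not double *)

Section means.
Context (R : realType) (G : groupType).

Definition right_invariant_mean (m : set G -> R) := [/\ forall B, 0 <= m B,
  m setT = 1, forall B C, B `&` C = set0 -> m (B `|` C) = m B + m C
  & forall B (g : G), m [set (x * g)%g | x in B] = m B].

Let inverse_set (B : set G) : set G := [set x | B (x^-1)%g].

Lemma inverse_setU B C : inverse_set (B `|` C) = inverse_set B `|` inverse_set C.
Proof. by []. Qed.

(** Inversion of sets exchanges left and right translations. The walks below move mass by right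
    multiplication. *)
Lemma amenable_right : amenable R G <-> exists m, right_invariant_mean m.
Proof.
split=> -[m [m0 m1 mU mg]]; exists (m \o inverse_set); split=> //=.
- move=> B C BC; rewrite inverse_setU mU//; apply/seteqP; split=> // x [Bx Cx].
  by have : set0 (x^-1)%g by rewrite -BC.
- move=> B g; rewrite -[RHS](mg (g^-1)%g); congr m.
  apply/seteqP; split=> x; rewrite /inverse_set/=.
    move=> [y By yx]; exists (y^-1)%g; rewrite ?invgK//.
    by rewrite -invgM yx invgK.
  by move=> [y By <-]; exists (y^-1)%g => //; rewrite invgM invgK.
- move=> B C BC; rewrite inverse_setU mU//; apply/seteqP; split=> // x [Bx Cx].
  by have : set0 (x^-1)%g by rewrite -BC.
- move=> g B; rewrite -[RHS](mg _ (g^-1)%g); congr m.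
  apply/seteqP; split=> x; rewrite /inverse_set/=.
    move=> [y By yx]; exists (y^-1)%g; rewrite ?invgK//.
    by rewrite -invgM yx invgK.
  by move=> [y By <-]; exists (y^-1)%g => //; rewrite invgM invgK.
Qed.

(** B splits into finitely many pieces according to the increment x^-1 f(x), and f is a right
    translation on each; injectivity keeps the images disjoint. *)
Lemma mean_piecewise_translation (m : set G -> R) (E : seq G) (B : set G) (f : G -> G) :
  right_invariant_mean m ->
  (forall x y, B x -> B y -> f x = f y -> x = y) ->
  (forall x, B x -> (x^-1 * f x)%g \in E) -> m (f @` B) = m B.
Proof.
move=> [m0 m1 mU mg]; elim: E B => [|e E IH] B fI fE.
  suff -> : B = set0 by rewrite image_set0.
  by apply/seteqP; split=> // x /fE.
pose B1 := B `&` [set x | f x = (x * e)%g]; pose B2 := B `\` [set x | f x = (x * e)%g].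
have BE : B = B1 `|` B2 by rewrite /B1 /B2 setUIDK.
rewrite {1}BE image_setU mU.
  rewrite (IH B2); first last.
  - move=> x [Bx fx]; have := fE x Bx; rewrite inE => /predU1P[H|//].
    by case: fx; rewrite /= -H mulVKg.
  - by move=> x y [Bx _] [By _]; exact: fI.
  rewrite (_ : f @` B1 = [set (x * e)%g | x in B1]) ?mg.
    by rewrite [in RHS]BE mU// /B1 /B2 setDE setIACA setICr setI0.
  apply/seteqP; split=> y [x B1x <-]; exists x => //.
    by case: B1x => _ /= ->.
  by case: B1x => _ /= ->.
apply/seteqP; split=> // y [[x [Bx fx]] <-] [z [Bz fz]] zx.
by apply: fz; have -> := fI _ _ Bz Bx zx.
Qed.

(** If every nonempty finite K doubled, marrying two copies of G into G would give two piecewise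
    translations with increments in E and disjoint ranges. Each range has mean 1, which exceeds the
    total mean. *)
Lemma amenable_no_doubling (E : {fset G}) : amenable R G ->
  exists K : {fset G}, (#|` K| > 0)%N /\
    (#|` [fset (x * e)%g | x in K, e in E]| < 2 * #|` K|)%N%fset.
Proof.
move=> /amenable_right[m mm]; apply: contrapT => H.
(* The boolean tag makes two copies of each point, so that Hall's condition becomes the doubling of
   finite sets. *)
pose N (xb : G * bool) := [fset (xb.1 * e)%g | e in E]%fset.
have hallN : hall N.
  move=> K; pose K' := [fset xb.1 | xb in K]%fset.
  have -> : neighbourhood N K = [fset (x * e)%g | x in K', e in E]%fset.
    apply/fsetP => y; apply/neighbourhoodP/imfset2P.
      move=> [xb xbK /imfsetP[e /= eE ->]]; exists xb.1; last by exists e.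
      by apply/imfsetP; exists xb.
    move=> [_ /imfsetP[xb /= xbK ->] [e eE ->]]; exists xb => //.
    by apply/imfsetP; exists e.
  have K2 : (#|` K| <= 2 * #|` K'|)%N.
    have KK' : (K `<=` [fset (x, true) | x in K'] `|` [fset (x, false) | x in K'])%fset.
      apply/fsubsetP => -[x b] xbK; rewrite in_fsetU; apply/orP.
      have xK : x \in K' by apply/imfsetP; exists (x, b).
      by case: b xbK => _; [left|right]; apply/imfsetP; exists x.
    apply: leq_trans (fsubset_leq_card KK') _.
    rewrite cardfsU mul2n -addnn; apply: leq_trans (leq_subr _ _) _.
    by apply: leq_add; exact: leq_imfset_card.
  have [K0|K0] := posnP #|` K'|.
    by apply: leq_trans K2 _; rewrite K0 muln0.
  rewrite leqNgt; apply/negP => lt; apply: H; exists K'; split=> //.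
  exact: leq_trans lt K2.
have [f [fI fN]] := marriage hallN.
have fE b x : (x^-1 * f (x, b))%g \in enum_fset E.
  by have /imfsetP[e /= eE ->] := fN (x, b); rewrite mulKg.
have mT b : m (range (fun x => f (x, b))) = 1.
  rewrite (@mean_piecewise_translation m E) //.
  - by case: mm.
  - by move=> x y _ _ /fI[].
have [m0 m1 mU mg] := mm.
have Hd : range (fun x => f (x, true)) `&` range (fun x => f (x, false)) = set0.
  by apply/seteqP; split=> // y [[x _ <-] [z _ /fI[]]].
have := mU _ _ Hd; rewrite !mT.
have := mU _ (~` (range (fun x => f (x, true)) `|` range (fun x => f (x, false))))
  (setICr _).
rewrite setUCr m1 => /eqP; rewrite eq_sym => /eqP H1 H2.
have := m0 (~` (range (fun x => f (x, true)) `|` range (fun x => f (x, false)))).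
move: H1 H2; set a := m _; set b := m _; lra.
Qed.

End means.

(** * Walks on a finite set times a group *)

(** The limit along an ultrafilter that refines convergence to infinity; it exists for bounded
    sequences by compactness of a segment. *)
Lemma bounded_limit_functional (R : realType) : exists L : (nat -> R) -> R,
  [/\ forall (c : R) (u v : nat -> R) (M : R),
        (forall n, `|u n| <= M) -> (forall n, `|v n| <= M) ->
        L (fun n => c * u n + v n) = c * L u + L v,
      forall (u : nat -> R) (M : R), (forall n, 0 <= u n <= M) -> 0 <= L u
    & forall (u : nat -> R) (l : R), u @ \oo --> l -> L u = l].
Proof.
have [U [UU UF]] := ultraFilterLemma (eventually_filter : ProperFilter \oo).
have cvgU (u : nat -> R) (M : R) : (forall n, `|u n| <= M) -> cvg (u @ U).
  move=> uM; have cptM : compact `[- M, M]%classic by exact: segment_compact.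
  have [|l [_ ul]] := cptM (u @ U) (fmap_proper_filter u _).
    by apply: (@filterE _ U) => n /=; rewrite in_itv/= -ler_norml.
  apply/cvg_ex; exists l => A Al.
  have [//|FnA] := in_ultra_setVsetC (u @^-1` A) UU.
  by have [x []] := ul (~` A) A FnA Al.
exists (fun u => lim (u @ U)); split.
- move=> c u v M uM vM; apply: cvg_lim => //.
  apply: cvgD; last exact: (cvgU v M).
  by apply: cvgM; [exact: cvg_cst|exact: (cvgU u M)].
- move=> u M uM; apply: limr_ge.
    by apply: (cvgU u M) => n; have /andP[u0 un] := uM n; rewrite ger0_norm.
  by apply: filterE => n; have /andP[] := uM n.
- move=> u l ul; apply: cvg_lim => //; apply: cvg_trans ul.
  by move=> A /= /UF.
Qed.

(** * Operators that commute with left translations *)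

Section equivariant.
Context (R : realType) (S I : finType) (G : groupType).
Variables (s : I -> S -> S) (psi : I -> G).
Implicit Types (F : S -> G -> R) (q : I -> S -> R) (w : seq I) (om : S -> R).

(** The shape of a transfer operator on a group extension: [s i v] is the state after the letter i
    has been put in front, [q i v] its weight, and the group coordinate is moved back by [psi i]. *)
Definition transition q F : S -> G -> R :=
  fun v g => \sum_i q i v * F (s i v) (g * (psi i)^-1)%g.

Definition sip om F F' : R := \sum_v om v * fsum (fun g => F v g * F' v g).
Definition sqnorm om F : R := \sum_v om v * fsum (fun g => F v g ^+ 2).
Definition ffs F := forall v, fsupp (F v).

Lemma ffs_transition q F : ffs F -> ffs (transition q F).
Proof. by move=> fF v; apply: fsupp_sum => i _; apply/fsuppMr/fsupp_mulr. Qed.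

Lemma ffs_iter q F n : ffs F -> ffs (iter n (transition q) F).
Proof. by move=> fF; elim: n => //= n; exact: ffs_transition. Qed.

Lemma ffsB F F' : ffs F -> ffs F' -> ffs (fun v g => F v g - F' v g).
Proof. by move=> fF fF' v; apply: fsuppB. Qed.

Lemma transition_ge0 q F : (forall i v, 0 <= q i v) -> (forall v g, 0 <= F v g) ->
  forall v g, 0 <= transition q F v g.
Proof. by move=> q0 F0 v g; apply: sumr_ge0 => i _; apply: mulr_ge0. Qed.

Lemma iter_transition_ge0 q F n : (forall i v, 0 <= q i v) -> (forall v g, 0 <= F v g) ->
  forall v g, 0 <= iter n (transition q) F v g.
Proof. by move=> q0 F0; elim: n => //= n IH; exact: transition_ge0. Qed.

Lemma norm_iter_transition q F n : (forall i v, 0 <= q i v) ->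
  forall v g, `|iter n (transition q) F v g| <=
    iter n (transition q) (fun v g => `|F v g|) v g.
Proof.
move=> q0; elim: n => //= n IH v g.
apply: le_trans (ler_norm_sum _ _ _) _; apply: ler_sum => i _.
by rewrite normrM ger0_norm// ler_wpM2l.
Qed.

Lemma transitionZ q c F v g :
  transition q (fun v g => c * F v g) v g = c * transition q F v g.
Proof. by rewrite /transition mulr_sumr; apply: eq_bigr => i _; rewrite mulrCA. Qed.

Lemma transition_sum q (J : Type) (r : seq J) (F : J -> S -> G -> R) v g :
  transition q (fun v g => \sum_(j <- r) F j v g) v g =
  \sum_(j <- r) transition q (F j) v g.
Proof.
rewrite /transition exchange_big/=; apply: eq_bigr => i _.
by rewrite mulr_sumr.
Qed.

Lemma eq_sqnorm om F F' : (forall v g, F v g = F' v g) -> sqnorm om F = sqnorm om F'.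
Proof.
move=> FF'; apply: eq_bigr => v _; congr (_ * _); apply: eq_fsum => g.
by rewrite FF'.
Qed.

Section weights.
Variable om : S -> R.
Hypothesis om0 : forall v, 0 <= om v.

Lemma sqnorm_ge0 F : 0 <= sqnorm om F.
Proof.
apply: sumr_ge0 => v _; apply: mulr_ge0 => //; apply: fsum_ge0 => g.
exact: sqr_ge0.
Qed.

Lemma sqnormZ c F : sqnorm om (fun v g => c * F v g) = c ^+ 2 * sqnorm om F.
Proof.
rewrite /sqnorm mulr_sumr; apply: eq_bigr => v _; rewrite mulrCA -(fsumZ (c ^+ 2)).
by congr (_ * _); apply: eq_fsum => g; rewrite exprMn.
Qed.

Lemma le_sqnorm F F' : ffs F -> ffs F' -> (forall v g, `|F v g| <= `|F' v g|) ->
  sqnorm om F <= sqnorm om F'.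
Proof.
move=> fF fF' FF'; apply: ler_sum => v _; apply: ler_wpM2l => //.
apply: le_fsum; [exact: fsuppX|exact: fsuppX|] => g.
by rewrite -(real_normK (num_real (F v g))) -(real_normK (num_real (F' v g))) lerXn2r.
Qed.

Lemma sipBl F F' F'' : ffs F -> ffs F' -> sip om (fun v g => F v g - F' v g) F'' =
  sip om F F'' - sip om F' F''.
Proof.
move=> fF fF'; rewrite /sip -sumrB; apply: eq_bigr => v _.
rewrite -mulrBr -fsumB; [|exact: fsuppMl|exact: fsuppMl].
by congr (_ * _); apply: eq_fsum => g; rewrite mulrBl.
Qed.

Lemma sip_sqnorm F : sip om F F = sqnorm om F.
Proof. by apply: eq_bigr => v _; congr (_ * _); apply: eq_fsum => g; rewrite expr2. Qed.

Lemma sqnorm_comb s0 t0 F F' : ffs F -> ffs F' ->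
  sqnorm om (fun v g => s0 * F v g + t0 * F' v g) =
  s0 ^+ 2 * sqnorm om F + s0 * t0 * sip om F F' *+ 2 + t0 ^+ 2 * sqnorm om F'.
Proof.
move=> fF fF'; rewrite /sqnorm /sip !mulr_sumr -sumrMnl -!big_split/=.
apply: eq_bigr => v _.
have f1 : fsupp (fun g => s0 ^+ 2 * F v g ^+ 2) by apply/fsuppMr/fsuppX.
have f2 : fsupp (fun g => t0 ^+ 2 * F' v g ^+ 2) by apply/fsuppMr/fsuppX.
have f3 : fsupp (fun g => s0 * t0 *+ 2 * (F v g * F' v g)) by apply/fsuppMr/fsuppMl.
rewrite (eq_fsum (g := fun g => s0 ^+ 2 * F v g ^+ 2 + s0 * t0 *+ 2 * (F v g * F' v g) +
  t0 ^+ 2 * F' v g ^+ 2)); last by move=> g; ring.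
rewrite fsumD; [|exact: fsuppD|by[]].
by rewrite fsumD// !fsumZ; ring.
Qed.

Lemma sip_cauchy F F' : ffs F -> ffs F' ->
  sip om F F' ^+ 2 <= sqnorm om F * sqnorm om F'.
Proof.
move=> fF fF'; apply: sqr_le_discriminant => s0 t0.
by rewrite -sqnorm_comb// sqnorm_ge0.
Qed.

Lemma sqnormB_le F F' : ffs F -> ffs F' ->
  sqnorm om (fun v g => F v g - F' v g) <= 2 * sqnorm om F + 2 * sqnorm om F'.
Proof.
move=> fF fF'.
have := sqnorm_ge0 (fun v g => 1 * F v g + 1 * F' v g).
rewrite sqnorm_comb// => H1.
rewrite (@eq_sqnorm om _ (fun v g => 1 * F v g + (-1) * F' v g)); last first.
  by move=> v g; rewrite mul1r mulN1r.
rewrite sqnorm_comb//; move: H1.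
by set a := sqnorm _ _; set b := sqnorm _ _; set c := sip _ _ _; lra.
Qed.

End weights.

(** * Markov chains with a group coordinate *)

Section walk.
Variables (p : I -> S -> R) (om : S -> R).
Hypothesis p0 : forall i v, 0 <= p i v.
Hypothesis p1 : forall v, \sum_i p i v = 1.
Hypothesis om_gt0 : forall v, 0 < om v.
Hypothesis stationary :
  forall f : S -> R, \sum_v om v * (\sum_i p i v * f (s i v)) = \sum_v om v * f v.

Local Notation Q := (transition p).

Let om0 v : 0 <= om v. Proof. exact: ltW. Qed.

Lemma jensen_sqr v (f : I -> R) : (\sum_i p i v * f i) ^+ 2 <= \sum_i p i v * f i ^+ 2.
Proof.
have -> : \sum_i p i v * f i ^+ 2 = 1 * (\sum_i p i v * f i ^+ 2) by rewrite mul1r.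
apply: sqr_le_discriminant => s0 t0.
rewrite -{1}(p1 v) !mulr_sumr -sumrMnl -!big_split/=; apply: sumr_ge0 => i _.
have -> : s0 ^+ 2 * p i v + s0 * t0 * (p i v * f i) *+ 2 + t0 ^+ 2 * (p i v * f i ^+ 2) =
  p i v * (s0 + t0 * f i) ^+ 2 by ring.
by apply: mulr_ge0 => //; exact: sqr_ge0.
Qed.

Lemma sqnorm_walk_shift F : sqnorm om F =
  \sum_v om v * \sum_i p i v * fsum (fun g => F (s i v) (g * (psi i)^-1)%g ^+ 2).
Proof.
rewrite /sqnorm -(stationary (fun v => fsum (fun g => F v g ^+ 2))).
apply: eq_bigr => v _; congr (_ * _); apply: eq_bigr => i _; congr (_ * _).
by rewrite (fsum_mulr _ (fun g => F (s i v) g ^+ 2)).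
Qed.

Lemma sqnorm_walk F : ffs F -> sqnorm om (Q F) <= sqnorm om F.
Proof.
move=> fF; rewrite [leRHS]sqnorm_walk_shift; apply: ler_sum => v _; apply: ler_wpM2l => //.
have fi i : fsupp (fun g => p i v * F (s i v) (g * (psi i)^-1)%g ^+ 2).
  by apply/fsuppMr/fsuppX/fsupp_mulr.
under [leRHS]eq_bigr => i _ do rewrite -fsumZ.
rewrite -fsum_sum//; apply: le_fsum; [|exact: fsupp_sum|] => [|g].
  by apply/fsuppX/ffs_transition.
exact: jensen_sqr.
Qed.

Lemma sqnorm_iter_walk F m n : ffs F -> (m <= n)%N ->
  sqnorm om (iter n Q F) <= sqnorm om (iter m Q F).
Proof.
move=> fF /subnK <-; elim: (n - m)%N => [|k IH]; first by rewrite add0n.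
rewrite addSn /=; apply: le_trans IH; apply: sqnorm_walk; exact: ffs_iter.
Qed.

(* With F >= 0 the orbit sum of F over N steps has square norm at least the sum of the square
   norms, while it is moved by Q by at most 2|F|. *)
Lemma almost_invariant_walk :
  (forall N, exists F, ffs F /\ sqnorm om F < 4 * sqnorm om (iter N Q F)) ->
  forall e, 0 < e -> exists F, [/\ ffs F, sqnorm om F = 1 &
    sqnorm om (fun v g => Q F v g - F v g) <= e].
Proof.
(* The orbit sum is moved by a vector of square norm at most 4|F|^2 < 16 |Q^N F|^2, and its own
   square norm is at least N |Q^N F|^2; hence 16 / e steps suffice. *)
move=> gap e e0; pose N := (Num.truncn (16 / e)).+1.
have NR : 16 <= e * N%:R.
  rewrite mulrC -ler_pdivrMr//; apply: ltW.
  by have /andP[] := truncn_itv (divr_ge0 (ler0n R 16) (ltW e0)).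
have [F1 [fF1 gapF1]] := gap N.
(* Absolute values keep the norm of [F1] and can only increase that of its image, since the weights
   are nonnegative. *)
pose F v g := `|F1 v g|.
have fF : ffs F by move=> v; apply: fsupp_norm.
have F0 v g : 0 <= F v g by exact: normr_ge0.
have FF1 : sqnorm om F = sqnorm om F1.
  apply: eq_bigr => v _; congr (_ * _); apply: eq_fsum => g.
  exact: real_normK (num_real _).
have gapF : sqnorm om F < 4 * sqnorm om (iter N Q F).
  rewrite FF1; apply: lt_le_trans gapF1 _; rewrite ler_pM2l//.
  apply: le_sqnorm => //; [exact: ffs_iter|exact: ffs_iter|] => v g.
  apply: le_trans (norm_iter_transition _ _ p0 v g) _; exact: ler_norm.
pose Ft v g := \sum_(n < N) iter n Q F v g.
have fFt : ffs Ft by move=> v; apply: fsupp_sum => n _; exact: ffs_iter.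
have FtN : N%:R * sqnorm om (iter N Q F) <= sqnorm om Ft.
  have : \sum_(n < N) sqnorm om (iter n Q F) <= sqnorm om Ft.
    rewrite /sqnorm exchange_big/=; apply: ler_sum => v _.
    rewrite -mulr_sumr; apply: ler_wpM2l => //.
    rewrite -fsum_sum => [|n _]; last by apply/fsuppX/ffs_iter.
    apply: le_fsum; [|exact: fsuppX|] => [|g].
      by apply: fsupp_sum => n _; apply/fsuppX/ffs_iter.
    have H0 n : 0 <= iter n Q F v g by exact: iter_transition_ge0.
    rewrite /Ft expr2 mulr_suml; apply: ler_sum => n _.
    rewrite expr2; apply: ler_wpM2l => //.
    by rewrite (bigD1 n)//= lerDl; apply: sumr_ge0.
  apply: le_trans.
  have -> : N%:R * sqnorm om (iter N Q F) = \sum_(n < N) sqnorm om (iter N Q F).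
    by rewrite sumr_const card_ord mulr_natl.
  by apply: ler_sum => n _; apply: sqnorm_iter_walk => //; exact: ltnW.
have Fpos : 0 < sqnorm om (iter N Q F).
  have := le_lt_trans (sqnorm_ge0 om0 F) gapF; by rewrite pmulr_rgt0.
have Ftpos : 0 < sqnorm om Ft.
  by apply: lt_le_trans FtN; rewrite mulr_gt0.
have QFt v g : Q Ft v g - Ft v g = iter N Q F v g - F v g.
  rewrite transition_sum -sumrB.
  have -> : \sum_(n < N) (Q (fun v g => iter n Q F v g) v g - iter n Q F v g) =
    \sum_(0 <= n < N) (iter n.+1 Q F v g - iter n Q F v g) by rewrite big_mkord.
  by rewrite telescope_sumr.
have small : sqnorm om (fun v g => Q Ft v g - Ft v g) <= e * sqnorm om Ft.
  rewrite (eq_sqnorm om QFt).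
  have := sqnormB_le om0 (ffs_iter p N fF) fF.
  have := @sqnorm_iter_walk F 0 N fF isT; rewrite /=.
  have : e * (N%:R * sqnorm om (iter N Q F)) <= e * sqnorm om Ft by rewrite ler_pM2l.
  have : 16 * sqnorm om (iter N Q F) <= e * N%:R * sqnorm om (iter N Q F) by rewrite ler_pM2r.
  rewrite mulrA; move: gapF; set a := sqnorm _ F; set b := sqnorm _ _; lra.
pose c := (Num.sqrt (sqnorm om Ft))^-1.
have c2 : c ^+ 2 = (sqnorm om Ft)^-1 by rewrite exprVn sqr_sqrtr// ltW.
exists (fun v g => c * Ft v g); split.
- by move=> v; apply: fsuppMr.
- by rewrite sqnormZ c2 mulVf// gt_eqF.
- rewrite (@eq_sqnorm om _ (fun v g => c * (Q Ft v g - Ft v g))); last first.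
    by move=> v g; rewrite transitionZ mulrBr.
  by rewrite sqnormZ c2 ler_pdivrMl// mulrC.
Qed.

(** Expand the square: by stationarity both square terms sum to [sqnorm om F], and the cross terms
    give -2 [sip om (Q F) F]. *)
Lemma dirichlet_form F : ffs F ->
  \sum_v om v * \sum_i p i v * fsum (fun g => (F (s i v) (g * (psi i)^-1)%g - F v g) ^+ 2)
  = 2 * sip om (fun v g => F v g - Q F v g) F.
Proof.
move=> fF; rewrite sipBl//; last exact: ffs_transition.
rewrite sip_sqnorm mulrBr; apply/eqP; rewrite eq_sym subr_eq; apply/eqP.
have -> : 2 * sip om (Q F) F = \sum_v 2 * (om v * fsum (fun g => Q F v g * F v g)).
  by rewrite mulr_sumr.
have addE (x y : S -> R) : \sum_v x v + \sum_v y v = \sum_v (x v + y v).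
  by rewrite big_split.
rewrite mulr_natl mulr2n {1}sqnorm_walk_shift /sqnorm !addE.
apply: eq_bigr => v _.
pose a i := fsum (fun g => F (s i v) (g * (psi i)^-1)%g ^+ 2).
pose b i := fsum (fun g => F (s i v) (g * (psi i)^-1)%g * F v g).
have -> : fsum (fun g => Q F v g * F v g) = \sum_i p i v * b i.
  rewrite (eq_fsum (g := fun g => \sum_i p i v * (F (s i v) (g * (psi i)^-1)%g * F v g))).
    rewrite fsum_sum => [|i _]; last by apply/fsuppMr/fsuppMr.
    by apply: eq_bigr => i _; rewrite fsumZ.
  by move=> g; rewrite /transition mulr_suml; apply: eq_bigr => i _; rewrite mulrA.
have -> : fsum (fun g => F v g ^+ 2) = \sum_i p i v * fsum (fun g => F v g ^+ 2).
  by rewrite -mulr_suml p1 mul1r.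
have addE' (x y : I -> R) : \sum_i x i + \sum_i y i = \sum_i (x i + y i).
  by rewrite big_split.
rewrite [2 * _]mulrCA -!mulrDr mulr_sumr !addE'; congr (_ * _).
apply: eq_bigr => i _; rewrite [2 * _]mulrCA -!mulrDr; congr (_ * _).
have f1 : fsupp (fun g => F (s i v) (g * (psi i)^-1)%g ^+ 2) by apply/fsuppX/fsupp_mulr.
have f2 : fsupp (fun g => F v g ^+ 2) by exact: fsuppX.
have f3 : fsupp (fun g => 2 * (F (s i v) (g * (psi i)^-1)%g * F v g)) by apply/fsuppMr/fsuppMr.
rewrite -fsumZ -!fsumD//; last by apply/fsuppX/fsuppB => //; exact: fsupp_mulr.
by apply: eq_fsum => g; ring.
Qed.

(** The last letter of w acts first, as when w is put in front of a sequence. *)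
Definition act w v := foldr s v w.
Definition wprod w : G := foldr (fun i g => (psi i * g)%g) 1%g w.
Fixpoint positive_path w v :=
  if w is i :: w' then (0 < p i (act w' v)) && positive_path w' v else true.

Hypothesis connected : forall u, exists c, forall v g, exists w,
  [/\ positive_path w v, act w v = u & wprod w = (c * g)%g].

Definition mass F (v : S) (B : set G) : R := fsum (fun g => \1_B g * F v g ^+ 2).

Lemma mass_ge0 F v B : 0 <= mass F v B.
Proof. by apply: fsum_ge0 => g; rewrite mulr_ge0 ?sqr_ge0// indicE. Qed.

Lemma mass_le F v B : ffs F -> sqnorm om F = 1 -> mass F v B <= (om v)^-1.
Proof.
move=> fF F1; rewrite -[leRHS]mulr1 ler_pdivlMl// -F1 /sqnorm (bigD1 v)//=.
rewrite -[leLHS]addr0 lerD//; last first.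
  apply: sumr_ge0 => u _; apply: mulr_ge0 => //; apply: fsum_ge0 => g; exact: sqr_ge0.
apply: ler_wpM2l => //; apply: le_fsum; [exact/fsuppMr/fsuppX|exact: fsuppX|] => g.
by rewrite ler_piMl ?sqr_ge0// indicE; case: (_ \in _).
Qed.

Lemma massU F v B C : ffs F -> B `&` C = set0 -> mass F v (B `|` C) = mass F v B + mass F v C.
Proof.
move=> fF BC; rewrite /mass -fsumD; [|exact/fsuppMr/fsuppX|exact/fsuppMr/fsuppX].
apply: eq_fsum => g; rewrite -mulrDl; congr (_ * _); rewrite !indicE in_setU.
have : g \notin B `&` C by rewrite BC in_set0.
by rewrite in_setI; case: (g \in B); case: (g \in C); rewrite ?addr0 ?add0r.
Qed.

Lemma massT F : ffs F -> \sum_v om v * mass F v setT = sqnorm om F.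
Proof.
move=> fF; apply: eq_bigr => v _; congr (_ * _); apply: eq_fsum => g.
by rewrite indicT mul1r.
Qed.

(** The difference of masses is a sum of (b - a)(b + a) over a set, up to sign, where a and b are
    the values of F at the two ends of the edge. In Cauchy-Schwarz the first factor is one term of
    the Dirichlet form, and the second is bounded because F has norm 1. *)
Lemma mass_shift F i v B : ffs F -> sqnorm om F = 1 ->
  (p i v * om v) * (mass F v B - mass F (s i v) [set (g * (psi i)^-1)%g | g in B]) ^+ 2 <=
  4 * ((om v)^-1 + (om (s i v))^-1) * sip om (fun v g => F v g - Q F v g) F.
Proof.
move=> fF F1.
pose a g := F v g; pose b g := F (s i v) (g * (psi i)^-1)%g.
have fa : fsupp a by exact: (fF v).
have fb : fsupp b by exact: fsupp_mulr.
have -> : mass F (s i v) [set (g * (psi i)^-1)%g | g in B] = fsum (fun g => \1_B g * b g ^+ 2).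
  rewrite /mass -(fsum_mulr (psi i)^-1%g); apply: eq_fsum => g; congr (_ * _).
  rewrite !indicE; suff -> : ((g * (psi i)^-1)%g \in [set (g * (psi i)^-1)%g | g in B]) =
    (g \in B) by [].
  apply/idP/idP; rewrite !inE.
    by move=> [x Bx] /mulIg <-.
  by move=> Bg; exists g.
rewrite /mass -fsumB; [|exact/fsuppMr/fsuppX|exact/fsuppMr/fsuppX].
rewrite (eq_fsum (g := fun g => (b g - a g) * (- \1_B g * (a g + b g)))); last first.
  by move=> g; rewrite /a; ring.
have fba : fsupp (fun g => b g - a g) by exact: fsuppB.
have fab : fsupp (fun g => - \1_B g * (a g + b g)) by exact/fsuppMr/fsuppD.
have cs := fsum_cauchy fba fab.
have bound : fsum (fun g => (- \1_B g * (a g + b g)) ^+ 2) <=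
    2 * ((om v)^-1 + (om (s i v))^-1).
  apply: (@le_trans _ _ (2 * (fsum (fun g => a g ^+ 2) + fsum (fun g => b g ^+ 2)))).
    rewrite -fsumD; [|exact: fsuppX|exact: fsuppX].
    rewrite -fsumZ; apply: le_fsum => [||g].
    - exact: fsuppX.
    - by apply/fsuppMr/fsuppD; exact: fsuppX.
    - rewrite exprMn sqrrN; apply: (@le_trans _ _ ((a g + b g) ^+ 2)).
        have i1 : \1_B g ^+ 2 <= 1 :> R.
          by rewrite indicE; case: (g \in B) => /=; rewrite ?expr1n ?expr0n.
        by rewrite ler_piMl ?sqr_ge0.
      have := sqr_ge0 (a g - b g); rewrite sqrrB sqrrD.
      by move: (a g * b g) (a g ^+ 2) (b g ^+ 2) => x y z; lra.
  rewrite ler_pM2l// lerD//.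
    have := mass_le v setT fF F1; rewrite /mass.
    by rewrite (eq_fsum (g := fun g => a g ^+ 2))// => g; rewrite indicT mul1r.
  have := mass_le (s i v) setT fF F1; rewrite /mass.
  rewrite -(fsum_mulr (psi i)^-1%g).
  by rewrite (eq_fsum (g := fun g => b g ^+ 2))// => g; rewrite indicT mul1r.
have dir : p i v * om v * fsum (fun g => (b g - a g) ^+ 2) <=
    2 * sip om (fun v g => F v g - Q F v g) F.
  rewrite -dirichlet_form// (bigD1 v)//= -[leLHS]addr0; apply: lerD; last first.
    apply: sumr_ge0 => u _; apply: mulr_ge0 => //; apply: sumr_ge0 => k _.
    by apply: mulr_ge0 => //; apply: fsum_ge0 => g; exact: sqr_ge0.
  rewrite [p i v * _]mulrC -mulrA ler_wpM2l// (bigD1 i)//= lerDl.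
  apply: sumr_ge0 => k _.
  by apply: mulr_ge0 => //; apply: fsum_ge0 => g; exact: sqr_ge0.
have pom0 : 0 <= p i v * om v by exact: mulr_ge0.
have C0 : 0 <= 2 * ((om v)^-1 + (om (s i v))^-1) by rewrite mulr_ge0// addr_ge0// invr_ge0.
have D0 : 0 <= fsum (fun g => (b g - a g) ^+ 2) by apply: fsum_ge0 => g; exact: sqr_ge0.
apply: le_trans (ler_wpM2l pom0 cs) _; rewrite mulrA.
apply: le_trans (ler_wpM2l _ bound) _; first exact: mulr_ge0.
by apply: le_trans (ler_wpM2r C0 dir) _; rewrite le_eqVlt; apply/orP; left; apply/eqP; ring.
Qed.

(** Limits [nu v] of the square masses of almost invariant vectors are carried along each edge of
    positive probability by the translation by the inverse of [psi i]. Some [nu u] is nonzero, as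
    the total mass is 1. The element c in [connected] depends on the target only, so there are paths
    from u to u of values c and c g for every g; comparing them shows that [nu u] is
    right-invariant. *)
Lemma walk_amenable :
  (forall N, exists F, ffs F /\ sqnorm om F < 4 * sqnorm om (iter N Q F)) ->
  amenable R G.
Proof.
move=> /almost_invariant_walk ai.
have e_gt0 n : 0 < (n.+1%:R^-1 : R) by rewrite invr_gt0.
have /choice[F HF] : forall n : nat, exists F, [/\ ffs F, sqnorm om F = 1 &
  sqnorm om (fun v g => Q F v g - F v g) <= n.+1%:R^-1] by move=> n; exact: ai.
have fF n : ffs (F n) by have [] := HF n.
have F1 n : sqnorm om (F n) = 1 by have [] := HF n.
have [L [Llin L0 Llim]] := bounded_limit_functional R.
have LD (u v : nat -> R) (M : R) : (forall n, `|u n| <= M) -> (forall n, `|v n| <= M) ->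
    L (fun n => u n + v n) = L u + L v.
  move=> uM vM; rewrite -[L u]mul1r -(Llin 1 u v M)//; congr L; apply/funext => n.
  by rewrite mul1r.
pose nu v B := L (fun n => mass (F n) v B).
have mass_norm n v B : `|mass (F n) v B| <= (om v)^-1.
  by rewrite ger0_norm ?mass_ge0// mass_le.
have nuU v B C : B `&` C = set0 -> nu v (B `|` C) = nu v B + nu v C.
  move=> BC; rewrite /nu -(LD _ _ (om v)^-1)//; congr L; apply/funext => n.
  exact: massU.
have nu0 v B : 0 <= nu v B.
  by apply: (L0 _ (om v)^-1) => n; rewrite mass_ge0 mass_le.
have sip_small n : sip om (fun v g => F n v g - Q (F n) v g) (F n) ^+ 2 <= n.+1%:R^-1.
  have [_ _ small] := HF n.
  apply: le_trans (sip_cauchy om0 _ _) _ => //; first exact/ffsB/ffs_transition.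
  rewrite F1 mulr1; apply: le_trans small.
  rewrite le_eqVlt; apply/orP; left; apply/eqP.
  apply: eq_bigr => v _; congr (_ * _); apply: eq_fsum => g; ring.
have nu_step i v B : 0 < p i v -> nu v B = nu (s i v) [set (g * (psi i)^-1)%g | g in B].
  move=> piv; set B' := [set _ | _ in _].
  pose M := (om v)^-1 + (om (s i v))^-1.
  have M0 : 0 < M by rewrite addr_gt0// invr_gt0.
  pose d n := mass (F n) v B - mass (F n) (s i v) B'.
  pose K := 4 * M / (p i v * om v).
  have K0 : 0 < K by rewrite divr_gt0 ?mulr_gt0.
  (* The square of [d n] is bounded by an inner product of which only the square is known to be
     small; the fourth power avoids a root. *)
  have d4 n : d n ^+ 4 <= K ^+ 2 * n.+1%:R^-1.
    have := @mass_shift (F n) i v B (fF n) (F1 n).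
    rewrite -ler_pdivlMl ?mulr_gt0// -/B' -/(d n) -/M => d2.
    have d2' : d n ^+ 2 <= K * sip om (fun v g => F n v g - Q (F n) v g) (F n).
      by apply: le_trans d2 _; rewrite mulrA /K [_^-1 * _]mulrC.
    rewrite (_ : d n ^+ 4 = (d n ^+ 2) ^+ 2); last by rewrite -exprM.
    apply: le_trans (_ : _ <= (K * sip om (fun v g => F n v g - Q (F n) v g) (F n)) ^+ 2) _.
      by rewrite lerXn2r// nnegrE ?sqr_ge0// (le_trans _ d2')// sqr_ge0.
    by rewrite exprMn ler_wpM2l// sqr_ge0.
  have d4_cvg : (fun n => d n ^+ 4) @ \oo --> (0 : R).
    apply: (@squeeze_cvgr _ _ _ _ (fun=> 0) (fun n => K ^+ 2 * n.+1%:R^-1)).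
    - apply: nearW => n; rewrite d4 andbT.
      by rewrite (_ : d n ^+ 4 = (d n ^+ 2) ^+ 2) ?sqr_ge0// -exprM.
    - exact: cvg_cst.
    - rewrite -[X in _ --> X](mulr0 (K ^+ 2)); apply: cvgM; first exact: cvg_cst.
      exact: cvg_harmonic.
  have d_cvg : d @ \oo --> (0 : R).
    apply/cvgr0Pnorm_lt => e e0.
    have e40 : 0 < e ^+ 4 by rewrite exprn_gt0.
    move/cvgr0Pnorm_lt : d4_cvg => /(_ _ e40); apply: filterS => n.
    by rewrite normrX ltr_pXn2r// ?nnegrE// ltW.
  have : L d = 0 by exact: Llim.
  have nud : nu v B = L (fun n => d n + mass (F n) (s i v) B').
    by congr L; apply/funext => n; rewrite subrK.
  have MdM n : `|d n| <= M.
    apply: le_trans (ler_normB _ _) _; exact: lerD.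
  rewrite nud (LD _ _ M)// => [->|n]; first by rewrite add0r.
  by apply: le_trans (mass_norm n (s i v) B') _; rewrite lerDr invr_ge0.
have nu_path w v B : positive_path w v ->
    nu v B = nu (act w v) [set (g * (wprod w)^-1)%g | g in B].
  elim: w => [|i w IH] /=.
    by move=> _; congr nu; apply/seteqP; split=> x; rewrite /= invg1;
      [move=> Bx; exists x => //; rewrite mulg1|move=> [y By <-]; rewrite mulg1].
  move=> /andP[pi /IH ->]; rewrite (nu_step i)//; congr nu.
  apply/seteqP; split=> x /=.
    by move=> [_ [y By <-] <-]; exists y => //; rewrite invgM mulgA.
  move=> [y By <-]; exists (y * (wprod w)^-1)%g; first by exists y.
  by rewrite invgM mulgA.
have nuT : \sum_v om v * nu v setT = 1.
  suff H : forall r : seq S, L (fun n => \sum_(v <- r) om v * mass (F n) v setT) =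
      \sum_(v <- r) om v * nu v setT.
    rewrite -H (_ : (fun _ => _) = fun=> 1); first by apply: Llim; exact: cvg_cst.
    by apply/funext => n; rewrite massT.
  elim=> [|v r IH].
    rewrite big_nil (_ : (fun _ => _) = fun=> 0); first by apply: Llim; exact: cvg_cst.
    by apply/funext => n; rewrite big_nil.
  rewrite big_cons -IH.
  rewrite -(Llin (om v) _ _ ((om v)^-1 + \sum_(v <- r) om v * (om v)^-1)) => [|n|n].
  - by congr L; apply/funext => n; rewrite big_cons.
  - apply: le_trans (mass_norm n v setT) _; rewrite lerDl; apply: sumr_ge0 => u _.
    by rewrite mulr_ge0// invr_ge0.
  - apply: le_trans (ler_norm_sum _ _ _) _; rewrite -[leLHS]add0r lerD ?invr_ge0//.
    apply: ler_sum => u _; rewrite normrM ger0_norm//; exact: ler_wpM2l.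
have [u nuu] : exists u, 0 < nu u setT.
  apply: contrapT => H; have := @ltr01 R; rewrite -nuT ltNge => /negP; apply.
  apply: sumr_le0 => v _; rewrite pmulr_rle0// leNgt; apply/negP => nuv.
  by apply: H; exists v.
have [c Hc] := connected u.
apply/amenable_right; exists (fun B => nu u B / nu u setT); split.
- by move=> B; rewrite divr_ge0// ltW.
- by rewrite divff// gt_eqF.
- by move=> B C BC; rewrite nuU// mulrDl.
- move=> B g; congr (_ / _).
  have [w [pw aw ww]] := Hc u g; have [w1 [pw1 aw1 ww1]] := Hc u 1%g.
  rewrite (nu_path w u)// [RHS](nu_path w1 u)// aw aw1 ww ww1 mulg1; congr nu.
  apply/seteqP; split=> x /=.
    by move=> [_ [y By <-] <-]; exists y => //; rewrite invgM mulgA mulgK.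
  move=> [y By <-]; exists (y * g)%g; first by exists y.
  by rewrite invgM mulgA mulgK.
Qed.

End walk.

End equivariant.

(** * Amenability and norms of transition operators *)

Section amenable_lower_bound.
Context (R : realType) (S I : finType) (G : groupType).
Variables (s : I -> S -> S) (psi : I -> G) (q : I -> S -> R).
Hypothesis q0 : forall i v, 0 <= q i v.
Variables (H w : S -> R) (lam : R).
Hypothesis w0 : forall v, 0 <= w v.
Hypothesis eigenH : forall v, \sum_i q i v * H (s i v) = lam * H v.

Local Notation T := (transition s psi q).

(** This set contains the values of all words of length n; the n-th iterate of [T] spreads a support
    K into its translates by it. *)
Let products n : {fset G} :=
  iter n (fun E : {fset G} => [fset (x * y)%g | x in E, y in [fset psi i | i : I]]%fset)
    [fset 1%g]%fset.

Let translates (K E : {fset G}) : {fset G} := [fset (x * y)%g | x in K, y in E]%fset.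

Lemma iter_transition_support (K : {fset G}) (F : S -> G -> R) n :
  (forall v g, g \notin K -> F v g = 0) ->
  forall v g, g \notin translates K (products n) -> iter n T F v g = 0.
Proof.
move=> FK; elim: n => [|n IH] v g gK.
  apply: FK; apply: contra gK => gK; apply/imfset2P; exists g => //; exists 1%g.
    by rewrite inE.
  by rewrite mulg1.
rewrite iterS; apply: big1 => i _; rewrite IH ?mulr0//.
apply: contra gK => /imfset2P[x /= xK [y /= yE gxy]]; apply/imfset2P.
exists x => //; exists (y * psi i)%g; last by rewrite mulgA -gxy mulgVK.
by apply/imfset2P; exists y => //; exists (psi i) => //; apply/imfsetP; exists i.
Qed.

Lemma fsum_iter_transition (F : S -> G -> R) c n : ffs F ->
  (forall v, fsum (F v) = c * H v) ->
  forall v, fsum (iter n T F v) = c * lam ^+ n * H v.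
Proof.
move=> fF FH; elim: n => [|n IH] v; first by rewrite FH expr0 mulr1.
have fi i : fsupp (fun g => q i v * iter n T F (s i v) (g * (psi i)^-1)%g).
  by apply/fsuppMr/fsupp_mulr/ffs_iter.
rewrite (fsum_sum _ (fun i _ => fi i)).
under eq_bigr => i _ do rewrite fsumZ (fsum_mulr _ (iter n T F (s i v))) IH mulrCA.
by rewrite -mulr_sumr eigenH exprS; ring.
Qed.

(** Let F be H on a set K that does not double under [products n]. The sum of the n-th iterate over
    each fibre is exactly lam^n |K| H(v), spread over fewer than 2|K| points, so Cauchy-Schwarz
    bounds its square sum below. The factor 2 does not depend on n. *)
Lemma amenable_transition n : amenable R G -> (exists v, 0 < w v /\ H v != 0) ->
  exists F, [/\ ffs F, 0 < sqnorm w F &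
    lam ^+ n ^+ 2 * sqnorm w F <= 2 * sqnorm w (iter n T F)].
Proof.
move=> am [v0 [wv0 Hv0]].
have [K [K0 KE]] := amenable_no_doubling (products n) am.
rewrite -/(translates K (products n)) in KE.
set KP := translates K (products n) in KE.
pose F v g : R := if g \in K then H v else 0.
have FK v g : g \notin K -> F v g = 0 by rewrite /F => /negbTE ->.
have fF : ffs F by move=> v; exists K; exact: FK.
have sumF v : fsum (F v) = #|` K|%:R * H v.
  rewrite (fsumE (FK v)) big_seq (eq_bigr (fun=> H v)) -?big_seq => [|g gK].
    by rewrite big_const_seq count_predT iter_addr_0 mulr_natl.
  by rewrite /F gK.
have sumF2 v : fsum (fun g => F v g ^+ 2) = #|` K|%:R * H v ^+ 2.
  rewrite (@fsumE _ _ K) => [|g /FK ->]; last by rewrite expr0n.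
  rewrite big_seq (eq_bigr (fun=> H v ^+ 2)) -?big_seq => [|g gK].
    by rewrite big_const_seq count_predT iter_addr_0 mulr_natl.
  by rewrite /F gK.
exists F; split=> //.
  rewrite /sqnorm (bigD1 v0)//=; apply: ltr_pwDl.
    by rewrite sumF2 mulr_gt0// mulr_gt0 ?ltr0n// exprn_even_gt0.
  by apply: sumr_ge0 => v _; rewrite sumF2 mulr_ge0// mulr_ge0// sqr_ge0.
rewrite /sqnorm !mulr_sumr; apply: ler_sum => v _.
rewrite mulrCA [leRHS]mulrCA; apply: ler_wpM2l => //; rewrite sumF2.
have fT : fsupp (iter n T F v) by exact: ffs_iter.
have T0 g : g \notin KP -> iter n T F v g = 0 by exact: iter_transition_support.
pose one (g : G) : R := if g \in KP then 1 else 0.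
have one0 g : g \notin KP -> one g = 0 by rewrite /one => /negbTE ->.
have f1 : fsupp one by exists KP; exact: one0.
have := fsum_cauchy f1 fT.
have -> : fsum (fun g => one g * iter n T F v g) = #|` K|%:R * lam ^+ n * H v.
  rewrite -(fsum_iter_transition n fF sumF); apply: eq_fsum => g; rewrite /one.
  by case: ifPn => [|/T0 ->]; rewrite ?mul1r ?mulr0.
have -> : fsum (fun g => one g ^+ 2) = #|` KP|%:R.
  rewrite (@fsumE _ _ KP) => [|g /one0 ->]; last by rewrite expr0n.
  rewrite big_seq (eq_bigr (fun=> 1)) -?big_seq => [|g gK].
    by rewrite big_const_seq count_predT iter_addr_0.
  by rewrite /one gK expr1n.
have KE' : #|` KP|%:R <= 2 * #|` K|%:R :> R by rewrite -natrM ler_nat ltnW.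
have Kp : 0 < #|` K|%:R :> R by rewrite ltr0n.
have X0 : 0 <= fsum (fun g => iter n T F v g ^+ 2).
  by apply: fsum_ge0 => g; exact: sqr_ge0.
move=> cs; rewrite -(ler_pM2l Kp).
have -> : #|` K|%:R * (lam ^+ n ^+ 2 * (#|` K|%:R * H v ^+ 2)) =
  (#|` K|%:R * lam ^+ n * H v) ^+ 2 by ring.
apply: le_trans cs _; rewrite mulrA; apply: ler_wpM2r => //.
by rewrite mulrC.
Qed.

End amenable_lower_bound.

Lemma weighted_cauchy (R : realFieldType) (J : Type) (r : seq J) (c u : J -> R) :
  (\sum_(j <- r) c j * u j) ^+ 2 <=
  (\sum_(j <- r) `|c j|) * (\sum_(j <- r) `|c j| * u j ^+ 2).
Proof.
have -> : (\sum_(j <- r) c j * u j) ^+ 2 = `|\sum_(j <- r) c j * u j| ^+ 2.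
  by rewrite real_normK ?num_real.
apply: (@le_trans _ _ ((\sum_(j <- r) `|c j| * `|u j|) ^+ 2)).
  have cu0 : 0 <= \sum_(j <- r) `|c j| * `|u j| by apply: sumr_ge0 => j _; exact: mulr_ge0.
  rewrite lerXn2r ?nnegrE//.
  by apply: le_trans (ler_norm_sum _ _ _) _; apply: ler_sum => j _; rewrite normrM.
apply: sqr_le_discriminant => s t.
rewrite !mulr_sumr -sumrMnl -!big_split/=; apply: sumr_ge0 => j _.
have -> : s ^+ 2 * `|c j| + s * t * (`|c j| * `|u j|) *+ 2 + t ^+ 2 * (`|c j| * u j ^+ 2) =
    `|c j| * (s + t * `|u j|) ^+ 2.
  by rewrite -(real_normK (num_real (u j))); ring.
by rewrite mulr_ge0 ?sqr_ge0.
Qed.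

(** If x > y, then (x / y)^(2^k) is at least 1 + k (x / y - 1) by Bernoulli's inequality, hence
    unbounded. Exponents are powers of 2 because log-convexity will be used by doubling. *)
Lemma le_of_expr2n_le (R : archiRealFieldType) (x y C : R) : 0 <= x -> 0 < y ->
  (forall k, x ^+ (2 ^ k) <= C * y ^+ (2 ^ k)) -> x <= y.
Proof.
move=> x0 y0 xy; rewrite leNgt; apply/negP => yx.
pose r := x / y - 1; have r0 : 0 < r by rewrite subr_gt0 ltr_pdivlMr ?mul1r.
have H k : 1 + k%:R * r <= C.
  have := xy k; rewrite -ler_pdivrMr ?exprn_gt0// -expr_div_n; apply: le_trans.
  have -> : x / y = 1 + r by rewrite /r addrC subrK.
  have le1 : 1 <= 1 + r by rewrite lerDl ltW.
  apply: le_trans (_ : (1 + r) ^+ k <= _); last first.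
    by apply: ler_weXn2l => //; exact/ltnW/ltn_expl.
  elim: k => [|k IH]; first by rewrite mul0r addr0 expr0.
  rewrite exprS; apply: le_trans (ler_wpM2l (le_trans ler01 le1) IH).
  rewrite -subr_ge0 -natr1.
  have -> : (1 + r) * (1 + k%:R * r) - (1 + (k%:R + 1) * r) = k%:R * r * r by ring.
  by rewrite !mulr_ge0// ltW.
have := H (Num.truncn (C / r)).+1.
have : C < (Num.truncn (C / r)).+1%:R * r.
  rewrite -ltr_pdivrMr//; exact: real_truncnS_gt (num_real _).
by move=> ? ?; lra.
Qed.

(** * Norms from return weights *)

Section power_trick.
Context (R : realType) (G : groupType).
Implicit Types f : G -> R.
Variable B : (G -> R) -> G -> R.
Hypothesis B_fsupp : forall f, fsupp f -> fsupp (B f).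
Hypothesis B_sum : forall (r : seq G) (c : G -> R) (u : G -> G -> R) g,
  B (fun g => \sum_(x <- r) c x * u x g) g = \sum_(x <- r) c x * B (u x) g.
Hypothesis B_sym : forall f f', fsupp f -> fsupp f' ->
  fsum (fun g => B f g * f' g) = fsum (fun g => f g * B f' g).
Hypothesis B_equiv : forall x f, B (fun g => f (x * g)%g) = fun g => B f (x * g)%g.
Hypothesis B_ext : forall f f', f =1 f' -> B f = B f'.

Definition delta1 (g : G) : R := if g == 1%g then 1 else 0.

Lemma fsupp_delta1 : fsupp delta1.
Proof.
by exists [fset 1%g]%fset => g; rewrite inE /delta1 => /negbTE ->.
Qed.

Lemma iter_fsupp f k : fsupp f -> fsupp (iter k B f).
Proof. by move=> ff; elim: k => //= k; exact: B_fsupp. Qed.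

Lemma iter_sym f f' k : fsupp f -> fsupp f' ->
  fsum (fun g => iter k B f g * f' g) = fsum (fun g => f g * iter k B f' g).
Proof.
move=> ff ff'; elim: k f' ff' => [//|k IH] f' ff'.
by rewrite iterS B_sym// ?IH -?iterSr//; [exact: B_fsupp|exact: iter_fsupp].
Qed.

Lemma iter_sum (r : seq G) (c : G -> R) (u : G -> G -> R) k :
  iter k B (fun g => \sum_(x <- r) c x * u x g) =
  fun g => \sum_(x <- r) c x * iter k B (u x) g.
Proof. by elim: k => //= k ->; apply/funext => g; rewrite B_sum. Qed.

Lemma iter_equiv x f k :
  iter k B (fun g => f (x * g)%g) = fun g => iter k B f (x * g)%g.
Proof. by elim: k => //= k ->; rewrite B_equiv. Qed.

Lemma iter_delta1 k : fsum (fun g => iter k B delta1 g ^+ 2) = iter (k + k) B delta1 1%g.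
Proof.
under eq_fsum => g do rewrite expr2.
rewrite iter_sym; [|exact: fsupp_delta1|exact/iter_fsupp/fsupp_delta1].
rewrite -iterD (@fsumE _ _ [fset 1%g]%fset).
  by rewrite big_seq_fset1 /delta1 eqxx mul1r.
by move=> g; rewrite inE /delta1 => /negbTE ->; rewrite mul0r.
Qed.

(** f is a combination of translates of [delta1], whose images under the k-th iterate all have the
    same norm by equivariance. *)
Lemma iter_norm_le f k (A : {fset G}) : (forall g, g \notin A -> f g = 0) ->
  fsum (fun g => iter k B f g ^+ 2) <=
  (\sum_(x <- A) `|f x|) ^+ 2 * fsum (fun g => iter k B delta1 g ^+ 2).
Proof.
move=> fA; pose d x g := delta1 (x^-1 * g)%g.
have fE : f = fun g => \sum_(x <- A) f x * d x g.
  apply/funext => g; have [gA|gA] := boolP (g \in A).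
    rewrite (big_fsetD1 g)//= /d mulVg /delta1 eqxx mulr1 big1_fset ?addr0// => x.
    rewrite !inE => /andP[xg _] _; case: eqP => [xg1|_]; last by rewrite mulr0.
    by move: xg; rewrite -(mulKg x^-1%g g) xg1 mulg1 invgK eqxx.
  rewrite fA// big1_fset// => x xA _; rewrite /d /delta1.
  case: eqP => [xg1|_]; last by rewrite mulr0.
  by move: gA; rewrite -(mulKg x^-1%g g) xg1 mulg1 invgK xA.
rewrite [in leLHS]fE iter_sum.
have dE x : iter k B (d x) = fun g => iter k B delta1 (x^-1 * g)%g by exact: iter_equiv.
have fd : fsupp (iter k B delta1) by exact/iter_fsupp/fsupp_delta1.
have fdx x : fsupp (iter k B (d x)) by rewrite dE; exact: fsupp_mull.
apply: (@le_trans _ _ (fsum (fun g =>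
    (\sum_(x <- A) `|f x|) * (\sum_(x <- A) `|f x| * iter k B (d x) g ^+ 2)))).
  apply: le_fsum => [||g]; last exact: weighted_cauchy.
  - by apply/fsuppX/fsupp_sum => x _; apply: fsuppMr.
  - by apply/fsuppMr/fsupp_sum => x _; apply/fsuppMr/fsuppX.
rewrite fsumZ expr2 -mulrA; apply: ler_wpM2l; first by apply: sumr_ge0.
rewrite fsum_sum => [|x _]; last by apply/fsuppMr/fsuppX.
rewrite mulr_suml; apply: ler_sum => x _; rewrite fsumZ dE.
by rewrite (fsum_mull _ (fun g => iter k B delta1 g ^+ 2)).
Qed.

(* Log-convexity of k |-> |B^k f| reduces the norm of B to the growth of |B^k f|, which is
   governed by the return weights (B^k delta1) 1. *)
Lemma norm_le_return_growth (C theta : R) : 0 < theta ->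
  (forall k, iter k B delta1 1%g <= C * theta ^+ k) ->
  forall f, fsupp f -> fsum (fun g => B f g ^+ 2) <= theta ^+ 2 * fsum (fun g => f g ^+ 2).
Proof.
move=> th0 ret f ff; pose x k := fsum (fun g => iter k B f g ^+ 2).
have x0 k : 0 <= x k by apply: fsum_ge0 => g; exact: sqr_ge0.
have conv k : x k ^+ 2 <= x (k + k)%N * x 0%N.
  rewrite {1}/x; under eq_fsum => g do rewrite expr2.
  rewrite iter_sym//; last exact: iter_fsupp.
  rewrite -iterD mulrC; apply: fsum_cauchy => //; exact: iter_fsupp.
rewrite -/(x 1%N) -/(x 0%N).
have [x00|x0N] := eqVneq (x 0%N) 0.
  have := conv 1%N; rewrite x00 !mulr0 => x1.
  have : x 1%N ^+ 2 == 0 by rewrite eq_le x1 sqr_ge0.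
  by rewrite sqrf_eq0 => /eqP ->.
have x0p : 0 < x 0%N by rewrite lt_neqAle eq_sym x0N x0.
have [A fA] := ff.
rewrite -ler_pdivrMr//; apply: (@le_of_expr2n_le _ _ _
  ((\sum_(x <- A) `|f x|) ^+ 2 * C / x 0%N)); rewrite ?divr_ge0 ?exprn_gt0// => k.
(* With x k the square norm of the k-th iterate, [conv] at doubled indices gives (x 1 / x 0)^(2^k)
   <= x (2^k) / x 0 by induction. *)
apply: (@le_trans _ _ (x (2 ^ k)%N / x 0%N)).
  elim: k => [|k IH]; first by rewrite expn0 expr1.
  rewrite expnS mul2n -addnn exprD -expr2.
  apply: le_trans (_ : (x (2 ^ k)%N / x 0%N) ^+ 2 <= _).
    by rewrite lerXn2r// nnegrE ?exprn_ge0// divr_ge0.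
  rewrite expr_div_n ler_pdivrMr ?exprn_gt0//.
  have -> : x (2 ^ k + 2 ^ k)%N / x 0%N * x 0%N ^+ 2 = x (2 ^ k + 2 ^ k)%N * x 0%N.
    by field.
  exact: conv.
rewrite mulrAC ler_pM2r ?invr_gt0//.
apply: le_trans (iter_norm_le _ fA) _; set c := (X in X ^+ 2); rewrite -[leRHS]mulrA; apply: ler_wpM2l; first exact: sqr_ge0.
by rewrite iter_delta1 -exprM mul2n -addnn; exact: ret.
Qed.

End power_trick.

(** * Convolutions with asymptotic symmetry *)

Section convolution.
Context (R : realType) (G : groupType).
Variables (J : nat -> finType) (e : forall n, J n -> R) (gam : forall n, J n -> G).
Hypothesis e0 : forall n j, 0 <= @e n j.
Implicit Types f : G -> R.

(** [J n] stands for the words of length n. The operators [conv n] need not form a semigroup in n;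
    the hypothesis [glue] below bounds the convolution of a weight by weights of a few slightly
    larger lengths instead. *)
Definition conv n f g := \sum_j @e n j * f (g * (gam j)^-1)%g.
Definition convT n f g := \sum_j @e n j * f (g * @gam n j)%g.
Definition weight n (g : G) := \sum_(j | @gam n j == g) e j.

Lemma weight_ge0 n g : 0 <= weight n g.
Proof. by apply: sumr_ge0 => j _. Qed.

Lemma weight_fsupp n : fsupp (weight n).
Proof.
exists [fset @gam n j | j : J n]%fset => g gJ; apply: big1 => j /eqP jg.
by exfalso; move/negP: gJ; apply; apply/imfsetP; exists j.
Qed.

Lemma weight_regroup n f : \sum_j @e n j * f (gam j) = fsum (fun g => weight n g * f g).
Proof.
rewrite (@fsumE _ _ [fset @gam n j | j : J n]%fset); last first.
  move=> g gJ; rewrite [weight _ _]big1 ?mul0r// => j /eqP jg.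
  by exfalso; move/negP: gJ; apply; apply/imfsetP; exists j.
under [RHS]eq_bigr => g _ do rewrite /weight big_mkcond mulr_suml.
rewrite exchange_big/=; apply: eq_bigr => j _.
rewrite (big_fsetD1 (gam j))/=; last by apply/imfsetP; exists j.
rewrite eqxx big1_fset ?addr0// => g; rewrite !inE => /andP[gj _] _.
by rewrite eq_sym (negbTE gj) mul0r.
Qed.

Lemma conv_fsupp n f : fsupp f -> fsupp (conv n f).
Proof. by move=> ff; apply: fsupp_sum => j _; apply/fsuppMr/fsupp_mulr. Qed.

Lemma convT_fsupp n f : fsupp f -> fsupp (convT n f).
Proof. by move=> ff; apply: fsupp_sum => j _; apply/fsuppMr/fsupp_mulr. Qed.

Lemma le_conv n f f' : (forall g, f g <= f' g) -> forall g, conv n f g <= conv n f' g.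
Proof. by move=> ff' g; apply: ler_sum => j _; apply: ler_wpM2l. Qed.

Lemma le_convT n f f' : (forall g, f g <= f' g) -> forall g, convT n f g <= convT n f' g.
Proof. by move=> ff' g; apply: ler_sum => j _; apply: ler_wpM2l. Qed.

Lemma conv_sum n (X : Type) (r : seq X) (c : X -> R) (u : X -> G -> R) g :
  conv n (fun g => \sum_(x <- r) c x * u x g) g = \sum_(x <- r) c x * conv n (u x) g.
Proof.
rewrite /conv; under eq_bigr do rewrite mulr_sumr.
rewrite exchange_big/=; apply: eq_bigr => x _; rewrite mulr_sumr.
by apply: eq_bigr => j _; rewrite mulrCA.
Qed.

Lemma convT_sum n (X : Type) (r : seq X) (c : X -> R) (u : X -> G -> R) g :
  convT n (fun g => \sum_(x <- r) c x * u x g) g = \sum_(x <- r) c x * convT n (u x) g.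
Proof.
rewrite /convT; under eq_bigr do rewrite mulr_sumr.
rewrite exchange_big/=; apply: eq_bigr => x _; rewrite mulr_sumr.
by apply: eq_bigr => j _; rewrite mulrCA.
Qed.

Lemma conv_adjoint n f f' : fsupp f -> fsupp f' ->
  fsum (fun g => conv n f g * f' g) = fsum (fun g => f g * convT n f' g).
Proof.
move=> ff ff'.
rewrite (eq_fsum (g := fun g => \sum_(j : J n) e j * (f (g * (gam j)^-1)%g * f' g))); last first.
  by move=> g; rewrite mulr_suml; apply: eq_bigr => j _; rewrite mulrA.
rewrite [RHS](eq_fsum (g := fun g => \sum_(j : J n) e j * (f g * f' (g * gam j)%g))); last first.
  by move=> g; rewrite mulr_sumr; apply: eq_bigr => j _; rewrite mulrCA.
rewrite !fsum_sum; first last.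
- by move=> j _; apply/fsuppMr/fsuppMr.
- by move=> j _; apply/fsuppMr/fsuppMl.
apply: eq_bigr => j _; rewrite !fsumZ; congr (_ * _).
rewrite -[LHS](fsum_mulr (gam j)); apply: eq_fsum => g /=.
by rewrite mulgK.
Qed.

Lemma convT_weight n f g : convT n f g = fsum (fun x => weight n x * f (g * x)%g).
Proof. exact: (weight_regroup _ (fun x => f (g * x)%g)). Qed.

Lemma conv_weight n f g : conv n f g = fsum (fun x => weight n x * f (g * x^-1)%g).
Proof. exact: (weight_regroup _ (fun x => f (g * x^-1)%g)). Qed.

Variables (E C : R) (rho : nat).
Hypotheses (E0 : 0 < E) (C0 : 0 < C) (rho0 : (0 < rho)%N).
Hypothesis glue : forall l n g, (0 < l)%N -> (0 < n)%N ->
  conv n (weight l) g <= C * \sum_(r < rho) weight (l + n + r) g.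

(* A bound of f by a finite combination of the return weights, measured by its value when the
   weights of length l are replaced by E^l. *)
Definition dominated (c : R) f := exists l : seq (R * nat),
  [/\ forall x, x \in l -> 0 <= x.1 /\ (0 < x.2)%N,
      forall g, f g <= \sum_(x <- l) x.1 * weight x.2 g
    & \sum_(x <- l) x.1 * E ^+ x.2 <= c].

Let K := C * \sum_(r < rho) E ^+ r.

Lemma dominated_weight l : (0 < l)%N -> dominated (E ^+ l) (weight l).
Proof.
move=> l0; exists [:: (1, l)]; split=> [x|g|]; rewrite ?big_seq1 ?mul1r//.
by rewrite inE => /eqP ->.
Qed.

Lemma le_dominated c c' f f' : dominated c f -> c <= c' -> (forall g, f' g <= f g) ->
  dominated c' f'.
Proof.
move=> [l [l0 fl lc]] cc' ff'; exists l; split=> // [g|].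
  exact: le_trans (ff' g) (fl g).
exact: le_trans lc cc'.
Qed.

Lemma dominatedZ d c f : 0 <= d -> dominated c f -> dominated (d * c) (fun g => d * f g).
Proof.
move=> d0 [l [l0 fl lc]]; exists [seq (d * x.1, x.2) | x <- l]; split.
- by move=> _ /mapP[x xl ->] /=; have [x1 x2] := l0 x xl; rewrite mulr_ge0.
- move=> g; rewrite big_map; under eq_bigr do rewrite -mulrA.
  by rewrite -mulr_sumr ler_wpM2l.
- rewrite big_map; under eq_bigr do rewrite -mulrA.
  by rewrite -mulr_sumr ler_wpM2l.
Qed.

Lemma dominatedD c c' f f' : dominated c f -> dominated c' f' ->
  dominated (c + c') (fun g => f g + f' g).
Proof.
move=> [l [l0 fl lc]] [l' [l0' fl' lc']]; exists (l ++ l'); split.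
- by move=> x; rewrite mem_cat => /orP[/l0|/l0'].
- by move=> g; rewrite big_cat; apply: lerD.
- by rewrite big_cat; apply: lerD.
Qed.

Lemma dominated_sum (X : eqType) (r : seq X) (c : X -> R) (f : X -> G -> R) :
  (forall x, x \in r -> dominated (c x) (f x)) ->
  dominated (\sum_(x <- r) c x) (fun g => \sum_(x <- r) f x g).
Proof.
elim: r => [_|x r IH H].
  by exists [::]; split=> // [g|]; rewrite !big_nil.
have Hr y : y \in r -> dominated (c y) (f y) by move=> yr; apply: H; rewrite inE yr orbT.
rewrite big_cons; have [l [l0 fl lc]] := dominatedD (H x (mem_head _ _)) (IH Hr).
by exists l; split=> // g; rewrite big_cons.
Qed.

(** By [glue] a weight of length l becomes C times the weights of lengths l + n + r with r < rho.
    When lengths are replaced by powers of E, this multiplies the measure by K E^n. *)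
Lemma dominated_conv n c f : (0 < n)%N -> dominated c f ->
  dominated (K * E ^+ n * c) (conv n f).
Proof.
move=> n0 [l [l0 fl lc]].
have H : dominated (\sum_(x <- l) x.1 * (C * \sum_(r < rho) E ^+ (x.2 + n + r)))
    (fun g => \sum_(x <- l) x.1 * (C * \sum_(r < rho) weight (x.2 + n + r) g)).
  apply: dominated_sum => x /l0[x1 x2]; apply: dominatedZ => //.
  apply: dominatedZ; first exact: ltW.
  apply: dominated_sum => r _; apply: dominated_weight.
  by rewrite -addnA addn_gt0 x2.
apply: le_dominated H _ _ => [|g]; last first.
  apply: le_trans (le_conv n fl g) _; rewrite conv_sum big_seq [leRHS]big_seq.
  by apply: ler_sum => x /l0[x1 x2]; apply: ler_wpM2l => //; exact: glue.
have KE0 : 0 <= K * E ^+ n.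
  by rewrite !mulr_ge0 ?exprn_ge0 ?sumr_ge0// ?ltW// => r _; rewrite exprn_ge0// ltW.
apply: le_trans (ler_wpM2l KE0 lc); rewrite mulr_sumr; apply: ler_sum => x _.
rewrite le_eqVlt; apply/orP; left; apply/eqP.
rewrite /K [RHS]mulrCA; congr (_ * _); rewrite -!mulrA; congr (_ * _).
rewrite mulr_suml; apply: eq_bigr => r _; rewrite !exprD; ring.
Qed.

Variables (n N : nat) (c : R).
Hypotheses (n0 : (0 < n)%N) (N0 : (0 < N)%N) (c0 : 0 < c).
Hypothesis symmetric : forall g,
  weight n g <= c * \sum_(i < N) weight (n + i) (g^-1)%g.

Lemma fsum_invg f : fsum (fun g => f (g^-1)%g) = fsum f.
Proof. by apply: (fsum_reindex (s := fun g => (g^-1)%g)) => g; exact: invgK. Qed.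

(** [convT n] is the convolution by the weight composed with inversion, which [symmetric] bounds by
    weights of lengths n + i. *)
Lemma convT_le_conv f g : (forall g, 0 <= f g) ->
  convT n f g <= c * \sum_(i < N) conv (n + i) f g.
Proof.
move=> f0; rewrite convT_weight mulr_sumr.
under eq_bigr => i _ do rewrite conv_weight -fsum_invg -fsumZ.
have fi (i : 'I_N) : fsupp (fun x : G =>
    c * (weight (n + i) (x^-1)%g * f (g * (x^-1)^-1)%g)).
  apply/fsuppMr/fsuppMl; apply: (fsupp_comp (t := fun x => (x^-1)%g)) (weight_fsupp _).
  exact: invgK.
rewrite -fsum_sum//; apply: le_fsum => [||x].
- by apply/fsuppMl/weight_fsupp.
- by apply: fsupp_sum.
- rewrite -mulr_sumr -mulr_suml mulrA invgK; apply: ler_wpM2r => //.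
Qed.

Lemma dominated_convT d f : dominated d f ->
  dominated (c * \sum_(i < N) (K * E ^+ (n + i)) * d) (convT n f).
Proof.
(* f may take negative values, so its nonnegative majorant F is used in [convT_le_conv]. *)
move=> [l [l0 fl lc]]; pose F g := \sum_(x <- l) x.1 * weight x.2 g.
have dF : dominated d F by exists l; split.
have F0 g : 0 <= F g.
  by rewrite /F big_seq; apply: sumr_ge0 => x /l0[x0 _]; rewrite mulr_ge0 ?weight_ge0.
have : dominated (c * \sum_(i < N) (K * E ^+ (n + i)) * d)
    (fun g => c * \sum_(i < N) conv (n + i) F g).
  apply: dominatedZ; first exact: ltW.
  by apply: dominated_sum => i _; apply: dominated_conv => //; rewrite addn_gt0 n0.
move/le_dominated; apply => // g.
by apply: le_trans (le_convT n fl g) _; exact: convT_le_conv.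
Qed.

Variables (M C1 : R) (l0 : nat).
Hypothesis bound : forall l, (0 < l)%N -> weight l 1%g <= M * E ^+ l.
Hypotheses (l00 : (0 < l0)%N) (C10 : 0 <= C1).
Hypothesis start : C1 * weight l0 1%g >= 1.

Let theta := c * \sum_(i < N) (K * E ^+ (n + i)) * (K * E ^+ n).

Lemma theta_gt0 : 0 < theta.
Proof.
have K0 : 0 < K.
  rewrite mulr_gt0// (bigD1 (Ordinal rho0))//= ltr_pwDl ?exprn_gt0// sumr_ge0// => r _.
  by rewrite exprn_ge0// ltW.
have KE0 m : 0 < K * E ^+ m by rewrite pmulr_rgt0 ?exprn_gt0.
rewrite mulr_gt0// (bigD1 (Ordinal N0))//=; apply: ltr_pwDl.
  by rewrite pmulr_rgt0 ?KE0.
by apply: sumr_ge0 => i _; rewrite pmulr_rge0 ?KE0// ltW ?KE0.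
Qed.

Lemma dominated_iter k :
  dominated (theta ^+ k * (C1 * E ^+ l0)) (iter k (convT n \o conv n) (@delta1 R G)).
Proof.
elim: k => [|k IH].
  rewrite expr0 mul1r; apply: le_dominated (dominatedZ C10 (dominated_weight l00)) _ _ => //.
  move=> g /=; rewrite /delta1; case: eqP => [->//|_].
  by rewrite mulr_ge0 ?weight_ge0.
rewrite iterS; apply: le_dominated (dominated_convT (dominated_conv n0 IH)) _ _ => //.
rewrite /theta exprS -mulr_suml le_eqVlt; apply/orP; left; apply/eqP.
by rewrite -mulr_suml; ring.
Qed.

(** The composite B of [conv n] and [convT n] is symmetric. By [start], [delta1] is dominated by the
    weight of length [l0]; each B costs a factor [theta], and [bound] evaluates the result at 1.
    This bounds the return weights, hence |B f| <= theta |f|, and |conv n f|^2 is the inner product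
    of f and B f. *)
Lemma conv_norm_le f : fsupp f ->
  fsum (fun g => conv n f g ^+ 2) <= theta * fsum (fun g => f g ^+ 2).
Proof.
move=> ff; set X := fsum _; set Y := fsum _.
have Y0 : 0 <= Y by apply: fsum_ge0 => g; exact: sqr_ge0.
have X0 : 0 <= X by apply: fsum_ge0 => g; exact: sqr_ge0.
have fB f' : fsupp f' -> fsupp ((convT n \o conv n) f').
  by move=> /(conv_fsupp n)/(convT_fsupp n).
have main : fsum (fun g => (convT n \o conv n) f g ^+ 2) <= theta ^+ 2 * Y.
  apply: (@norm_le_return_growth R G _ fB _ _ _ (M * (C1 * E ^+ l0)) theta) => //.
  - move=> r u v g /=; rewrite -convT_sum; apply: eq_bigr => j _; congr (_ * _).
    exact: conv_sum.
  - move=> f1 f2 ff1 ff2 /=.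
    under eq_fsum => g do rewrite mulrC.
    rewrite -conv_adjoint//; last exact: conv_fsupp.
    under eq_fsum => g do rewrite mulrC.
    by rewrite conv_adjoint//; exact: conv_fsupp.
  - move=> x f1; apply/funext => g /=; apply: eq_bigr => j _; congr (_ * _).
    by apply: eq_bigr => j' _; rewrite !mulgA.
  - exact: theta_gt0.
  - move=> k; have [l [l0' fl lc]] := dominated_iter k.
    apply: le_trans (fl 1%g) _; rewrite [leRHS]mulrC.
    have M0 : 0 <= M.
      have := le_trans (weight_ge0 _ _) (bound l00).
      by rewrite pmulr_lge0// exprn_gt0.
    rewrite mulrCA; apply: le_trans (ler_wpM2l M0 lc).
    rewrite mulr_sumr big_seq [leRHS]big_seq; apply: ler_sum => x /l0'[x1 x2].
    by rewrite mulrCA ler_wpM2l// bound.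
have XE : X = fsum (fun g => f g * (convT n \o conv n) f g).
  by rewrite -conv_adjoint//; exact: conv_fsupp.
have : X ^+ 2 <= (theta * Y) ^+ 2.
  rewrite {1}XE; apply: le_trans (fsum_cauchy ff (fB _ ff)) _; rewrite -/Y.
  apply: le_trans (ler_wpM2l Y0 main) _.
  by rewrite [leRHS]exprMn mulrCA -expr2.
by rewrite ler_pXn2r// nnegrE// mulr_ge0// ltW// theta_gt0.
Qed.

End convolution.

(** * Growth rates *)

Section nth_roots.
Context (R : realType).
Implicit Types (u : nat -> R) (x c b l : R).

Lemma powR_cvg1 c (r : nat -> R) : 0 < c -> r @ \oo --> (0 : R) ->
  (fun n => c `^ r n) @ \oo --> (1 : R).
Proof.
move=> c0 r0; rewrite /powR gt_eqF// -[X in _ --> X]expR0 -(mul0r (ln c)).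
apply: continuous_cvg; first exact: continuous_expR.
by apply: cvgM => //; exact: cvg_cst.
Qed.

Lemma cvg_invn : (fun n => n%:R^-1 : R) @ \oo --> (0 : R).
Proof. by rewrite -(cvg_shiftn 1); under eq_fun do rewrite addn1; exact: cvg_harmonic. Qed.

Lemma root_cvg1 c : 0 < c -> (fun n => c `^ n%:R^-1) @ \oo --> (1 : R).
Proof. by move=> c0; apply: powR_cvg1 => //; exact: cvg_invn. Qed.

Lemma rootXK n x : (0 < n)%N -> 0 <= x -> (x ^+ n) `^ n%:R^-1 = x.
Proof.
move=> n0 x0; rewrite -powR_mulrn// -powRrM divff ?powRr1// pnatr_eq0.
by rewrite -lt0n.
Qed.

Lemma rootK n x : (0 < n)%N -> 0 <= x -> (x `^ n%:R^-1) ^+ n = x.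
Proof.
move=> n0 x0; rewrite -powR_mulrn ?powR_ge0// -powRrM mulVf ?powRr1// pnatr_eq0.
by rewrite -lt0n.
Qed.

Lemma le_root n x y : 0 <= x -> x <= y -> x `^ n%:R^-1 <= y `^ n%:R^-1.
Proof.
by move=> x0 xy; apply: ge0_ler_powR; rewrite ?invr_ge0 ?nnegrE// (le_trans x0).
Qed.

Lemma root_geom_cvg c b : 0 < c -> 0 <= b ->
  (fun n => (c * b ^+ n) `^ n%:R^-1) @ \oo --> b.
Proof.
move=> c0 b0.
have H : (fun n => c `^ n%:R^-1 * b) @ \oo --> b.
  by rewrite -[X in _ --> X]mul1r; apply: cvgM; [exact: root_cvg1|exact: cvg_cst].
apply: cvg_trans H; apply: near_eq_cvg; exists 1%N => // n /= n0.
by rewrite powRM ?exprn_ge0 ?(ltW c0)// rootXK.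
Qed.

Lemma root_squeeze u c C b : 0 < c -> 0 < C -> 0 <= b ->
  (forall n, c * b ^+ n <= u n <= C * b ^+ n) ->
  (fun n => u n `^ n%:R^-1) @ \oo --> b.
Proof.
move=> c0 C0 b0 uH.
apply: (@squeeze_cvgr _ _ _ _ (fun n => (c * b ^+ n) `^ n%:R^-1)
   (fun n => (C * b ^+ n) `^ n%:R^-1)); [|exact: root_geom_cvg|exact: root_geom_cvg].
apply: nearW => n; have /andP[lo hi] := uH n.
have cb : 0 <= c * b ^+ n by rewrite mulr_ge0 ?exprn_ge0// ltW.
by rewrite !le_root// (le_trans cb).
Qed.

Lemma root_lim_ge u c b l : 0 < c -> 0 <= b -> (forall n, c * b ^+ n <= u n) ->
  (fun n => u n `^ n%:R^-1) @ \oo --> l -> b <= l.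
Proof.
move=> c0 b0 uH ul.
rewrite -(cvg_lim (@Rhausdorff R) (root_geom_cvg c0 b0)) -(cvg_lim (@Rhausdorff R) ul).
apply: ler_lim.
- by apply/cvg_ex; exists b; exact: root_geom_cvg.
- by apply/cvg_ex; exists l.
- apply: nearW => n; apply: le_root => //.
  by rewrite mulr_ge0 ?exprn_ge0// ltW.
Qed.

Lemma le_of_subexponential b l (v : nat -> R) :
  (forall n, (0 < n)%N -> 0 <= v n) -> (fun n => v n `^ n%:R^-1) @ \oo --> (1 : R) ->
  0 <= b -> 0 <= l -> (forall n, (0 < n)%N -> l ^+ n <= v n * b ^+ n) -> l <= b.
Proof.
move=> v0 v1 b0 l0 lv.
have vb : (fun n => v n `^ n%:R^-1 * b) @ \oo --> b.
  by rewrite -[X in _ --> X]mul1r; apply: cvgM => //; exact: cvg_cst.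
rewrite -(cvg_lim (@Rhausdorff R) vb); apply: limr_ge; first by apply/cvg_ex; exists b.
exists 1%N => // n /= n0.
rewrite -(rootXK n0 l0) -(rootXK n0 b0) -powRM ?v0 ?exprn_ge0//.
by apply: le_root; [exact: exprn_ge0|exact: lv].
Qed.

(** Fekete's lemma in multiplicative form. The limit is the infimum of the nth roots; the upper
    bound divides n with remainder by an m whose root is nearly minimal. The value 0 is allowed. *)
Lemma fekete u : (forall n, 0 <= u n) -> (forall m n, u (m + n)%N <= u m * u n) ->
  exists2 l, 0 <= l /\ (forall n, (0 < n)%N -> l ^+ n <= u n) &
    (fun n => u n `^ n%:R^-1) @ \oo --> l.
Proof.
move=> u0 um.
pose A := [set u n `^ n%:R^-1 | n in [set n | (0 < n)%N]].
have A0 : has_lbound A by exists 0 => _ [n _ <-]; exact: powR_ge0.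
have Ai : has_inf A by split=> //; exists (u 1%N `^ 1%:R^-1), 1%N.
have l0 : 0 <= inf A by apply: lb_le_inf; [exact: Ai.1|move=> _ [n _ <-]; exact: powR_ge0].
have lu n : (0 < n)%N -> inf A <= u n `^ n%:R^-1.
  by move=> n0; apply: ge_inf => //; exists n.
(* The last factor covers k = 0, where [u 0] may exceed 1. *)
have umul m k : u (m * k)%N <= u m ^+ k * (1 + u 0%N).
  elim: k => [|k IH]; first by rewrite muln0 expr0 mul1r lerDr.
  rewrite mulnS exprS -mulrA; apply: le_trans (um _ _) _; exact: ler_wpM2l.
exists (inf A).
  split=> // n n0; rewrite -(rootK n0 (u0 n)); apply: lerXn2r; rewrite ?nnegrE ?powR_ge0//.
  exact: lu.
apply/cvgrPdist_le => e e0.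
have e20 : 0 < e / 2 by rewrite divr_gt0.
have [_ [m /= m0 <-] um_lt] := inf_adherent e20 Ai.
pose b := inf A + e / 2.
have b0 : 0 < b by rewrite ltr_wpDl// divr_gt0.
have umb : u m <= b ^+ m.
  by rewrite -(rootK m0 (u0 m)) lerXn2r ?nnegrE ?powR_ge0// ltW.
(* C absorbs all remainders r < m; the factor (1 + 1/b)^r makes up for b^r, which may be less than
   1. *)
pose C := \sum_(r < m) (1 + u r) * (1 + u 0%N) * (1 + b^-1) ^+ r.
have C1 r : (r < m)%N -> (1 + u r) * (1 + u 0%N) * (1 + b^-1) ^+ r <= C.
  move=> rm; rewrite /C (bigD1 (Ordinal rm))//= lerDl; apply: sumr_ge0 => i _.
  by rewrite !mulr_ge0 ?addr_ge0 ?exprn_ge0 ?addr_ge0 ?invr_ge0// ltW.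
have C0 : 0 < C.
  apply: lt_le_trans (C1 0%N m0); rewrite expr0 mulr1 mulr_gt0//;
    by rewrite ltr_pwDl.
have ub n : u n <= C * b ^+ n.
  have -> : b ^+ n = b ^+ (m * (n %/ m)) * b ^+ (n %% m).
    by rewrite -exprD mulnC -divn_eq.
  rewrite {1}(divn_eq n m) addnC mulnC.
  apply: le_trans (um _ _) _.
  apply: le_trans (ler_wpM2l (u0 _) (umul _ _)) _.
  have rm : (n %% m < m)%N by rewrite ltn_mod.
  have q1 : u m ^+ (n %/ m) <= b ^+ (m * (n %/ m)).
    by rewrite exprM lerXn2r ?nnegrE ?exprn_ge0// ltW.
  have q0 : 0 <= b ^+ (m * (n %/ m)) by rewrite exprn_ge0// ltW.
  have br0 : 0 < b ^+ (n %% m) by rewrite exprn_gt0.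
  have r1 : u (n %% m)%N * (1 + u 0%N) <= C * b ^+ (n %% m).
    apply: le_trans (ler_wpM2r (ltW br0) (C1 _ rm)).
    have E : (1 + b^-1) ^+ (n %% m) * b ^+ (n %% m) = (b + 1) ^+ (n %% m).
      by rewrite -exprMn mulrDl mul1r mulVf ?gt_eqF.
    rewrite -[leRHS]mulrA E.
    have X1 : 0 <= (1 + u 0%N) by rewrite addr_ge0.
    have : 1 <= (b + 1) ^+ (n %% m) by rewrite exprn_ege1// lerDr ltW.
    move=> X2; apply: le_trans (_ : (1 + u (n %% m)%N) * (1 + u 0%N) <= _).
      by rewrite ler_wpM2r// lerDr.
    by rewrite ler_peMr// mulr_ge0// addr_ge0.
  rewrite mulrCA [leRHS]mulrCA; apply: ler_pM => //; rewrite ?exprn_ge0// mulr_ge0//.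
  by rewrite addr_ge0.
have Cb := root_geom_cvg C0 (ltW b0).
have /cvgrPdist_le/(_ _ e20)[N _ HN] := Cb.
exists (maxn 1 N) => // n /=; rewrite geq_max => /andP[n0 nN].
have := HN n nN => /=; rewrite ler_norml => /andP[H _].
have H1 := lu n n0.
have H2 : u n `^ n%:R^-1 <= (C * b ^+ n) `^ n%:R^-1 by apply: le_root.
rewrite ler_norml; apply/andP; split; move: H H1 H2; rewrite /b;
  set x := inf A; set y := _ `^ _; set z := _ `^ _; lra.
Qed.

End nth_roots.

(** * Admissible words and points *)

Local Notation shift := Defs.shift.

Section points.
Context (I : finType) (A : incidence_matrix I).
Implicit Types (x y : shift_space A) (i : I) (w : seq I).

Lemma point_ext x y : (forall n, letter x n = letter y n) -> x = y.
Proof. by move=> xy; apply/val_inj/funext => n; exact: xy. Qed.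

Lemma letter_incidence x n : A (letter x n) (letter x n.+1).
Proof. exact: (set_mem (valP x)). Qed.

Lemma letter_shift x n : letter (shift x) n = letter x n.+1.
Proof. by []. Qed.

Lemma letter_iter_shift x m n : letter (iter m (@shift I A) x) n = letter x (m + n).
Proof. by elim: m n => [//|m IH] n; rewrite iterS letter_shift IH addnS. Qed.

Let cons_seq i x : prod_topology (fun _ : nat => discrete_topology I) :=
  fun n => if n is m.+1 then letter x m else i.

Lemma cons_seq_admissible i x : A i (letter x 0) -> cons_seq i x \in admissible A.
Proof.
by move=> ix; apply/mem_set => -[|n] //=; exact: letter_incidence.
Qed.

(* The default value x makes [consx i] a total, measurable map. *)
Definition consx i x : shift_space A :=
  match pselect (A i (letter x 0)) with
  | left ix => exist _ (cons_seq i x) (cons_seq_admissible ix)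
  | right _ => x
  end.

Lemma consx_id i x : ~~ A i (letter x 0) -> consx i x = x.
Proof. by move=> /negP nix; rewrite /consx; case: pselect. Qed.

Lemma letter_consx0 i x : A i (letter x 0) -> letter (consx i x) 0 = i.
Proof. by rewrite /consx; case: pselect. Qed.

Lemma letter_consxS i x n : A i (letter x 0) -> letter (consx i x) n.+1 = letter x n.
Proof. by rewrite /consx; case: pselect. Qed.

Lemma shift_consx i x : A i (letter x 0) -> shift (consx i x) = x.
Proof. by move=> ix; apply: point_ext => n; rewrite letter_shift letter_consxS. Qed.

Lemma consx_shift x : consx (letter x 0) (shift x) = x.
Proof.
have ax : A (letter x 0) (letter (shift x) 0) by exact: letter_incidence.
by apply: point_ext => -[|n]; rewrite ?letter_consx0// letter_consxS.
Qed.

Lemma transferE (R : realType) (phi f : shift_space A -> R) x : transfer phi f x =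
  \sum_(i | A i (letter x 0)) expR (phi (consx i x)) * f (consx i x).
Proof.
rewrite /transfer.
have -> : (@shift I A) @^-1` [set x] = (consx^~ x) @` [set i | A i (letter x 0)].
  apply/seteqP; split=> y /=.
    by move=> <-; exists (letter y 0); [exact: letter_incidence|exact: consx_shift].
  by move=> [i ix <-]; exact: shift_consx.
rewrite fsbig_image; last first.
  move=> i i' /set_mem ix /set_mem ix' /(congr1 (fun y => letter y 0)).
  by rewrite !letter_consx0.
by rewrite -(bigfs _ (index_enum_uniq I))// => i _; rewrite mem_index_enum.
Qed.

Definition agree n x y := forall m, (m < n)%N -> letter x m = letter y m.

Lemma agree_consx n i x y : (0 < n)%N -> A i (letter x 0) -> agree n x y ->
  agree n.+1 (consx i x) (consx i y).
Proof.
move=> n0 ix xy; have iy : A i (letter y 0) by rewrite -xy.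
by move=> [_|m mn]; rewrite ?letter_consx0 ?letter_consxS// xy.
Qed.

Definition appendx w x := foldr consx x w.

Lemma appendx_admissible w x : sorted A (rcons w (letter x 0)) ->
  letter (appendx w x) 0 = head (letter x 0) w.
Proof.
by case: w => //= i w; elim: w i => [|i' w IH] i /= /andP[ix H];
  rewrite letter_consx0//= IH.
Qed.

Lemma appendx_cons i w x : sorted A (rcons (i :: w) (letter x 0)) ->
  A i (letter (appendx w x) 0) /\ sorted A (rcons w (letter x 0)).
Proof.
move=> iw; have H : sorted A (rcons w (letter x 0)) by case: w iw => //= b w /andP[].
by rewrite appendx_admissible//; split=> //; case: w iw {H} => //= [|b w] /andP[].
Qed.

Lemma letter_appendx w x n : sorted A (rcons w (letter x 0)) ->
  letter (appendx w x) n = if (n < size w)%N then nth (letter x 0) w n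
    else letter x (n - size w).
Proof.
elim: w n => [|i w IH] n; first by rewrite subn0.
move=> /appendx_cons[ix /IH H]; case: n => [|n]; first by rewrite letter_consx0.
by rewrite letter_consxS// H /= ltnS subSS.
Qed.

Let successor (i : I) : I := xchoose (incidence_succ A i).

Let orbit_seq i : prod_topology (fun _ : nat => discrete_topology I) :=
  fun n => iter n successor i.

Lemma orbit_admissible i : orbit_seq i \in admissible A.
Proof. by apply/mem_set => n; exact: (xchooseP (incidence_succ A _)). Qed.

Definition orbit_point i : shift_space A := exist _ (orbit_seq i) (orbit_admissible i).

Lemma exists_point w : sorted A w -> exists x, mkseq (letter x) (size w) = w.
Proof.
case: w => [_|a w]; first by exists point.
elim: w a => [a _|b w IH a /= /andP[ab bw]].
  by exists (orbit_point a).
have [x xw] := IH b bw.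
have x0 : letter x 0 = b by have := congr1 (head a) xw.
have ax : A a (letter x 0) by rewrite x0.
exists (consx a x); apply: (@eq_from_nth _ a); first by rewrite size_mkseq.
move=> n; rewrite size_mkseq => nw; rewrite nth_mkseq//.
case: n nw => [_|n nw] /=; first by rewrite letter_consx0.
by rewrite letter_consxS// -[in RHS]xw nth_mkseq.
Qed.

Lemma cylinderP w x : cylinder A w x <-> forall n, (n < size w)%N -> letter x n = nth (letter x 0) w n.
Proof.
rewrite /cylinder/=; split=> [xw n nw|H]; first by rewrite -[in RHS]xw nth_mkseq.
apply: (@eq_from_nth _ (letter x 0)); first by rewrite size_mkseq.
by move=> n; rewrite size_mkseq => nw; rewrite nth_mkseq// [LHS]H.
Qed.

Lemma cylinder_mkseq n x y : cylinder A (mkseq (letter x) n) y <-> agree n x y.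
Proof.
rewrite cylinderP size_mkseq; split=> H m mn; have := H m mn; rewrite nth_mkseq//.
Qed.

Lemma sorted_mkseq n x : sorted A (mkseq (letter x) n).
Proof.
apply/(sortedP (letter x 0)) => m; rewrite size_mkseq => mn.
by rewrite !nth_mkseq// 1?ltnW//; exact: letter_incidence.
Qed.

Lemma appendx_cylinder w x : sorted A (rcons w (letter x 0)) -> cylinder A w (appendx w x).
Proof.
move=> wx; apply/cylinderP => n nw; rewrite letter_appendx// nw.
by rewrite (set_nth_default (letter x 0))// ; exact: set_nth_default.
Qed.

(** The sets that do not separate x from y form a sigma-algebra, which contains the cylinders of
    length n. *)
Lemma cylinder_algebra_saturated n (B : set (shift_space A)) x y :
  cylinder_algebra A n B -> agree n x y -> B x -> B y.
Proof.
move=> + xy.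
pose sat := [set B : set (shift_space A) | B x <-> B y].
suff H : cylinder_algebra A n `<=` sat by move=> BA; have [BxBy _] := H _ BA.
apply: smallest_sub; last first.
  move=> _ [w [wn _] <-]; split=> /cylinderP H; apply/cylinderP => m mw.
    have mn : (m < n)%N by rewrite -wn.
    by rewrite -xy// [LHS]H//; exact: set_nth_default.
  have mn : (m < n)%N by rewrite -wn.
  by rewrite xy// [LHS]H//; exact: set_nth_default.
split.
- by [].
- by move=> C [C1 C2]; split=> /= -[_ H]; split=> //; [move/C2|move/C1].
- by move=> F HF; split=> /= -[k _ Fk]; exists k => //; apply/HF.
Qed.

Lemma measurable_wrt_local (R : realType) n (phi : shift_space A -> R) :
  measurable_wrt (cylinder_algebra A n) phi -> forall x y, agree n x y -> phi x = phi y.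
Proof.
move=> mphi x y xy; apply/esym.
exact: (cylinder_algebra_saturated (mphi _ (measurable_set1 (phi x))) xy).
Qed.

Definition state n := {v : n.-tuple I | sorted A v}.

Definition pre n x : state n :=
  exist _ (Tuple (introT eqP (size_mkseq (letter x) n))) (sorted_mkseq n x).

Lemma preP n x y : pre n x = pre n y <-> agree n x y.
Proof.
split=> [/(congr1 (fun v : state n => (val (val v) : seq I))) /= H m mn|xy].
  by have := congr1 (fun s => nth (letter x 0) s m) H; rewrite !nth_mkseq.
apply/val_inj/val_inj => /=; apply: (@eq_from_nth _ (letter x 0)).
  by rewrite !size_mkseq.
by move=> m; rewrite size_mkseq => mn; rewrite !nth_mkseq ?xy.
Qed.

Lemma exists_rep n (v : state n) : exists x, pre n x = v.
Proof.
case: v => v sv; have [x xv] := exists_point sv; exists x.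
by apply/val_inj/val_inj => /=; rewrite -[RHS]xv size_tuple.
Qed.

Definition rep n (v : state n) : shift_space A := projT1 (cid (exists_rep v)).

Lemma repK n (v : state n) : pre n (rep v) = v.
Proof. exact: projT2 (cid (exists_rep v)). Qed.

Lemma agree_rep n x : agree n x (rep (pre n x)).
Proof. by apply/preP; rewrite repK. Qed.

End points.

Lemma sum_tuple_cons (R : nmodType) (I : finType) n (f : seq I -> R) :
  \sum_(w : n.+1.-tuple I) f w = \sum_i \sum_(w : n.-tuple I) f (i :: w).
Proof.
rewrite pair_big/= (reindex (fun p : I * n.-tuple I => [tuple of p.1 :: p.2]))/=; last first.
  exists (fun t : n.+1.-tuple I => (thead t, [tuple of behead t])).
    by move=> [i w] _ /=; congr pair; apply: val_inj.
  by move=> t _; rewrite /= -tuple_eta.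
by [].
Qed.

(** * States, words and links *)

Section words.
Context (R : realType) (I : finType) (A : incidence_matrix I) (G : groupType).
Variables (Psi : seq I -> G) (phi : shift_space A -> R) (j : nat).
Hypothesis Psi_hom : semigroup_hom Psi.
Hypothesis phi_loc : forall x y : shift_space A, agree j.+1 x y -> phi x = phi y.
Hypothesis j0 : (0 < j)%N.
Implicit Types (x y : shift_space A) (i : I) (w : seq I) (v : state A j).

Definition psi i : G := Psi [:: i].
Definition step i v : state A j := pre j (consx i (rep v)).
Definition jump i v : R := if A i (letter (rep v) 0) then expR (phi (consx i (rep v))) else 0.

Lemma jump_ge0 i v : 0 <= jump i v.
Proof. by rewrite /jump; case: ifP => // _; exact: expR_ge0. Qed.

Lemma letter_rep x : letter (rep (pre j x)) 0 = letter x 0.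
Proof. by apply/esym/agree_rep. Qed.

Lemma pre_consx i x : pre j (consx i x) = step i (pre j x).
Proof.
have [ix|ix] := boolP (A i (letter x 0)).
  apply/preP => m mj; apply: (agree_consx j0 ix (@agree_rep _ _ j x)).
  exact: ltnW.
by rewrite /step !consx_id ?repK// letter_rep.
Qed.

Lemma jump_pre i x : jump i (pre j x) = if A i (letter x 0) then expR (phi (consx i x)) else 0.
Proof.
rewrite /jump letter_rep; case: ifP => // ix; congr expR; apply/esym/phi_loc.
exact: (agree_consx j0 ix (@agree_rep _ _ j x)).
Qed.

Lemma act_pre w x : act step w (pre j x) = pre j (appendx w x).
Proof. by elim: w => //= i w ->; rewrite pre_consx. Qed.

Lemma wprodE w : w <> [::] -> wprod psi w = Psi w.
Proof.
elim: w => // i [_ _|i' w IH _]; first by rewrite /= mulg1.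
by rewrite -cat1s Psi_hom//= -IH.
Qed.

Local Notation T := (transition step psi jump).

Lemma birkhoff_sumS n x :
  birkhoff_sum phi n.+1 x = phi x + birkhoff_sum phi n (shift x).
Proof.
rewrite /birkhoff_sum big_ord_recl/=; congr (_ + _); apply: eq_bigr => m _.
by rewrite -iterSr.
Qed.

Lemma birkhoff_sumD m n x : birkhoff_sum phi (m + n) x =
  birkhoff_sum phi m x + birkhoff_sum phi n (iter m (@shift I A) x).
Proof.
elim: m x => [|m IH] x; first by rewrite /birkhoff_sum big_ord0 add0r.
by rewrite addSn !birkhoff_sumS IH addrA iterSr.
Qed.

Lemma iter_transition_words n F x g : iter n T F (pre j x) g =
  \sum_(w : n.-tuple I | sorted A (rcons w (letter x 0)))
    expR (birkhoff_sum phi n (appendx w x)) * F (pre j (appendx w x)) (g * (wprod psi w)^-1)%g.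
Proof.
elim: n F => [|n IH] F.
  rewrite (big_pred1 [tuple]) => [|w]; last by rewrite tuple0/= eqxx.
  by rewrite /birkhoff_sum big_ord0 expR0 mul1r /= invg1 mulg1.
rewrite iterSr IH [LHS]big_mkcond [RHS]big_mkcond/=.
rewrite (sum_tuple_cons n (fun w => if sorted A (rcons w (letter x 0)) then
  expR (birkhoff_sum phi n.+1 (appendx w x)) *
  F (pre j (appendx w x)) (g * (wprod psi w)^-1)%g else 0)) exchange_big/=.
apply: eq_bigr => w _; case: ifP => [wx|wx]; last first.
  apply/esym/big1 => i _; case: ifP => // iwx.
  by case: (w : seq I) wx iwx => //= b w' -> /andP[].
rewrite /transition mulr_sumr; apply: eq_bigr => i _; rewrite jump_pre.
have -> : path A i (rcons w (letter x 0)) = A i (letter (appendx w x) 0).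
  rewrite appendx_admissible//.
  by case: (w : seq I) wx => //= [|b w' ->]; rewrite andbT.
case: ifP => iwx; last by rewrite mul0r mulr0.
rewrite birkhoff_sumS shift_consx// expRD pre_consx invgM mulgA.
by rewrite mulrA [expR _ * expR _]mulrC.
Qed.

Definition phi_bound : R := \sum_(v : state A j.+1) `|phi (rep v)|.

Lemma phi_le x : `|phi x| <= phi_bound.
Proof.
by rewrite (phi_loc (@agree_rep _ _ j.+1 x)) /phi_bound (bigD1 (pre j.+1 x))//= lerDl sumr_ge0.
Qed.

Lemma phi_bound_ge0 : 0 <= phi_bound.
Proof. exact: sumr_ge0. Qed.

Lemma birkhoff_norm n x : `|birkhoff_sum phi n x| <= phi_bound *+ n.
Proof.
rewrite -[n in leRHS]card_ord -sumr_const; apply: le_trans (ler_norm_sum _ _ _) _.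
by apply: ler_sum => i _; exact: phi_le.
Qed.

Lemma word_sum_le w x : cylinder A w x -> birkhoff_sum phi (size w) x <= word_sum phi w.
Proof.
move=> wx; apply: ub_le_sup; last by exists x.
exists (phi_bound *+ size w) => _ [y _ <-].
by have := birkhoff_norm (size w) y; rewrite ler_norml => /andP[].
Qed.

Definition distortion : R := phi_bound *+ (2 * j.+1).

(** As long as x and y share more than j letters the summands coincide; at most j + 1 summands
    remain on each side, and they are bounded crudely. *)
Lemma birkhoff_distortion n x y : agree n x y ->
  birkhoff_sum phi n x <= birkhoff_sum phi n y + distortion.
Proof.
elim: n x y => [|n IH] x y xy.
  by rewrite /birkhoff_sum !big_ord0 add0r mulrn_wge0 ?phi_bound_ge0.
have [nj|nj] := leqP n.+1 j.+1.
  have Hx := birkhoff_norm n.+1 x; have Hy := birkhoff_norm n.+1 y.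
  have Hn : phi_bound *+ n.+1 <= phi_bound *+ j.+1.
    by rewrite ler_wpMn2l// ?phi_bound_ge0.
  have -> : distortion = phi_bound *+ j.+1 + phi_bound *+ j.+1.
    by rewrite /distortion mul2n -addnn mulrnDr.
  move: Hx Hy; rewrite !ler_norml => /andP[_ Hx] /andP[Hy _].
  set a := birkhoff_sum _ _ x in Hx *; set b := birkhoff_sum _ _ y in Hy *.
  set c := phi_bound *+ n.+1 in Hx Hy Hn; set d := phi_bound *+ j.+1 in Hn *; lra.
rewrite !birkhoff_sumS (phi_loc (x := x) (y := y)) => [|m mj]; last first.
  by apply: xy; exact: leq_trans mj (ltnW nj).
by rewrite -addrA lerD2l; apply: IH => m mn; exact: xy.
Qed.

Lemma word_sum_ge w x : cylinder A w x ->
  word_sum phi w <= birkhoff_sum phi (size w) x + distortion.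
Proof.
move=> wx; apply: ge_sup; first by exists (birkhoff_sum phi (size w) x), x.
move=> _ [y wy <-]; apply: birkhoff_distortion => m mw.
have /cylinderP yw := wy; have /cylinderP xw := wx.
by rewrite [LHS]yw// [RHS]xw//; exact: set_nth_default.
Qed.

Hypothesis Psi_linked : linked A Psi.

Lemma links_exist : exists lk : I -> I -> seq I, forall a b,
  sorted A (a :: lk a b ++ [:: b]) /\ wprod psi (lk a b) = 1%g.
Proof.
have H (ab : I * I) : exists l : seq I,
    sorted A (ab.1 :: l ++ [:: ab.2]) /\ wprod psi l = 1%g.
  have [l [kl [_ sl]]] := Psi_linked ab.1 ab.2; exists l; split=> //.
  case: kl => [[/= lker [l0 _]]|->//]; by rewrite wprodE.
have [lk Hlk] := choice H; exists (fun a b => lk (a, b)) => a b; exact: (Hlk (a, b)).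
Qed.

Definition lk : I -> I -> seq I := projT1 (cid links_exist).

Lemma lk_sorted a b : sorted A (a :: lk a b ++ [:: b]).
Proof. exact: (projT2 (cid links_exist) a b).1. Qed.

Lemma wprod_lk a b : wprod psi (lk a b) = 1%g.
Proof. exact: (projT2 (cid links_exist) a b).2. Qed.

Lemma wprod_cat w w' : wprod psi (w ++ w') = (wprod psi w * wprod psi w')%g.
Proof. by elim: w => [|i w IH] /=; rewrite ?mul1g// IH mulgA. Qed.

(** Gluing through a link of trivial value, so that values multiply. No link is inserted when one of
    the words is empty. *)
Definition join (w w' : seq I) : seq I :=
  if w is a :: u then if w' is b :: _ then w ++ lk (last a u) b ++ w' else w else w'.

Lemma join_cons a u b u' : join (a :: u) (b :: u') =
  (a :: u) ++ lk (last a u) b ++ (b :: u').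
Proof. by []. Qed.

Lemma join_sorted w w' : sorted A w -> sorted A w' -> sorted A (join w w').
Proof.
case: w w' => [|a u] [|b u']// au bu'; rewrite join_cons /= cat_path.
rewrite -cat_rcons cat_path -cats1 last_cat /=.
by move: au bu' => /= -> ->; rewrite andbT; exact: lk_sorted.
Qed.

Lemma wprod_join w w' : wprod psi (join w w') = (wprod psi w * wprod psi w')%g.
Proof.
case: w w' => [|a u] [|b u']; rewrite ?mul1g ?mulg1//.
by rewrite join_cons !wprod_cat wprod_lk mul1g.
Qed.

Lemma join_prefix w w' : take (size w) (join w w') = w.
Proof.
case: w w' => [|a u] [|b u']; rewrite ?take0 ?take_size//.
by rewrite join_cons take_size_cat.
Qed.

Definition longest_link : nat := (\max_(p : I * I) size (lk p.1 p.2))%N.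

Lemma size_lk a b : (size (lk a b) <= longest_link)%N.
Proof. exact: (leq_bigmax (F := fun p : I * I => size (lk p.1 p.2)) (a, b)). Qed.

Hypothesis Psi_onto : Psi @` words A = [set: G].

(* Going from u back to v through a word of value g: all middle segments are chosen freely, so
   the values of the paths from v to u fill the coset [Psi u * G] = G. *)
Lemma step_connected (u : state A j) : exists c : G, forall v g, exists w,
  [/\ sorted A (rcons w (letter (rep v) 0)), act step w v = u & wprod psi w = (c * g)%g].
Proof.
exists (wprod psi (val u)) => v g.
have [al [al0 sal] Pal] : exists2 al, words A al & Psi al = g.
  by have : (Psi @` words A) g by rewrite Psi_onto.
pose b := letter (rep v) 0.
have su : sorted A (join (val u) al) by apply: join_sorted => //; exact: (valP u).
have tu : take j (join (val u) al) = val u.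
  by rewrite -{1}(size_tuple (val u)) join_prefix.
have ju : (j <= size (join (val u) al))%N.
  rewrite -{1}(size_tuple (val u)) -[X in (size X <= _)%N](join_prefix (val u) al).
  by rewrite size_take_min geq_minr.
have Pj : wprod psi (join (val u) al) = (wprod psi (val u) * g)%g.
  by rewrite wprod_join (wprodE al0) Pal.
case E : (join (val u) al) => [|a r] in su tu ju Pj.
  by have := leq_trans j0 ju.
have sw : sorted A (rcons ((a :: r) ++ lk (last a r) b) b).
  have -> : rcons ((a :: r) ++ lk (last a r) b) b = join (a :: r) [:: b].
    by rewrite join_cons catA cats1.
  exact: join_sorted.
exists ((a :: r) ++ lk (last a r) b); split=> //; last by rewrite wprod_cat wprod_lk mulg1.
rewrite -[X in act _ _ X](repK v) act_pre -[RHS](repK u); apply/preP => m mj.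
rewrite letter_appendx// size_cat (leq_trans mj (leq_trans ju (leq_addr _ _))).
have uE : mkseq (letter (rep u)) j = val u by rewrite -[in RHS](repK u).
rewrite nth_cat (leq_trans mj ju) -(nth_take _ mj) tu -uE nth_mkseq//.
Qed.

End words.

(** * Weights of words *)

Lemma ler_sum_inj (R : realFieldType) (X Y : finType) (P : pred X) (Q : pred Y)
    (f : X -> R) (F : Y -> R) (h : X -> Y) :
  {in P &, injective h} -> (forall x, P x -> Q (h x)) -> (forall x, P x -> f x <= F (h x)) ->
  (forall y, 0 <= F y) -> \sum_(x | P x) f x <= \sum_(y | Q y) F y.
Proof.
move=> hI PQ fF F0; apply: (@le_trans _ _ (\sum_(x in P) F (h x))).
  exact: ler_sum.
rewrite -(big_imset F hI)/= [leRHS](bigID (fun y => y \in h @: P))/=.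
rewrite -[leLHS]addr0; apply: lerD; last by apply: sumr_ge0.
rewrite le_eqVlt; apply/orP; left; apply/eqP; apply: eq_bigl => y.
apply/idP/andP => [yP|[]//]; split=> //.
by case/imsetP: yP => x xP ->; exact: PQ.
Qed.

Lemma tuple_consE (I : Type) n (t : n.-tuple I) : (0 < n)%N ->
  exists a u, t = a :: u :> seq I.
Proof. by case: n t => // n t _; case/tupleP: t => a u; exists a, u. Qed.

Section word_weights.
Context (R : realType) (I : finType) (A : incidence_matrix I) (G : groupType).
Variables (Psi : seq I -> G) (phi : shift_space A -> R) (j : nat).
Hypothesis Psi_hom : semigroup_hom Psi.
Hypothesis phi_loc : forall x y : shift_space A, agree j.+1 x y -> phi x = phi y.
Hypothesis j0 : (0 < j)%N.
Hypothesis Psi_linked : linked A Psi.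
Implicit Types (x y : shift_space A) (i : I) (w : seq I) (v : state A j).

Local Notation T := (transition (@step I A j) (psi Psi) (jump phi (j := j))).
Local Notation B := (phi_bound phi j).
Local Notation D := (distortion phi j).
Local Notation wp := (wprod (psi Psi)).
Local Notation jn := (join Psi_hom Psi_linked).

Definition ew n (w : n.-tuple I) : R := if sorted A w then expR (word_sum phi w) else 0.

Lemma ew_ge0 n (w : n.-tuple I) : 0 <= ew w.
Proof. by rewrite /ew; case: ifP => // _; exact: expR_ge0. Qed.

Definition glue_const : R := expR (D *+ 2 + B *+ longest_link Psi_hom Psi_linked).

(** Both suprema are compared with the Birkhoff sums along one point of the joined cylinder, at the
    cost of one distortion each; the link contributes at least -B times its length. *)
Lemma word_sum_join w w' : sorted A w -> sorted A w' -> w <> [::] -> w' <> [::] ->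
  word_sum phi w + word_sum phi w' <=
  D *+ 2 + B *+ longest_link Psi_hom Psi_linked + word_sum phi (jn w w').
Proof.
move=> sw sw' w0 w0'.
have [x xw] := exists_point (join_sorted Psi_hom Psi_linked sw sw').
have [l [lE ll]] : exists l, jn w w' = w ++ l ++ w' /\
    (size l <= longest_link Psi_hom Psi_linked)%N.
  case: w w' w0 w0' {sw sw' x xw} => [|a u] [|b u']// _ _.
  exists (lk Psi_hom Psi_linked (last a u) b); split; first by rewrite join_cons.
  exact: size_lk.
have xj : cylinder A (jn w w') x by [].
have xw1 : cylinder A w x.
  apply/cylinderP => n nw; have /cylinderP -> := xj; rewrite lE.
    by rewrite nth_cat nw; exact: set_nth_default.
  by rewrite size_cat (leq_trans nw)// leq_addr.
have xw2 : cylinder A w' (iter (size w + size l) (@shift I A) x).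
  apply/cylinderP => n nw; rewrite letter_iter_shift.
  have /cylinderP H := xj; rewrite [LHS]H lE.
    rewrite catA nth_cat size_cat ltnNge leq_addr/= addKn; exact: set_nth_default.
  by rewrite catA !size_cat ltn_add2l.
have := word_sum_le phi_loc xj; rewrite {1}lE catA !size_cat birkhoff_sumD birkhoff_sumD => H.
have H1 := word_sum_ge phi_loc xw1; have H2 := word_sum_ge phi_loc xw2.
have := birkhoff_norm phi_loc (size l) (iter (size w) (@shift I A) x).
rewrite ler_norml => /andP[H3 _].
have H4 : B *+ size l <= B *+ longest_link Psi_hom Psi_linked.
  by rewrite ler_wpMn2l// phi_bound_ge0.
move: H H1 H2 H3 H4; rewrite mulr2n.
set a1 := birkhoff_sum _ _ x; set a2 := birkhoff_sum _ _ (iter _ _ _).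
set a3 := birkhoff_sum _ _ (iter (_ + _) _ _).
set b1 := B *+ size l; set b2 := B *+ longest_link _ _; lra.
Qed.

(** Pairs of words are joined and sorted by the length r of the link. For fixed r the pair is
    recovered as the first l and the last n letters of the joined word, so joining is injective on
    each class. *)
Lemma ew_glue l n g : (0 < l)%N -> (0 < n)%N ->
  conv (@ew) (fun n (w : n.-tuple I) => wp w) n
    (weight (@ew) (fun n (w : n.-tuple I) => wp w) l) g <=
  glue_const * \sum_(r < (longest_link Psi_hom Psi_linked).+1)
    weight (@ew) (fun n (w : n.-tuple I) => wp w) (l + n + r) g.
Proof.
move=> l0 n0; rewrite /conv /weight mulr_sumr.
pose lkz (p : l.-tuple I * n.-tuple I) := (size (jn p.1 p.2) - (l + n))%N.
pose P (p : l.-tuple I * n.-tuple I) :=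
  [&& sorted A p.1, sorted A p.2 & wp p.1 == (g * (wp p.2)^-1)%g].
have lkE (p : l.-tuple I * n.-tuple I) :
    exists2 m, jn p.1 p.2 = p.1 ++ m ++ p.2 & size m = lkz p.
  have [m mE] : exists m, jn p.1 p.2 = p.1 ++ m ++ p.2.
    have [a [u ->]] := tuple_consE p.1 l0; have [b [u' ->]] := tuple_consE p.2 n0.
    by exists (lk Psi_hom Psi_linked (last a u) b); rewrite join_cons.
  by exists m => //; rewrite /lkz mE !size_cat !size_tuple; lia.
have lkz_lt p : (lkz p < (longest_link Psi_hom Psi_linked).+1)%N.
  have [a [u E1]] := tuple_consE p.1 l0; have [b [u' E2]] := tuple_consE p.2 n0.
  rewrite /lkz E1 E2 join_cons !size_cat -E1 -E2 !size_tuple.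
  have := size_lk Psi_hom Psi_linked (last a u) b; lia.
apply: (@le_trans _ _ (\sum_(p | P p) glue_const * expR (word_sum phi (jn p.1 p.2)))).
  under eq_bigr => w _ do rewrite mulr_sumr big_mkcond/=.
  rewrite exchange_big/= pair_big/= [leRHS]big_mkcond/=.
  apply: ler_sum => -[w' w] _ /=; rewrite /P /= /ew.
  case: (wp w' == _); last by rewrite !andbF.
  rewrite andbT; case: (boolP (sorted A w)) => sw; case: (boolP (sorted A w')) => sw' /=;
    rewrite ?mul0r ?mulr0//.
  rewrite /glue_const -!expRD ler_expR addrC; apply: word_sum_join => //.
    by move/eqP; rewrite -size_eq0 size_tuple -leqn0 leqNgt l0.
  by move/eqP; rewrite -size_eq0 size_tuple -leqn0 leqNgt n0.
rewrite (partition_big (fun p => Ordinal (lkz_lt p)) xpredT)//=.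
apply: ler_sum => r _; rewrite -mulr_sumr; apply: ler_wpM2l; first exact: expR_ge0.
(* A default that only makes the map total: on the class of r the joined word has length l + n +
   r. *)
pose t0 : (l + n + r).-tuple I := [tuple of nseq (l + n + r) (letter (point : shift_space A) 0)].
pose h (p : l.-tuple I * n.-tuple I) : (l + n + r).-tuple I := insubd t0 (jn p.1 p.2).
have hE p : Ordinal (lkz_lt p) == r -> h p = jn p.1 p.2 :> seq I.
  move=> /eqP/(congr1 val)/= pr; rewrite /h insubdK//; apply/eqP.
  have [m -> sm] := lkE p; rewrite !size_cat sm pr !size_tuple; lia.
apply: (ler_sum_inj (h := h)).
- move=> p p' /andP[_ pr] /andP[_ pr'] /(congr1 val)/=; rewrite !hE// => E.
  have [m mE sm] := lkE p; have [m' mE' sm'] := lkE p'.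
  have smr : size m = r by rewrite sm; exact: (congr1 val (eqP pr)).
  have smr' : size m' = r by rewrite sm'; exact: (congr1 val (eqP pr')).
  case: p p' {pr pr' sm sm'} mE mE' E => [p1 p2] [p1' p2'] /= mE mE'; rewrite mE mE' => E.
  have /eqP := E; rewrite eqseq_cat ?size_tuple// => /andP[/eqP E1].
  rewrite eqseq_cat ?smr ?smr'// => /andP[_ /eqP E2].
  by congr pair; apply: val_inj.
- move=> p /andP[/and3P[_ _ /eqP Pp] pr]; rewrite hE// wprod_join Pp.
  by rewrite mulgVK.
- move=> p /andP[/and3P[s1 s2 _] pr]; rewrite /ew hE// ifT//.
  exact: join_sorted.
- by move=> y; exact: ew_ge0.
Qed.

Definition total (F : state A j -> G -> R) g := \sum_v `|F v g|.

(** Forgetting the states: the admissible prefixes of v are among all words, each Birkhoff sum is at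
    most the word sum, and F is replaced by its total over states. *)
Lemma transition_le_conv n F v g : `|iter n T F v g| <=
  conv (@ew) (fun n (w : n.-tuple I) => wp w) n (total F) g.
Proof.
rewrite -[v in leLHS](repK v) iter_transition_words//.
apply: le_trans (ler_norm_sum _ _ _) _; rewrite big_mkcond/=; apply: ler_sum => w _.
case: ifP => [wx|_]; last by rewrite mulr_ge0 ?ew_ge0// sumr_ge0.
have sw : sorted A w.
  by move: wx; case: (w : seq I) => //= a u; rewrite rcons_path => /andP[].
rewrite normrM ger0_norm ?expR_ge0// /ew sw; apply: ler_pM => //.
  have := word_sum_le phi_loc (appendx_cylinder wx); by rewrite size_tuple ler_expR.
rewrite /total (bigD1 (pre j (appendx w (rep v))))//= lerDl; exact: sumr_ge0.
Qed.

Section norms.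
Variable om : state A j -> R.
Hypothesis om_gt0 : forall v, 0 < om v.

Let om0 v : 0 <= om v. Proof. exact: ltW. Qed.

Lemma sum_sqr_le (X : state A j -> R) :
  (\sum_v X v) ^+ 2 <= (\sum_v (om v)^-1) * \sum_v om v * X v ^+ 2.
Proof.
have H := weighted_cauchy (index_enum (state A j)) (fun v => (om v)^-1) (fun v => om v * X v).
have E v : (om v)^-1 * (om v * X v) = X v by rewrite mulKf// gt_eqF.
under eq_bigr => v _ do rewrite -E.
apply: le_trans H _; rewrite le_eqVlt; apply/orP; left; apply/eqP; congr (_ * _).
  by apply: eq_bigr => v _; rewrite ger0_norm// invr_ge0.
apply: eq_bigr => v _; rewrite ger0_norm ?invr_ge0// exprMn expr2 -!mulrA mulKf// gt_eqF//.
Qed.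

(** Passing from states times G to G and back costs only a factor that does not depend on n. *)
Lemma sqnorm_transition_le n (theta : R) F : ffs F ->
  (forall f, fsupp f -> fsum (fun g =>
     conv (@ew) (fun n (w : n.-tuple I) => wp w) n f g ^+ 2) <= theta * fsum (fun g => f g ^+ 2)) ->
  0 <= theta ->
  sqnorm om (iter n T F) <= (\sum_v om v) * (\sum_v (om v)^-1) * theta * sqnorm om F.
Proof.
move=> fF Hth th0.
have ft : fsupp (total F) by apply: fsupp_sum => v _; exact: fsupp_norm.
have H1 : fsum (fun g => total F g ^+ 2) <= (\sum_v (om v)^-1) * sqnorm om F.
  apply: (@le_trans _ _ (fsum (fun g => (\sum_v (om v)^-1) * \sum_v om v * F v g ^+ 2))).
    apply: le_fsum => [||g]; first exact: fsuppX.
      by apply/fsuppMr/fsupp_sum => v _; apply/fsuppMr/fsuppX.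
    apply: le_trans (sum_sqr_le _) _; rewrite ler_wpM2l ?sumr_ge0// => [v _|].
      by rewrite invr_ge0.
    by apply: ler_sum => v _; rewrite real_normK ?num_real.
  rewrite fsumZ fsum_sum => [|v _]; last by apply/fsuppMr/fsuppX.
  rewrite le_eqVlt; apply/orP; left; apply/eqP; congr (_ * _).
  by apply: eq_bigr => v _; rewrite fsumZ.
have S0 : 0 <= \sum_v om v by apply: sumr_ge0.
rewrite -!mulrA; apply: (@le_trans _ _ (\sum_v om v * (theta * fsum (fun g => total F g ^+ 2)))).
  apply: ler_sum => v _; apply: ler_wpM2l => //; apply: le_trans (Hth _ ft).
  apply: le_fsum => [||g].
  - by apply/fsuppX/ffs_iter.
  - by apply/fsuppX/conv_fsupp.
  - rewrite -(real_normK (num_real (iter n T F v g))) lerXn2r ?nnegrE//; last first.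
      exact: transition_le_conv.
    exact: le_trans (transition_le_conv n F v g).
rewrite -mulr_suml; apply: ler_wpM2l => //; rewrite mulrCA; apply: ler_wpM2l => //.
Qed.

Definition unit_fun (v : state A j) (g : G) : R := if g == 1%g then 1 else 0.

Lemma unit_fun_ffs : ffs unit_fun.
Proof.
move=> v; exists [fset 1%g]%fset => g; rewrite inE /unit_fun => /negbTE -> //.
Qed.

(** Every admissible w can be followed by some letter b, so w is counted at a state starting with b;
    one distortion is lost because the Birkhoff sum there replaces the supremum. *)
Lemma kernel_weight_le n :
  expR (- D) * weight (@ew) (fun n (w : n.-tuple I) => wp w) n 1%g <=
  \sum_v iter n T unit_fun v 1%g.
Proof.
have nE v : iter n T unit_fun v 1%g = \sum_(w : n.-tuple I | sorted A (rcons w (letter (rep v) 0)))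
    expR (birkhoff_sum phi n (appendx w (rep v))) * (if wp w == 1%g then 1 else 0).
  rewrite -[v in LHS](repK v) iter_transition_words//; apply: eq_bigr => w _.
  by rewrite /unit_fun mul1g -(invg_eq1 (wp w)).
under eq_bigr => v _ do rewrite nE big_mkcond.
rewrite exchange_big/= /weight mulr_sumr [leLHS]big_mkcond/=; apply: ler_sum => w _.
have tge0 (v : state A j) : 0 <= (if sorted A (rcons w (letter (rep v) 0)) then
    expR (birkhoff_sum phi n (appendx w (rep v))) * (if wp w == 1%g then 1 else 0) else 0) :> R.
  by case: ifP => // _; apply: mulr_ge0; [exact: expR_ge0|case: ifP => _; rewrite ?ler01].
have t0 (P : pred (state A j)) : 0 <= \sum_(v | P v) (if sorted A (rcons w (letter (rep v) 0)) then
    expR (birkhoff_sum phi n (appendx w (rep v))) * (if wp w == 1%g then 1 else 0) else 0) :> R.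
  by apply: sumr_ge0 => v _; exact: tge0.
case: ifP => w1; last by move: (t0 xpredT); rewrite w1.
rewrite /ew; case: ifP => sw; last by move: (t0 xpredT); rewrite w1 mulr0.
have [b wb] : exists b, sorted A (rcons w b).
  case: (w : seq I) sw => [|a u] /= au; first by exists (letter (point : shift_space A) 0).
  by have [b ub] := incidence_succ A (last a u); exists b; rewrite rcons_path au.
pose v := pre j (orbit_point A b).
have vb : letter (rep v) 0 = b by rewrite letter_rep.
rewrite (bigD1 v)//= -[leLHS]addr0; apply: lerD; last by move: (t0 (fun u => u != v)); rewrite w1.
rewrite vb wb mulr1 -expRD ler_expR.
have wc : cylinder A w (appendx w (rep v)) by apply: appendx_cylinder; rewrite vb.
have := word_sum_ge phi_loc wc; rewrite size_tuple.
by move: (word_sum _ _) (birkhoff_sum _ _ _) => a c ?; lra.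
Qed.

Lemma sqnorm_kernel_ge n :
  (expR (- D) * weight (@ew) (fun n (w : n.-tuple I) => wp w) n 1%g) ^+ 2 <=
  (\sum_v (om v)^-1) * sqnorm om (iter n T unit_fun).
Proof.
have W0 : 0 <= expR (- D) * weight (@ew) (fun n (w : n.-tuple I) => wp w) n 1%g.
  by rewrite mulr_ge0 ?expR_ge0// weight_ge0// => ? ?; exact: ew_ge0.
apply: le_trans (_ : _ <= (\sum_v iter n T unit_fun v 1%g) ^+ 2) _.
  by rewrite lerXn2r ?nnegrE ?(le_trans W0) ?kernel_weight_le.
apply: le_trans (sum_sqr_le _) _; apply: ler_wpM2l.
  by apply: sumr_ge0 => v _; rewrite invr_ge0.
apply: ler_sum => v _; apply: ler_wpM2l => //.
apply: (@ler_fsum_point _ _ (fun g => iter n T unit_fun v g ^+ 2)) => [|g].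
  by apply/fsuppX/ffs_iter/unit_fun_ffs.
exact: sqr_ge0.
Qed.

Lemma sqnorm_unit_fun : sqnorm om unit_fun = \sum_v om v.
Proof.
apply: eq_bigr => v _; rewrite (@fsumE _ _ [fset 1%g]%fset) ?big_seq_fset1.
  by rewrite /unit_fun eqxx expr1n mulr1.
by move=> g; rewrite inE /unit_fun => /negbTE ->; rewrite expr0n.
Qed.

End norms.

End word_weights.

(** * Measurability on the shift space *)

Section topology.
Context (I : finType) (A : incidence_matrix I).
Implicit Types (x y : shift_space A) (i : I) (w : seq I) (U : set (shift_space A)).

Let P := prod_topology (fun _ : nat => discrete_topology I).

Let agreement_filter (p : P) : set_system P :=
  filter_from [set: nat] (fun n => [set y : P | forall m, (m < n)%N -> y m = p m]).

Let agreement_filterP (p : P) : Filter (agreement_filter p).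
Proof.
apply: filter_from_filter; first by exists 0%N.
move=> m n _ _; exists (maxn m n) => // y /= H.
by split=> k kn; apply: H; rewrite leq_max kn ?orbT.
Qed.

Lemma agreement_cvg (p : P) : agreement_filter p --> p.
Proof.
have FF := agreement_filterP p; apply/cvg_sup => m B [_ [[C oC <-] /= Cp sB]].
exists m.+1 => // y /= Hy; apply: sB => /=.
by rewrite Hy.
Qed.

Lemma open_agree U x : open U -> U x -> exists n, forall y, agree n x y -> U y.
Proof.
move=> [W oW <-] Wx.
have nW : nbhs (set_val x : P) W by apply: open_nbhs_nbhs.
have [n _ nH] := agreement_cvg nW.
exists n => y xy; apply: nH => m mn; apply/esym; exact: xy.
Qed.

Lemma letter_open m i : open [set x : shift_space A | letter x m = i].
Proof.
exists [set p : P | p m = i] => //; rewrite openE => p /= pi.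
have /cvg_sup/(_ m) : nbhs p --> p by exact: cvg_id.
apply; exists [set y : P | y m = i] => //; split=> //.
by exists [set i : discrete_topology I] => //; exact: discrete_open.
Qed.

Lemma agree_open n x : open [set y | agree n x y].
Proof.
elim: n => [|n IH].
  by rewrite (_ : [set y | _] = setT); [exact: openT|apply/seteqP; split].
rewrite (_ : [set y | _] = [set y | agree n x y] `&` [set y | letter y n = letter x n]).
  by apply: openI => //; exact: letter_open.
apply/seteqP; split=> y /=; first by move=> xy; split=> [m mn|]; rewrite xy// ltnW.
by move=> [xy yn] m; rewrite ltnS leq_eqVlt => /predU1P[->|/xy].
Qed.

Lemma continuous_agree (R : realType) (f : shift_space A -> R) :
  (forall x (e : R), 0 < e -> exists n, forall y, agree n x y -> `|f x - f y| < e) ->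
  continuous f.
Proof.
move=> H x B /nbhs_ballP[e /= /(H x)[n xn] fB].
suff : nbhs x (f @^-1` B) by [].
rewrite nbhsE; exists [set y | agree n x y] => [|y /xn fxy]; last exact: fB.
by split; [exact: agree_open|].
Qed.

Lemma cylinder_open w : open (cylinder A w).
Proof.
have [->|/set0P[x /[dup] wx /cylinderP xw]] := eqVneq (cylinder A w) set0; first exact: open0.
rewrite (_ : cylinder A w = [set y | agree (size w) x y]); first exact: agree_open.
have E : mkseq (letter x) (size w) = w by exact: wx.
by rewrite -{1}E; apply/seteqP; split=> y /= /cylinder_mkseq.
Qed.

Definition cylinders : set (set (shift_space A)) := range (cylinder A).

(** There are only countably many words, so an open set is the countable union of the cylinders that
    it contains. *)
Lemma measurable_cylinders : @measurable _ (shift_space A) = <<s cylinders >>.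
Proof.
apply/seteqP; split; apply: smallest_sub.
- exact: smallest_sigma_algebra.
- move=> U oU.
  pose F (n : nat) : set (shift_space A) := if (choice.unpickle n : option (seq I)) is Some w then
    if `[< cylinder A w `<=` U >] then cylinder A w else set0 else set0.
  have -> : U = \bigcup_n F n.
    apply/seteqP; split=> [x Ux|x [n _]]; last first.
      by rewrite /F; case: choice.unpickle => // w; case: asboolP => // H /H.
    have [n xn] := open_agree oU Ux.
    exists (choice.pickle (mkseq (letter x) n)) => //; rewrite /F choice.pickleK asboolT.
      by apply/cylinder_mkseq.
    by move=> y /cylinder_mkseq/xn.
  apply: (@bigcupT_measurable _ (g_sigma_algebraType cylinders)) => n.
  rewrite /F; case: choice.unpickle => [w|]; last exact: measurable0.
  case: asboolP => _; last exact: measurable0.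
  by apply: sub_sigma_algebra; exists w.
- exact: smallest_sigma_algebra.
- by move=> _ [w _ <-]; apply: sub_sigma_algebra; exact: cylinder_open.
Qed.

Lemma measurable_cylinder w : measurable (cylinder A w).
Proof. by apply: sub_sigma_algebra; exact: cylinder_open. Qed.

Lemma measurable_letter m i : measurable [set x : shift_space A | letter x m = i].
Proof. by apply: sub_sigma_algebra; exact: letter_open. Qed.

Lemma measurable_fun_letters d (T : measurableType d) (f : T -> shift_space A) :
  (forall m i, measurable [set t | letter (f t) m = i]) -> measurable_fun setT f.
Proof.
move=> H; apply: (measurability cylinders measurable_cylinders).
move=> _ [_ [w _ <-] <-]; rewrite setTI.
pose x0 := letter (point : shift_space A) 0.
rewrite (_ : f @^-1` _ = \bigcap_(m in `I_(size w)) [set t | letter (f t) m = nth x0 w m]).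
  by apply: fin_bigcap_measurable => // m _; exact: H.
apply/seteqP; split=> t /=.
  move=> /cylinderP tw m /= mw; rewrite [LHS]tw//; exact: set_nth_default.
move=> tw; apply/cylinderP => m mw; rewrite [LHS]tw//; exact: set_nth_default.
Qed.

Lemma measurable_shift : measurable_fun setT (@Defs.shift I A).
Proof. by apply: measurable_fun_letters => m i; exact: measurable_letter. Qed.

Lemma measurable_consx i : measurable_fun setT (@consx I A i).
Proof.
apply: measurable_fun_letters => m k.
pose D := \bigcup_(l in [set l | A i l]) [set x : shift_space A | letter x 0 = l].
have mD : measurable D by apply: fin_bigcup_measurable => // l _; exact: measurable_letter.
have DP x : D x <-> A i (letter x 0).
  by split=> [[l /= il ->]//|ix]; exists (letter x 0).
rewrite (_ : [set x | _] =
  (D `&` [set x | if m is m'.+1 then letter x m' = k else i = k]) `|`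
  (~` D `&` [set x | letter x m = k])); last first.
  apply/seteqP; split=> x /=.
    have [ix|ix] := boolP (A i (letter x 0)).
      case: m => [|m]; rewrite ?letter_consx0 ?letter_consxS// => xk; left; split=> //;
        by apply/DP.
    by rewrite consx_id// => xk; right; split=> // /DP; exact/negP.
  move=> [[/DP ix]|[nD xk]]; last first.
    by rewrite consx_id//; apply/negP => /DP.
  by case: m => [|m]; rewrite ?letter_consx0 ?letter_consxS.
apply: measurableU; apply: measurableI => //.
- case: m => [|m]; last exact: measurable_letter.
  have [->|ik] := eqVneq i k.
    by rewrite (_ : [set _ | _] = setT)//; apply/seteqP; split.
  by rewrite (_ : [set _ | _] = set0)//; apply/seteqP; split=> // x /= /eqP; rewrite (negbTE ik).
- exact: measurableC.
- exact: measurable_letter.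
Qed.

Lemma continuous_measurable (R : realType) (f : shift_space A -> R) :
  continuous f -> measurable_fun setT f.
Proof.
move=> cf; apply: (measurability _ (RGenOpens.measurableE R)).
move=> _ [_ [a [b ->]] <-]; rewrite setTI; apply: sub_sigma_algebra.
by apply: (continuousP _).1 => //; exact: interval_open.
Qed.

End topology.

(** * Integrals as monotone functionals *)

Local Open Scope ereal_scope.

Section integral_functional.
Context d (X : measurableType d) (R : realType) (m : {measure set X -> \bar R}).
Variable J : (X -> \bar R) -> \bar R.
Hypothesis J_indic : forall C, measurable C -> J (fun x => (\1_C x)%:E) = m C.
Hypothesis J_add : forall f g : X -> \bar R, measurable_fun setT f -> measurable_fun setT g ->
  (forall x, 0 <= f x) -> (forall x, 0 <= g x) -> J (fun x => f x + g x) = J f + J g.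
Hypothesis J_scale : forall (c : R) (f : X -> \bar R), measurable_fun setT f -> (forall x, 0 <= f x) ->
  (0 <= c)%R -> J (fun x => c%:E * f x) = c%:E * J f.
Hypothesis J_lim : forall (f_ : nat -> X -> \bar R) (f : X -> \bar R), (forall n, measurable_fun setT (f_ n)) ->
  (forall n x, 0 <= f_ n x) -> (forall x, nondecreasing_seq (f_ ^~ x)) ->
  (forall x, f_ ^~ x @ \oo --> f x) -> J f = limn (fun n => J (f_ n)).

Import HBNNSimple.

Let J_simple (f : {nnsfun X >-> R}) : J (fun x => (f x)%:E) = \int[m]_x (f x)%:E.
Proof.
have ff : finite_set (range f) by exact: fimfunP.
have fE x : (f x)%:E = \sum_(y <- fset_set (range f)) y%:E * (\1_(f @^-1` [set y]) x)%:E.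
  by rewrite -fsbig_finite// {1}(fimfunE f x) -fsumEFin.
have ypos y : y \in fset_set (range f) -> (0 <= y)%R.
  by rewrite in_fset_set// inE => -[x _ <-]; exact: fun_ge0.
have mi y : measurable_fun setT (fun x => (\1_(f @^-1` [set y]) x)%:E : \bar R).
  exact/measurable_EFinP.
have H (s : seq R) : (forall y, y \in s -> (0 <= y)%R) ->
    J (fun x => \sum_(y <- s) y%:E * (\1_(f @^-1` [set y]) x)%:E) =
    \sum_(y <- s) y%:E * m (f @^-1` [set y]).
  elim: s => [_|y s IH ys].
    have J0 : J (fun x => (\1_set0 x)%:E) = 0 by rewrite J_indic// measure0.
    by rewrite big_nil -[RHS]J0; congr J; apply/funext => x; rewrite big_nil indic0.
  have y0 : (0 <= y)%R by apply: ys; rewrite mem_head.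
  have s0 z : z \in s -> (0 <= z)%R by move=> zs; apply: ys; rewrite inE zs orbT.
  rewrite big_cons -IH// -J_indic; last exact: measurable_sfunP.
  rewrite -J_scale//.
  rewrite -J_add.
  - by congr J; apply/funext => x; rewrite big_cons.
  - exact: measurable_funeM.
  - by apply: emeasurable_sum => z; exact: measurable_funeM.
  - by move=> x; rewrite mule_ge0// lee_fin.
  - move=> x; rewrite big_seq; apply: sume_ge0 => z zs.
    by apply: mule_ge0; rewrite lee_fin// s0.
rewrite [in LHS](_ : (fun x => (f x)%:E) =
  fun x => \sum_(y <- fset_set (range f)) y%:E * (\1_(f @^-1` [set y]) x)%:E); last first.
  by apply/funext => x; rewrite fE.
rewrite H// integralT_nnsfun sintegralE -fsbig_finite//.
Qed.

(** The passage from indicators to simple functions to increasing limits, done once for an abstract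
    functional. It is applied to weighted pullbacks and to iterated integrals, and yields
    conformality, the density of [mu_phi] and the product formula. *)
Lemma integral_functional F : measurable_fun setT F -> (forall x, 0 <= F x) ->
  J F = \int[m]_x F x.
Proof.
move=> mF F0; pose g := nnsfun_approx measurableT mF.
have g_cvg x : (fun n => (g n x)%:E) @ \oo --> F x by exact: cvg_nnsfun_approx.
have g_nd x : nondecreasing_seq (fun n => (g n x)%:E).
  by move=> a b ab; rewrite lee_fin; exact/lefP/nd_nnsfun_approx.
have g0 n x : 0 <= (g n x)%:E by rewrite lee_fin.
have mg n : measurable_fun setT (fun x => (g n x)%:E) by exact/measurable_EFinP.
rewrite (J_lim mg g0 g_nd g_cvg).
have -> : \int[m]_x F x = \int[m]_x limn (fun n => (g n x)%:E).
  by apply: eq_integral => x _; apply/esym/cvg_lim => //; exact: g_cvg.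
rewrite (monotone_convergence _ measurableT mg)//.
by congr (limn _); apply/funext => n; rewrite J_simple.
Qed.

End integral_functional.

Section counting_integral.
Context (R : realType) (G : groupType).
Hypothesis G_countable : countable [set: G].

Lemma measurable_fun_group d (Y : measurableType d) (f : discrete_group G -> Y) :
  measurable_fun setT f.
Proof. by []. Qed.

Lemma integral_counting (f : discrete_group G -> \bar R) : (forall g, 0 <= f g) ->
  \int[@counting (discrete_group G) R]_g f g = \esum_(g in [set: G]) f g.
Proof.
move=> f0; have /countable_injP[e eI] := G_countable.
pose F n : set (discrete_group G) := [set g | e g = n].
have FT : [set: discrete_group G] = \bigcup_n F n.
  by apply/seteqP; split=> g // _; exists (e g).
have tF : trivIset setT F.
  apply/trivIsetP => i j _ _ /eqP ij; apply/seteqP; split=> // g [/= gi gj].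
  by apply: ij; rewrite -gi -gj.
have F1 n : F n = set0 \/ exists g, F n = [set g].
  have [[g gn]|H] := pselect (exists g, F n g); [right|left].
    exists g; apply/seteqP; split=> g' /=; last by move=> ->.
    by move=> g'n; apply: eI; rewrite ?inE//= g'n gn.
  by apply/seteqP; split=> // g gn; apply: H; exists g.
rewrite [in LHS]FT ge0_integral_bigcup//.
have -> : \esum_(g in [set: G]) f g = \esum_(g in \bigcup_n F n) f g by rewrite -FT.
rewrite esum_bigcupT// nneseries_esumT => [|n]; last exact: integral_ge0.
apply: eq_esum => n _; have [->|[g ->]] := F1 n.
  by rewrite integral_set0 esum_set0.
rewrite esum_set1//.
have -> : \int[@counting (discrete_group G) R]_(x in [set g]) f x =
    \int[@counting (discrete_group G) R]_(x in [set g]) f g.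
  by apply: eq_integral => x; rewrite inE => ->.
rewrite integral_cst//= -[RHS]mule1; congr (_ * _).
have f1 : finite_set [set g] by exact: finite_set1.
by rewrite /counting asboolT// fset_set1 cardfs1.
Qed.

End counting_integral.

Section functional_on_generators.
Context d (X : measurableType d) (R : realType) (m : probability X R).
Variables (Gen : set (set X)) (J : (X -> \bar R) -> \bar R).
Hypothesis GenI : setI_closed Gen.
Hypothesis GenE : @measurable _ X = <<s Gen >>.
Hypothesis J_gen : forall C, Gen C -> J (fun x => (\1_C x)%:E) = m C.
Hypothesis J_setT : J (fun x => (\1_setT x)%:E) = m setT.
Hypothesis J_add : forall f g : X -> \bar R, measurable_fun setT f -> measurable_fun setT g ->
  (forall x, 0 <= f x) -> (forall x, 0 <= g x) -> J (fun x => f x + g x) = J f + J g.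
Hypothesis J_lim : forall (f_ : nat -> X -> \bar R) (f : X -> \bar R),
  (forall n, measurable_fun setT (f_ n)) ->
  (forall n x, 0 <= f_ n x) -> (forall x, nondecreasing_seq (f_ ^~ x)) ->
  (forall x, f_ ^~ x @ \oo --> f x) -> J f = limn (fun n => J (f_ n)).

(** Dynkin's argument: the sets on which J and m agree form a lambda-system; proper differences use
    that m is finite. *)
Lemma functional_on_measurable C : measurable C -> J (fun x => (\1_C x)%:E) = m C.
Proof.
pose H := [set C | measurable C /\ J (fun x => (\1_C x)%:E) = m C].
have m1 (D : set X) : measurable D -> measurable_fun setT (fun x => (\1_D x)%:E : \bar R).
  by move=> mD; exact/measurable_EFinP.
have i0 (D : set X) x : 0 <= (\1_D x)%:E :> \bar R by rewrite lee_fin indicE.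
suff : <<s Gen >> `<=` H by move=> sub mC; have [|_ ->//] := sub C; rewrite -GenE.
apply: (lambda_system_subset GenI) => //; last first.
  by move=> D GD; split; [rewrite GenE; exact: sub_sigma_algebra|exact: J_gen].
split=> //.
- move=> D E ED [mD JD] [mE JE]; have mDE := measurableD mD mE; split=> //.
  have : J (fun x => (\1_D x)%:E) = J (fun x => (\1_E x)%:E) + J (fun x => (\1_(D `\` E) x)%:E).
    rewrite -J_add//; [|exact: m1|exact: m1]; congr J; apply/funext => x.
    rewrite -EFinD; congr EFin; rewrite !indicE in_setD.
    have [xE|xE] := boolP (x \in E); last by rewrite andbT add0r.
    by rewrite andbF addr0 (mem_set (ED _ (set_mem xE))).
  rewrite JD JE => DE; have fE : m E \is a fin_num by exact: fin_num_measure.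
  have fD : m D < +oo by rewrite -ge0_fin_numE// fin_num_measure.
  have -> : m (D `\` E) = m D - m E by rewrite measureD// (setIidr ED).
  by rewrite DE addeAC subee// add0e.
- move=> F ndF HF; have mF n : measurable (F n) by have [] := HF n.
  have mU : measurable (\bigcup_n F n) by exact: bigcupT_measurable.
  split=> //; rewrite (J_lim (f_ := fun n x => (\1_(F n) x)%:E)) => [|n|//|x|x].
  + rewrite (_ : (fun n => _) = m \o F).
      by apply/cvg_lim => //; exact: nondecreasing_cvg_mu.
    by apply/funext => n; have [] := HF n.
  + exact: m1.
  + move=> a b ab; rewrite lee_fin !indicE ler_nat.
    case: (boolP (x \in F a)) => // /set_mem Fa; rewrite mem_set//.
    by move: (ndF _ _ ab) => /subsetPset; exact.
  + have [xU|xU] := boolP (x \in \bigcup_n F n).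
      have [n _ Fn] := set_mem xU.
      apply: cvg_near_cst; exists n => // k /= nk; rewrite !indicE xU mem_set//.
      by move: (ndF _ _ nk) => /subsetPset; exact.
    apply: cvg_near_cst; apply: nearW => n; rewrite !indicE (negbTE xU).
    case: (boolP (x \in F n)) => // /set_mem Fn.
    by move/negP: xU; case; apply/mem_set; exists n.
Qed.

End functional_on_generators.

Local Close Scope ereal_scope.

(** * Conformality and invariance *)

Local Open Scope ereal_scope.

Section pullback.
Context d d' (X : measurableType d) (Y : measurableType d') (R : realType).
Variables (mu : {measure set X -> \bar R}) (K : finType) (c : K -> X -> R) (t : K -> X -> Y).
Hypothesis c0 : forall k x, (0 <= c k x)%R.
Hypothesis mc : forall k, measurable_fun setT (c k).
Hypothesis mt : forall k, measurable_fun setT (t k).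
Implicit Types F : Y -> \bar R.

(** A finite sum over weighted branches. With the letters as index it is a transfer operator, with a
    single branch it is multiplication by a density. *)
Definition pullback F x := \sum_k (c k x)%:E * F (t k x).

Lemma pullback_ge0 F : (forall y, 0 <= F y) -> forall x, 0 <= pullback F x.
Proof. by move=> F0 x; apply: sume_ge0 => k _; rewrite mule_ge0 ?lee_fin. Qed.

Lemma measurable_pullback F : measurable_fun setT F -> measurable_fun setT (pullback F).
Proof.
move=> mF; apply: emeasurable_sum => k; apply: emeasurable_funM.
  exact/measurable_EFinP.
exact: measurableT_comp.
Qed.

Lemma pullbackD F F' : measurable_fun setT F -> measurable_fun setT F' ->
  (forall y, 0 <= F y) -> (forall y, 0 <= F' y) ->
  \int[mu]_x pullback (fun y => F y + F' y) x =
  \int[mu]_x pullback F x + \int[mu]_x pullback F' x.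
Proof.
move=> mF mF' F0 F'0; rewrite -ge0_integralD//.
- apply: eq_integral => x _; rewrite /pullback -big_split/=; apply: eq_bigr => k _.
  by rewrite ge0_muleDr.
- by move=> x _; exact: pullback_ge0.
- exact: measurable_pullback.
- by move=> x _; exact: pullback_ge0.
- exact: measurable_pullback.
Qed.

Lemma pullbackZ (a : R) F : measurable_fun setT F -> (forall y, 0 <= F y) -> (0 <= a)%R ->
  \int[mu]_x pullback (fun y => a%:E * F y) x = a%:E * \int[mu]_x pullback F x.
Proof.
move=> mF F0 a0; rewrite -ge0_integralZl_EFin//.
- apply: eq_integral => x _; rewrite /pullback ge0_sume_distrr => [|k _].
    by apply: eq_bigr => k _; rewrite muleCA.
  by rewrite mule_ge0 ?lee_fin.
- by move=> x _; exact: pullback_ge0.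
- exact: measurable_pullback.
Qed.

Lemma pullback_lim (f_ : nat -> Y -> \bar R) F : (forall n, measurable_fun setT (f_ n)) ->
  (forall n y, 0 <= f_ n y) -> (forall y, nondecreasing_seq (f_ ^~ y)) ->
  (forall y, f_ ^~ y @ \oo --> F y) ->
  \int[mu]_x pullback F x = limn (fun n => \int[mu]_x pullback (f_ n) x).
Proof.
move=> mf f0 fnd fF.
rewrite -monotone_convergence//.
- apply: eq_integral => x _; apply/esym/cvg_lim => //.
  apply: cvg_nnesum => [k _|k _]; last exact: cvgeZl.
  by apply: nearW => n; rewrite mule_ge0 ?lee_fin.
- by move=> n; exact: measurable_pullback.
- by move=> n x _; exact: pullback_ge0.
- move=> x _ a b ab; apply: lee_sum => k _; apply: lee_wpmul2l; first by rewrite lee_fin.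
  exact: fnd.
Qed.

End pullback.

(** * The Gibbs measure and its product with the counting measure *)

Section gibbs.
Context (R : realType) (I : finType) (A : incidence_matrix I) (G : groupType).
Hypothesis G_countable : countable [set: G].
Variables (Psi : seq I -> G) (phi : shift_space A -> R) (j : nat).
Hypothesis phi_loc : forall x y : shift_space A, agree j.+1 x y -> phi x = phi y.
Hypothesis j0 : (0 < j)%N.
Variables (mu : probability (shift_space A) R) (h : shift_space A -> R).
Variable mu_phi : probability (shift_space A) R.
Hypothesis gibbs : gibbs_measure phi mu h mu_phi.

Definition lam : R := expR (topological_pressure phi).

Lemma lam_gt0 : (0 < lam)%R. Proof. exact: expR_gt0. Qed.

Definition jw i x : R := jump phi i (pre j x).

Lemma jwE i x : jw i x = if A i (letter x 0) then expR (phi (consx i x)) else 0%R.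
Proof. exact: jump_pre. Qed.

Lemma jw_ge0 i x : (0 <= jw i x)%R. Proof. exact: jump_ge0. Qed.

Lemma continuous_local n (f : shift_space A -> R) :
  (forall x y, agree n x y -> f x = f y) -> continuous f.
Proof.
move=> floc; apply: continuous_agree => x e e0; exists n => y /floc ->.
by rewrite subrr normr0.
Qed.

Lemma measurable_local n (f : shift_space A -> R) :
  (forall x y, agree n x y -> f x = f y) -> measurable_fun setT f.
Proof. by move=> floc; apply: continuous_measurable; exact: (continuous_local floc). Qed.

Lemma measurable_jw i : measurable_fun setT (jw i).
Proof. by apply: (@measurable_local j) => x y /preP xy; rewrite /jw xy. Qed.

Let h_gt0 x : (0 < h x)%R. Proof. by have [_ [+ _ _ _] _] := gibbs. Qed.

Lemma measurable_h : measurable_fun setT h.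
Proof.
have [_ [_ [C [al [al0 hC]]] _ _] _] := gibbs.
apply: continuous_measurable; apply: continuous_agree => x e e0.
have : (fun n => C * expR (- al) ^+ n)%R @ \oo --> (0 : R)%R.
  rewrite -[X in _ --> X](mulr0 C); apply: cvgM; first exact: cvg_cst.
  apply: cvg_expr; rewrite ger0_norm ?expR_ge0//.
  by rewrite -expR0 ltr_expR oppr_lt0.
move=> /cvgrPdist_lt/(_ _ e0)[n _ /(_ n (leqnn n))] /=.
rewrite sub0r normrN => Cn; exists n => y xy.
apply: le_lt_trans (hC n x y xy) _; apply: le_lt_trans Cn.
by rewrite -expRM_natr ler_norm.
Qed.

Lemma transfer_jw (f : shift_space A -> R) x : transfer phi f x = (\sum_i jw i x * f (consx i x))%R.
Proof.
rewrite transferE big_mkcond; apply: eq_bigr => i _; rewrite jwE.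
by case: ifP => // _; rewrite mul0r.
Qed.

Let c i x : R := (lam^-1 * jw i x)%R.

Let c_ge0 i x : (0 <= c i x)%R.
Proof. by rewrite mulr_ge0 ?jw_ge0// invr_ge0 expR_ge0. Qed.

Let mc i : measurable_fun setT (c i).
Proof. by apply: measurable_funM; [exact: measurable_cst|exact: measurable_jw]. Qed.

Lemma conformal_local n (f : shift_space A -> R) : (forall x, 0 <= f x)%R ->
  (forall x y, agree n x y -> f x = f y) -> (exists M, forall x, (f x <= M)%R) ->
  \int[mu]_x pullback c (@consx I A) (fun x => (f x)%:E) x = \int[mu]_x (f x)%:E.
Proof.
move=> f0 floc [M fM]; have [conf _ _] := gibbs.
have mf := measurable_local floc.
have bf : bounded_fun f.
  exists M; split; first exact: num_real.
  move=> M' MM' x _ /=; rewrite ger0_norm//; exact: le_trans (fM x) (ltW MM').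
have := conf f (continuous_local floc) bf => E.
have -> : \int[mu]_x pullback c (@consx I A) (fun x => (f x)%:E) x =
    \int[mu]_x ((lam^-1)%:E * (transfer phi f x)%:E).
  apply: eq_integral => x _; rewrite /pullback transfer_jw -EFinM mulr_sumr -sumEFin.
  by apply: eq_bigr => i _; rewrite -EFinM mulrA.
have t0 x : (0 <= transfer phi f x)%R.
  by rewrite transfer_jw; apply: sumr_ge0 => i _; rewrite mulr_ge0// jw_ge0.
rewrite ge0_integralZl_EFin//.
- by rewrite E muleA -EFinM mulVf ?mul1e// gt_eqF// lam_gt0.
- by move=> x _; rewrite lee_fin.
- apply/measurable_EFinP; rewrite (_ : transfer phi f = fun x => \sum_i jw i x * f (consx i x))%R.
    apply: measurable_sum => i; apply: measurable_funM; first exact: measurable_jw.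
    by apply: measurableT_comp => //; exact: measurable_consx.
  by apply/funext => x; exact: transfer_jw.
- by rewrite invr_ge0 expR_ge0.
Qed.

(** Conformality is given for bounded continuous functions. Indicators of cylinders are among these,
    and they determine both sides. *)
Lemma conformal_ge0 F : measurable_fun setT F -> (forall x, 0 <= F x) ->
  \int[mu]_x pullback c (@consx I A) F x = \int[mu]_x F x.
Proof.
have mt i : measurable_fun setT (@consx I A i) by exact: measurable_consx.
(* Two cylinders are nested or disjoint, so with the empty set they are closed under
   intersection. *)
pose Gen := [set C | C = set0 \/ @cylinders I A C].
have ind0 (C : set (shift_space A)) x : (0 <= \1_C x :> R)%R by rewrite indicE.
have ind1 (C : set (shift_space A)) x : (\1_C x <= 1 :> R)%R by rewrite indicE; case: (_ \in C).
have onGen n (C : set (shift_space A)) : measurable C ->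
    (forall x y, agree n x y -> C x -> C y) ->
    \int[mu]_x pullback c (@consx I A) (fun x => (\1_C x)%:E) x = mu C.
  move=> mC Cloc; rewrite (@conformal_local n) => [|//|x y xy|].
  - by rewrite integral_indic// setIT.
  - rewrite !indicE; congr (_%:R)%R; congr nat_of_bool.
    apply/idP/idP => /set_mem Cx; apply/mem_set; first exact: Cloc Cx.
    by apply: Cloc Cx => m mn; rewrite xy.
  - by exists 1%R => x; exact: ind1.
apply: (integral_functional (J := fun F => \int[mu]_x pullback c (@consx I A) F x)) => //;
  [|by move=> f g *; exact: pullbackD|by move=> a f *; exact: pullbackZ|exact: pullback_lim].
apply: (@functional_on_measurable _ _ _ mu Gen
  (fun F => \int[mu]_x pullback c (@consx I A) F x)).
- have inter w w' : (size w <= size w')%N -> Gen (cylinder A w `&` cylinder A w').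
    move=> ww'; have [H|/existsNP[x xww]] := pselect (forall x, ~ (cylinder A w `&` cylinder A w') x).
      by left; apply/seteqP; split=> // x /H.
    have [xw xw'] := contrapT xww.
    right; exists w' => //; apply/seteqP; split=> [y yw'|y []//]; split=> //.
    apply/cylinderP => m mw; have mw' := leq_trans mw ww'.
    have /cylinderP -> // := yw'.
    have /cylinderP Hx := xw; have /cylinderP Hx' := xw'.
    rewrite (set_nth_default (letter x 0)) // -[LHS]Hx'// [LHS]Hx//.
    exact: set_nth_default.
  move=> B C [->|[w _ <-]] [->|[w' _ <-]]; rewrite ?set0I ?setI0; do ?by left.
  have [ww'|/ltnW w'w] := leqP (size w) (size w'); first exact: inter.
  by rewrite setIC; exact: inter.
- rewrite measurable_cylinders; apply/seteqP; split; apply: smallest_sub.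
  + exact: smallest_sigma_algebra.
  + by move=> C CC; apply: sub_sigma_algebra; right.
  + exact: smallest_sigma_algebra.
  + move=> C [->|CC]; last exact: sub_sigma_algebra.
    by have [] := smallest_sigma_algebra setT (@cylinders I A).
- move=> C [->|[w _ <-]]; first by apply: (@onGen 0%N).
  apply: (@onGen (size w)); first exact: measurable_cylinder.
  move=> x y xy /cylinderP xw; apply/cylinderP => m mw.
  by rewrite -xy// [LHS]xw//; exact: set_nth_default.
- by apply: (@onGen 0%N).
- by move=> f g *; exact: pullbackD.
- exact: pullback_lim.
Qed.

Lemma density F : measurable_fun setT F -> (forall x, 0 <= F x) ->
  \int[mu_phi]_x F x = \int[mu]_x ((h x)%:E * F x).
Proof.
move=> mF F0.
pose c1 (_ : unit) x := h x; pose t1 (_ : unit) (x : shift_space A) := x.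
have c10 k x : (0 <= c1 k x)%R by exact: ltW.
have mc1 k : measurable_fun setT (c1 k) by exact: measurable_h.
have mt1 k : measurable_fun setT (t1 k) by exact: measurable_id.
have pE F' x : pullback c1 t1 F' x = (h x)%:E * F' x.
  by rewrite /pullback (big_pred1 tt)// => -[].
have [_ [_ _ _ _] mphi] := gibbs.
suff : \int[mu]_x pullback c1 t1 F x = \int[mu_phi]_x F x.
  by under eq_integral do rewrite pE.
apply: (integral_functional (J := fun F => \int[mu]_x pullback c1 t1 F x)) => //.
- move=> C mC; under eq_integral do rewrite pE.
  apply: etrans (esym (mphi _ mC)).
  rewrite [RHS]integral_mkcond; apply: eq_integral => x _.
  rewrite patchE indicE; case: (x \in C); first by rewrite mule1.
  by rewrite mule0.
- by move=> f g *; exact: pullbackD.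
- by move=> a f *; exact: pullbackZ.
- exact: pullback_lim.
Qed.

(** The transition probabilities obtained by normalising the transfer operator with its
    eigenfunction; their sum over i is 1. *)
Definition pw i x : R := (c i x * h (consx i x) / h x)%R.

Lemma pw_ge0 i x : (0 <= pw i x)%R.
Proof.
apply: mulr_ge0; last by rewrite invr_ge0 ltW.
by apply: mulr_ge0 => //; exact: ltW.
Qed.

Lemma measurable_pw i : measurable_fun setT (pw i).
Proof.
apply: measurable_funM; last first.
  rewrite (_ : (fun x => (h x)^-1%R) = (fun x => h x `^ (-1))%R).
    exact: (measurableT_comp (measurable_powR (-1)%R) measurable_h).
  by apply/funext => x; rewrite powR_inv1// ltW.
apply: measurable_funM => //; exact: (measurableT_comp measurable_h (@measurable_consx I A i)).
Qed.

(** This is conformality for h F: the density h cancels the denominator of [pw]. *)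
Lemma base_invariance F : measurable_fun setT F -> (forall x, 0 <= F x) ->
  \int[mu_phi]_x pullback pw (@consx I A) F x = \int[mu_phi]_x F x.
Proof.
move=> mF F0; rewrite !density//; first last.
- by move=> x; apply: pullback_ge0 => //; exact: pw_ge0.
- by apply: measurable_pullback => // i; [exact: measurable_pw|exact: measurable_consx].
rewrite -[RHS]conformal_ge0; first last.
- by move=> x; rewrite mule_ge0// lee_fin ltW.
- by apply: emeasurable_funM => //; apply/measurable_EFinP; exact: measurable_h.
apply: eq_integral => x _; rewrite /pullback ge0_sume_distrr => [|i _]; last first.
  by rewrite mule_ge0// lee_fin pw_ge0.
apply: eq_bigr => i _; rewrite !muleA -!EFinM; congr (_%:E * _).
by rewrite /pw mulrCA divff ?mulr1// gt_eqF.
Qed.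

Let X : Type := (shift_space A * discrete_group G)%type.
Let m := extension_measure G mu_phi.

Lemma measurable_slice (F : X -> \bar R) (g : discrete_group G) : measurable_fun setT F ->
  measurable_fun setT (fun x => F (x, g)).
Proof. by move=> mF; apply: (measurableT_comp mF); exact: pair2_measurable. Qed.

(** The iterated integral, slices first, satisfies the hypotheses of [integral_functional] for the
    product measure; the outer integral over the countable group is a sum. *)
Lemma product_integral (F : X -> \bar R) : measurable_fun setT F -> (forall p, 0 <= F p) ->
  \int[m]_p F p = \esum_(g in [set: G]) \int[mu_phi]_x F (x, g).
Proof.
move=> mF F0; rewrite -(integral_counting G_countable) => [|g]; last exact: integral_ge0.
apply/esym; apply: (integral_functional
  (J := fun F => \int[@counting (discrete_group G) R]_g \int[mu_phi]_x F (x, g))) => //.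
- move=> C mC; apply: eq_integral => g _ /=.
  rewrite (_ : (fun x => _) = (fun x => (\1_(ysection C g) x)%:E)).
    by rewrite integral_indic ?setIT//; exact: measurable_ysection.
  by apply/funext => x; rewrite !indicE mem_ysection.
- move=> f f' mf mf' f0 f'0; rewrite -ge0_integralD//; first last.
  + by move=> g _; exact: integral_ge0.
  + by move=> g _; exact: integral_ge0.
  by apply: eq_integral => g _; rewrite ge0_integralD//; exact: measurable_slice.
- move=> a f mf f0 a0; rewrite -ge0_integralZl_EFin//; last first.
    by move=> g _; exact: integral_ge0.
  by apply: eq_integral => g _; rewrite ge0_integralZl_EFin//; exact: measurable_slice.
- move=> f_ f mf f0 fnd fF.
  have mg n : measurable_fun setT (fun g : discrete_group G => \int[mu_phi]_x f_ n (x, g)) by [].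
  have g0 n (g : discrete_group G) : setT g -> 0 <= \int[mu_phi]_x f_ n (x, g).
    by move=> _; exact: integral_ge0.
  have gnd (g : discrete_group G) : setT g ->
      nondecreasing_seq (fun n => \int[mu_phi]_x f_ n (x, g)).
    move=> _ a b ab; apply: ge0_le_integral => //; try exact: measurable_slice.
    by move=> x _; exact: (fnd _ _ _ ab).
  rewrite -(monotone_convergence _ _ mg g0 gnd)//.
  apply: eq_integral => g _.
  have nd (x : shift_space A) : setT x -> nondecreasing_seq (fun n => f_ n (x, g)).
    by move=> _ a b ab; exact: (fnd _ _ _ ab).
  rewrite -(monotone_convergence _ _ (fun n => measurable_slice g (mf n)) _ nd)//.
  by apply: eq_integral => x _; apply/esym/cvg_lim => //; exact: fF.
Qed.

Lemma esum_translation (f : G -> \bar R) x : (forall g, 0 <= f g) ->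
  \esum_(g in [set: G]) f (g * x)%g = \esum_(g in [set: G]) f g.
Proof.
move=> f0; rewrite [RHS](@reindex_esum _ _ _ setT setT (fun g => (g * x)%g))//.
split=> //; first by move=> g g' _ _; exact: mulIg.
by move=> g _; exists (g * x^-1)%g; rewrite // mulgVK.
Qed.

Definition ext_branch i (p : X) : X := (consx i p.1, ((p.2 : G) * (psi Psi i)^-1)%g).

Lemma measurable_ext_branch i : measurable_fun setT (ext_branch i).
Proof.
apply: measurable_fun_pair.
  by apply: (measurableT_comp (@measurable_consx I A i)); exact: measurable_fst.
apply: (measurableT_comp (f := fun g : discrete_group G => ((g : G) * (psi Psi i)^-1)%g
  : discrete_group G)); first exact: measurable_fun_group.
exact: measurable_snd.
Qed.

Lemma measurable_skew : measurable_fun setT (@skew_product I A G Psi).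
Proof.
apply: measurable_fun_pair.
  by apply: (measurableT_comp (@measurable_shift I A)); exact: measurable_fst.
move=> _ B _; rewrite setTI.
rewrite (_ : _ @^-1` B = \bigcup_(i in [set: I]) ([set x | letter x 0 = i] `*`
    [set g : discrete_group G | B ((g : G) * Psi [:: i])%g])).
  apply: fin_bigcup_measurable => // i _; apply: measurableX => //.
  exact: measurable_letter.
apply/seteqP; split=> [[x g] /= Bg|[x g] [i _ [/= <-]]]//.
by exists (letter x 0).
Qed.

Definition ext_weight i (p : X) : R := pw i p.1.

Lemma ext_weight_ge0 i p : (0 <= ext_weight i p)%R.
Proof. exact: pw_ge0. Qed.

Lemma measurable_ext_weight i : measurable_fun setT (ext_weight i).
Proof. by apply: (measurableT_comp (measurable_pw i)); exact: measurable_fst. Qed.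

(** For each letter the translation of the group coordinate is undone by reindexing the sum over G;
    what remains is [base_invariance] on each slice. *)
Lemma invariance (F : X -> \bar R) : measurable_fun setT F -> (forall p, 0 <= F p) ->
  \int[m]_p pullback ext_weight ext_branch F p = \int[m]_p F p.
Proof.
move=> mF F0.
have mP : measurable_fun setT (pullback ext_weight ext_branch F).
  apply: measurable_pullback => // i.
    exact: measurable_ext_weight.
  exact: measurable_ext_branch.
have P0 p : 0 <= pullback ext_weight ext_branch F p.
  by apply: pullback_ge0 => //; exact: ext_weight_ge0.
rewrite (product_integral mP P0) (product_integral mF F0).
have mi i g : measurable_fun setT (fun x => (pw i x)%:E * F (consx i x, g)).
  apply: emeasurable_funM; first by apply/measurable_EFinP; exact: measurable_pw.
  exact: (measurableT_comp (measurable_slice g mF) (@measurable_consx I A i)).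
have pos i g x : 0 <= (pw i x)%:E * F (consx i x, g) by rewrite mule_ge0// lee_fin pw_ge0.
transitivity (\esum_(g in [set: G]) \sum_i \int[mu_phi]_x ((pw i x)%:E * F (consx i x, g * (psi Psi i)^-1)%g)).
  apply: eq_esum => g _; rewrite /pullback -ge0_integral_sum//.
transitivity (\esum_(g in [set: G]) \sum_i \int[mu_phi]_x ((pw i x)%:E * F (consx i x, g))).
  rewrite !esum_sum => [|g i _ _|g i _ _]; [|exact: integral_ge0|exact: integral_ge0].
  apply: eq_bigr => i _.
  rewrite (@esum_translation (fun g => \int[mu_phi]_x ((pw i x)%:E * F (consx i x, g))) (psi Psi i)^-1%g)// => g.
  exact: integral_ge0.
apply: eq_esum => g _; rewrite -ge0_integral_sum//.
by rewrite -(base_invariance (measurable_slice g mF)).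
Qed.

End gibbs.

Local Close Scope ereal_scope.

(** * The space of square-integrable functions *)

Section L2_space.
Context d (X : measurableType d) (R : realType) (m : {measure set X -> \bar R}).
Implicit Types (f g : X -> R) (T : (X -> R) -> X -> R) (V : set (X -> R)).
Local Open Scope ereal_scope.

Definition sqint f : \bar R := \int[m]_x ((f x) ^+ 2)%:E.

Lemma sqint_ge0 f : 0 <= sqint f.
Proof. by apply: integral_ge0 => x _; rewrite lee_fin sqr_ge0. Qed.

Lemma Lnorm_sqint f : 'N[m]_2%:E[EFin \o f] = sqint f `^ 2^-1.
Proof.
rewrite unlock /=; congr (_ `^ _); apply: eq_integral => x _.
by rewrite /= powR_mulrn ?normr_ge0// real_normK ?num_real.
Qed.

Lemma sqint_Lnorm f : sqint f = 'N[m]_2%:E[EFin \o f] `^ 2.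
Proof. by rewrite Lnorm_sqint -poweRrM mulVf// poweRe1// sqint_ge0. Qed.

Lemma Lnorm_leP f K : (0 <= K)%R ->
  ('N[m]_2%:E[EFin \o f] <= K%:E) = (sqint f <= (K ^+ 2)%:E).
Proof.
move=> K0; apply/idP/idP => H.
  have -> : (K ^+ 2)%:E = K%:E `^ 2 by rewrite poweR_EFin powR_mulrn.
  rewrite sqint_Lnorm.
  apply: gt0_ler_poweR => //; first by rewrite in_itv /= leey Lnorm_ge0.
  by rewrite in_itv /= leey lee_fin K0.
rewrite Lnorm_sqint.
have -> : K%:E = (K ^+ 2)%:E `^ 2^-1.
  by rewrite poweR_EFin powR12_sqrt ?sqr_ge0// sqrtr_sqr ger0_norm.
apply: gt0_ler_poweR => //; first by rewrite in_itv /= leey sqint_ge0.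
by rewrite in_itv /= leey lee_fin sqr_ge0.
Qed.

Lemma L2P f : L2 m f <-> measurable_fun setT f /\ sqint f < +oo.
Proof.
split=> [Lf|[mf ff]].
  split; first by have /andP[/set_mem] := Lf.
  have /integrableP[_] := Lfun2_integrable_sqr Lf.
  under eq_integral do rewrite /= ger0_norm ?sqr_ge0//.
  by [].
apply/andP; rewrite !inE /=; split=> //.
by rewrite /finite_norm Lnorm_sqint poweR_lty.
Qed.

Lemma operator_norm_le V T K : (0 <= K)%R ->
  (forall f, V f -> sqint f <= 1 -> sqint (T f) <= (K ^+ 2)%:E) ->
  operator_norm m V T <= K%:E.
Proof.
move=> K0 H; apply: ge_ereal_sup => _ [f [Vf f1] <-]; rewrite Lnorm_leP//.
by apply: H => //; move: f1; rewrite Lnorm_leP// expr1n.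
Qed.

Lemma operator_norm_ge V T f K : (0 <= K)%R -> operator_norm m V T <= K%:E ->
  V f -> sqint f <= 1 -> sqint (T f) <= (K ^+ 2)%:E.
Proof.
move=> K0 TK Vf f1; rewrite -Lnorm_leP//; apply: le_trans TK.
by apply: ereal_sup_ubound; exists f => //; split=> //; rewrite Lnorm_leP// expr1n.
Qed.

Lemma operator_norm_ge0 V T f : V f -> sqint f <= 1 -> 0 <= operator_norm m V T.
Proof.
move=> Vf f1; apply: (@le_trans _ _ 'N[m]_2%:E[EFin \o T f]); first exact: Lnorm_ge0.
by apply: ereal_sup_ubound; exists f => //; split=> //; rewrite Lnorm_leP// expr1n.
Qed.

Lemma sqintZ a f : measurable_fun setT f -> sqint (fun x => a * f x)%R = (a ^+ 2)%:E * sqint f.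
Proof.
move=> mf; rewrite /sqint -ge0_integralZl_EFin ?sqr_ge0//.
- by under eq_integral do rewrite exprMn EFinM.
- by move=> x _; rewrite lee_fin sqr_ge0.
- by apply/measurable_EFinP; exact: measurable_funX.
Qed.

Lemma eq_sqint f g : measurable_fun setT f -> measurable_fun setT g ->
  ae_eq m setT f g -> sqint f = sqint g.
Proof.
move=> mf mg fg; apply: ae_eq_integral => //.
- by apply/measurable_EFinP; exact: measurable_funX.
- by apply/measurable_EFinP; exact: measurable_funX.
- by apply: filterS fg => x H xT; rewrite H.
Qed.

Lemma sqint_le f g c : measurable_fun setT f -> measurable_fun setT g -> (0 <= c)%R ->
  (forall x, `|f x| <= c * `|g x|)%R -> sqint f <= (c ^+ 2)%:E * sqint g.
Proof.
move=> mf mg c0 fg; rewrite -sqintZ//.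
apply: ge0_le_integral => //.
- by move=> x _; rewrite lee_fin sqr_ge0.
- by apply/measurable_EFinP; exact: measurable_funX.
- by apply/measurable_EFinP; apply: measurable_funX; exact: measurable_funM.
move=> x _; rewrite lee_fin -(real_normK (num_real (f x))) exprMn -(real_normK (num_real (g x))).
by rewrite -exprMn ler_sqr ?nnegrE ?mulr_ge0.
Qed.

Lemma operator_norm_apply V T f g K : (0 <= K)%R -> operator_norm m V T <= K%:E ->
  (forall a, V (fun x => a * f x)%R) ->
  (forall a, sqint (T (fun x => a * f x)%R) = sqint (fun x => a * g x)%R) ->
  measurable_fun setT f -> measurable_fun setT g -> sqint f < +oo ->
  sqint g <= (K ^+ 2)%:E * sqint f.
Proof.
move=> K0 TK Vf Tf mf mg foo.
have [s fs] : exists s, sqint f = s%:E.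
  by exists (fine (sqint f)); rewrite fineK// ge0_fin_numE ?sqint_ge0.
have s0 : (0 <= s)%R by rewrite -lee_fin -fs sqint_ge0.
(* Dividing by the root of some t > s instead of s also covers functions of norm 0; then t decreases
   to s. *)
have main t : (s < t)%R -> sqint g <= (K ^+ 2 * t)%:E.
  move=> st; have t0 : (0 < t)%R by exact: le_lt_trans st.
  pose a := Num.sqrt t^-1.
  have aa : (a ^+ 2 = t^-1)%R by rewrite sqr_sqrtr// invr_ge0 ltW.
  have := operator_norm_ge K0 TK (Vf a); rewrite sqintZ// fs aa -EFinM lee_fin.
  rewrite mulrC ler_pdivrMr// mul1r => /(_ (ltW st)); rewrite Tf sqintZ// aa.
  move=> H; rewrite mulrC EFinM -lee_pdivrMl// ?invrK//.
rewrite fs -EFinM; apply/lee_addgt0Pr => e e0.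
apply: le_trans (main (s + e / (K ^+ 2 + 1))%R _) _.
  by rewrite ltrDl divr_gt0// ltr_wpDl ?sqr_ge0.
rewrite -EFinD lee_fin mulrDr lerD2l mulrCA ger_pMr//.
by rewrite ler_pdivrMr ?mul1r ?lerDl// ltr_wpDl ?sqr_ge0.
Qed.

End L2_space.

(** * Pressure *)

Section limit_superior.
Context (R : realType).
Implicit Types (u : nat -> \bar R) (a : \bar R).

Lemma limn_esup_le u a N : (forall n, (N <= n)%N -> (u n <= a)%E) -> (limn_esup u <= a)%E.
Proof.
move=> H; rewrite /limn_esup limf_esupE; apply: (@le_trans _ _ (ereal_sup (u @` [set n | (N <= n)%N]))).
  by apply: ereal_inf_lbound; exists [set n | (N <= n)%N] => //; exists N.
by apply: ge_ereal_sup => _ [n /H ? <-].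
Qed.

Lemma limn_esup_ge u a : (forall N, exists n, (N <= n)%N /\ (a <= u n)%E) -> (a <= limn_esup u)%E.
Proof.
move=> H; rewrite /limn_esup limf_esupE; apply: le_ereal_inf_tmp => _ [V [N _ NV] <-].
have [n [Nn an]] := H N; apply: le_trans an _; apply: ereal_sup_ubound.
by exists n => //; exact: NV.
Qed.

Lemma limn_esup_lt u a : (limn_esup u < a)%E -> exists N, forall n, (N <= n)%N -> (u n <= a)%E.
Proof.
rewrite /limn_esup limf_esupE => /ereal_inf_lt[_ [V [N _ NV] <-] Va].
exists N => n Nn; apply: le_trans (ltW Va); apply: ereal_sup_ubound.
by exists n => //; exact: NV.
Qed.

End limit_superior.

Section pressure_bounds.
Context (R : realType) (I : finType) (A : incidence_matrix I) (phi : shift_space A -> R).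
Variable C : set (seq I).

Definition partition n : R := \sum_(w : n.-tuple I | (w : seq I) \in C) expR (word_sum phi w).

Lemma partition_ge0 n : 0 <= partition n.
Proof. by apply: sumr_ge0 => w _; exact: expR_ge0. Qed.

Lemma root_lne_le n (z s : R) : (0 < n)%N -> 0 <= z ->
  (((n%:R^-1)%:E * lne z%:E)%E <= s%:E)%E = (z <= expR (s * n%:R)).
Proof.
move=> n0 z0; have nn : 0 < n%:R :> R by rewrite ltr0n.
move: z0; rewrite le_eqVlt => /orP[/eqP<-|z0].
  by rewrite expR_ge0 le0_lneNy// gt0_muleNy ?lte_fin ?invr_gt0// leNye.
rewrite lne_EFin// -EFinM lee_fin mulrC ler_pdivrMr//.
by rewrite -[RHS]ler_ln ?posrE ?expR_gt0// expRK.
Qed.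

Lemma pressure_le s N : (forall n, (N <= n)%N -> (0 < n)%N -> partition n <= expR (s * n%:R)) ->
  (pressure phi C <= s%:E)%E.
Proof.
move=> H; apply: (@limn_esup_le _ _ _ N.+1) => n Nn.
have n0 : (0 < n)%N by exact: leq_trans Nn.
by rewrite root_lne_le// ?partition_ge0// H// ltnW.
Qed.

Lemma pressure_lt s : (pressure phi C < s%:E)%E ->
  exists N, forall n, (N <= n)%N -> (0 < n)%N -> partition n <= expR (s * n%:R).
Proof.
move=> /limn_esup_lt[N HN]; exists N => n Nn n0.
by rewrite -root_lne_le// ?partition_ge0// HN.
Qed.

Lemma pressure_ge s : (forall n, (0 < n)%N -> expR (s * n%:R) <= partition n) ->
  (s%:E <= pressure phi C)%E.
Proof.
move=> H; apply: limn_esup_ge => N; exists N.+1; split=> //.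
have nn : 0 < N.+1%:R :> R by rewrite ltr0n.
have z0 : 0 < partition N.+1 by exact: lt_le_trans (expR_gt0 _) (H _ _).
rewrite lne_EFin// -EFinM lee_fin mulrC ler_pdivlMr//.
by rewrite -(expRK (s * _)) ler_ln ?posrE ?expR_gt0// H.
Qed.

End pressure_bounds.

Section finite_pressure.
Context (R : realType) (I : finType) (A : incidence_matrix I) (phi : shift_space A -> R) (j : nat).
Hypothesis phi_loc : forall x y : shift_space A, agree j.+1 x y -> phi x = phi y.

Lemma word_sum_bounds w : words A w -> 
  - (phi_bound phi j *+ size w) <= word_sum phi w <= phi_bound phi j *+ size w.
Proof.
move=> [_ sw]; have [x wx] := exists_point sw.
have B y := birkhoff_norm phi_loc (size w) y.
apply/andP; split.
  apply: le_trans (word_sum_le phi_loc wx).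
  by have := B x; rewrite ler_norml => /andP[].
apply: ge_sup; first by exists (birkhoff_sum phi (size w) x), x.
by move=> _ [y _ <-]; have := B y; rewrite ler_norml => /andP[].
Qed.

(** The partition sum lies between the weight of a single word and the number of all words times the
    largest weight. *)
Lemma pressure_finite : pressure phi (words A) = (topological_pressure phi)%:E.
Proof.
rewrite /topological_pressure fineK// fin_numE.
suff [/lt_eqF lo /lt_eqF up] :
    (-oo < pressure phi (words A))%E /\ (pressure phi (words A) < +oo)%E.
  by rewrite eq_sym lo up.
set B := phi_bound phi j.
have inw n (w : n.-tuple I) : (w : seq I) \in words A -> words A w by move=> /set_mem.
split.
  apply: (@lt_le_trans _ _ (- B)%:E); first exact: ltNyr.
  apply: pressure_ge => n n0.
  pose w : n.-tuple I := val (pre n (point : shift_space A)).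
  have ww : words A w.
    split; last exact: (valP (pre n (point : shift_space A))).
    by move=> /(congr1 size); rewrite size_tuple => n00; rewrite n00 in n0.
  rewrite /partition (bigD1 w)/=; last exact/mem_set.
  apply: ler_wpDr; first by apply: sumr_ge0 => v _; exact: expR_ge0.
  rewrite ler_expR; have /andP[+ _] := word_sum_bounds ww.
  by rewrite size_tuple mulNr mulr_natr.
apply: (@le_lt_trans _ _ (ln #|I|%:R + B)%:E); last exact: ltry.
apply: (@pressure_le _ _ _ _ _ _ 0) => n _ n0.
apply: (@le_trans _ _ (\sum_(w : n.-tuple I) expR (B * n%:R))).
  rewrite /partition big_mkcond; apply: ler_sum => w _; case: ifP => [wA|_]; last exact: expR_ge0.
  rewrite ler_expR; have /andP[_] := word_sum_bounds (inw _ _ wA).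
  by rewrite size_tuple mulr_natr.
rewrite sumr_const card_tuple -[leLHS]mulr_natl natrX mulrDl expRD.
have lnI : expR (ln #|I|%:R) = #|I|%:R :> R.
  by rewrite lnK// posrE ltr0n; exact: alphabet_gt0 A.
by rewrite [expR (ln _ * _)]expRM_natr lnI.
Qed.

End finite_pressure.

(** Testing against real t treats l = 0, whose logarithm is -oo, and infinite x together with the
    finite case. *)
Lemma le_lne (R : realType) (x : \bar R) (l : R) : 0 <= l ->
  (forall t, l < expR t -> (x <= t%:E)%E) -> (x <= lne l%:E)%E.
Proof.
rewrite le_eqVlt => /orP[/eqP<- H|l0 H].
  rewrite le0_lneNy//; case: x H => [r|H|_] //.
    by move=> /(_ (r - 1) (expR_gt0 _)); rewrite lee_fin => Hr; exfalso; lra.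
  by have := H 0 (expR_gt0 _).
rewrite lne_EFin//; apply/lee_addgt0Pr => e e0; rewrite -EFinD; apply: H.
by rewrite expRD lnK// ltr_pMr// -expR0 ltr_expR.
Qed.

Lemma lne_le (R : realType) (x : \bar R) (l : R) : 0 <= l ->
  (forall t, (x < t%:E)%E -> l <= expR t) -> (lne l%:E <= x)%E.
Proof.
rewrite le_eqVlt => /orP[/eqP<- _|l0 H]; first by rewrite le0_lneNy// leNye.
have K t : (l <= expR t) = (ln l <= t) by rewrite -[RHS]ler_expR lnK.
rewrite lne_EFin// leNgt; apply/negP; case: x H => [r|//|] H.
  rewrite lte_fin => rl; have := H ((r + ln l) / 2); rewrite K lte_fin.
  by move=> /(_ ltac:(lra)) Hr; exfalso; lra.
by move=> _; have := H (ln l - 1) (ltNyr _); rewrite K => Hr; exfalso; lra.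
Qed.

(** * The transfer operator of the group extension *)

Lemma finite_lower_bound (R : realType) (T : finType) (c : T -> R) : (forall t, 0 < c t) ->
  exists2 d, 0 < d & forall t, d <= c t.
Proof.
move=> c0; exists (1 + \sum_t (c t)^-1)^-1.
  by rewrite invr_gt0 ltr_wpDr// sumr_ge0// => t _; rewrite invr_ge0 ltW.
move=> t; rewrite -[leRHS]invrK lef_pV2 ?posrE ?invr_gt0//.
  by rewrite (bigD1 t)//= addrCA lerDl addr_ge0// sumr_ge0// => s _; rewrite invr_ge0 ltW.
by rewrite ltr_wpDr// sumr_ge0// => s _; rewrite invr_ge0 ltW.
Qed.

Section gibbs_extension.
Context (R : realType) (I : finType) (A : incidence_matrix I) (G : groupType).
Hypothesis G_countable : countable [set: G].
Variables (Psi : seq I -> G) (phi : shift_space A -> R) (j : nat).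
Hypothesis Psi_hom : semigroup_hom Psi.
Hypothesis Psi_linked : linked A Psi.
Hypothesis Psi_onto : Psi @` words A = [set: G].
Hypothesis phi_loc : forall x y : shift_space A, agree j.+1 x y -> phi x = phi y.
Hypothesis j0 : (0 < j)%N.
Variables (mu : probability (shift_space A) R) (h : shift_space A -> R).
Variable mu_phi : probability (shift_space A) R.
Hypothesis gibbs : gibbs_measure phi mu h mu_phi.

Let X : Type := (shift_space A * discrete_group G)%type.
Let m := extension_measure G mu_phi.
Let L := extension_operator Psi phi h mu_phi.

Let h_gt0 x : 0 < h x. Proof. by have [_ [+ _ _ _] _] := gibbs. Qed.
Let lam_neq0 : lam phi != 0. Proof. by rewrite gt_eqF ?lam_gt0. Qed.

Let pw0 i x : 0 <= pw phi j h i x. Proof. by apply: pw_ge0; exact: gibbs. Qed.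

Lemma eigen x : h x = (lam phi)^-1 * \sum_i jw phi j i x * h (consx i x).
Proof.
have [_ [_ _ _ eig] _] := gibbs.
by rewrite -(transfer_jw phi_loc j0) eig mulKf.
Qed.

(** In the eigenvalue equation at x keep only the term of the letter put in front; all terms are
    nonnegative. *)
Lemma h_word w : exists2 c, 0 < c &
  forall x, sorted A (rcons w (letter x 0)) -> c * h (appendx w x) <= h x.
Proof.
elim: w => [|i w [c c0 IH]]; first by exists 1 => // x _; rewrite mul1r.
exists (c * ((lam phi)^-1 * expR (- phi_bound phi j))).
  by rewrite mulr_gt0// mulr_gt0 ?expR_gt0// invr_gt0 lam_gt0.
move=> x /appendx_cons[ix wx]; apply: le_trans (IH x wx).
set y := appendx w x.
rewrite (_ : appendx (i :: w) x = consx i y)// -mulrA ler_pM2l//.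
rewrite [leRHS]eigen -mulrA ler_pM2l ?invr_gt0 ?lam_gt0// (bigD1 i)//=.
apply: ler_wpDr.
  by apply: sumr_ge0 => k _; rewrite mulr_ge0 ?jw_ge0// ltW.
rewrite ler_pM2r// (jwE phi_loc j0) ix ler_expR.
by have := phi_le phi_loc (consx i y); rewrite ler_norml => /andP[].
Qed.

(** Positivity of h is given pointwise only. By continuity h is at least h(x0) / 2 on a cylinder
    around x0; from each of the finitely many states a word leads into this cylinder, and [h_word]
    carries the bound back. *)
Lemma h_lower : exists2 d, 0 < d & forall x, d <= h x.
Proof.
have [_ [_ [C [al [al0 hC]]] _ _] _] := gibbs.
pose x0 : shift_space A := point.
have [n0 Hn0] : exists n0, forall n x, (n0 <= n)%N -> agree n x x0 -> h x0 / 2 <= h x.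
  have : (fun n => C * expR (- al) ^+ n) @ \oo --> (0 : R).
    rewrite -[X in _ --> X](mulr0 C); apply: cvgM; first exact: cvg_cst.
    apply: cvg_expr; rewrite ger0_norm ?expR_ge0//.
    by rewrite -expR0 ltr_expR oppr_lt0.
  have hx2 : 0 < h x0 / 2 by rewrite divr_gt0.
  move=> /cvgrPdist_lt/(_ _ hx2)[n0 _ Hn]; exists n0 => n x n0n xx.
  have := Hn n n0n; rewrite /= sub0r normrN => Cn.
  have : `|h x0 - h x| < h x0 / 2.
    apply: le_lt_trans (hC n x0 x _) _; first by move=> i /xx.
    by apply: le_lt_trans Cn; rewrite -expRM_natr ler_norm.
  by rewrite ltr_norml => /andP[_]; lra.
pose n := maxn n0 j; have nn0 : (0 < n)%N by rewrite /n leq_max j0 orbT.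
have [c cP] := step_connected Psi_hom nn0 Psi_linked Psi_onto (pre n x0).
have /choice[e eP] : forall v : state A n, exists e : R, 0 < e /\ forall x, pre n x = v -> e <= h x.
  move=> v; have [w [sw aw _]] := cP v 1%g.
  have [e e0 eP] := h_word w.
  exists (e * (h x0 / 2)); split=> [|x xv]; first by rewrite mulr_gt0// divr_gt0.
  have sx : sorted A (rcons w (letter x 0)) by rewrite -(letter_rep nn0) xv.
  apply: le_trans (eP x sx); rewrite ler_pM2l//.
  apply: (Hn0 n); first exact: leq_maxl.
  by apply/preP; rewrite -(act_pre nn0) xv.
have [d d0 dP] := @finite_lower_bound R _ e (fun v => (eP v).1).
by exists d => // x; apply: le_trans (dP (pre n x)) _; apply: (eP _).2.
Qed.

Lemma h_upper : exists2 d, 0 < d & forall x, h x <= d.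
Proof.
have [_ [_ [C [al [al0 hC]]] _ _] _] := gibbs.
pose x0 : shift_space A := point.
exists (h x0 + `|C|); first by rewrite ltr_wpDr.
(* The Hölder bound at n = 0 compares any two points. *)
move=> x; have := hC 0%N x x0 (fun i => ltac:(by [])).
rewrite mulr0 expR0 mulr1 ler_norml => /andP[_]; rewrite lerBlDl => H.
by apply: le_trans H _; rewrite lerD2l ler_norm.
Qed.

(** * The normalised operator as adjoint of the Koopman isometry *)

Section transfer.
Implicit Types (f u v : X -> R) (p q : X).

Definition transfer_ext f p : R := \sum_i jw phi j i p.1 * f (ext_branch Psi i p).

(** The Markov operator conjugate to [transfer_ext] divided by [lam phi], by multiplication with h;
    see [transfer_extE]. *)
Definition transfer_norm f p : R := \sum_i pw phi j h i p.1 * f (ext_branch Psi i p).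

Local Notation Lx := transfer_ext.
Local Notation W := transfer_norm.

Lemma sum_pw x : \sum_i pw phi j h i x = 1.
Proof.
rewrite /pw -mulr_suml; apply: (canLR (mulfK _)); first by rewrite gt_eqF.
by rewrite mul1r [RHS]eigen mulr_sumr; apply: eq_bigr => i _; rewrite mulrA.
Qed.

Lemma pw_skew i p : pw phi j h i p.1 = 0 \/ skew_product Psi (ext_branch Psi i p) = p.
Proof.
have [ip|ip] := boolP (A i (letter p.1 0)); last first.
  by left; rewrite /pw (jwE phi_loc j0) (negbTE ip) mulr0 !mul0r.
right; case: p ip => x g /= ip; rewrite /skew_product /ext_branch /=.
by rewrite shift_consx// letter_consx0// mulgVK.
Qed.

(** Branches of nonzero weight are right inverses of the skew product, so a factor that depends on
    the image only comes out. Together with [integral_norm] this makes W the adjoint of the Koopman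
    operator, and its left inverse. *)
Lemma norm_skew u v p : W (fun q => u (skew_product Psi q) * v q) p = u p * W v p.
Proof.
rewrite /W mulr_sumr; apply: eq_bigr => i _.
by have [->|->] := pw_skew i p; rewrite ?mul0r ?mulr0// mulrCA.
Qed.

Lemma norm1 p : W (fun=> 1) p = 1.
Proof. by rewrite /W; under eq_bigr do rewrite mulr1; exact: sum_pw. Qed.

Lemma norm_pullback v p :
  pullback (ext_weight phi j h) (ext_branch Psi) (fun q => (v q)%:E) p = (W v p)%:E.
Proof. by rewrite /pullback /W -sumEFin; apply: eq_bigr => i _; rewrite EFinM. Qed.

Lemma norm_ge0 v : (forall q, 0 <= v q) -> forall p, 0 <= W v p.
Proof. by move=> v0 p; apply: sumr_ge0 => i _; rewrite mulr_ge0// pw0. Qed.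

Lemma measurable_norm v : measurable_fun setT v -> measurable_fun setT (W v).
Proof.
move=> mv; apply: measurable_sum => i; apply: measurable_funM.
  exact: (measurable_ext_weight j gibbs i).
by apply: (measurableT_comp mv); exact: measurable_ext_branch.
Qed.

Lemma integral_norm v : measurable_fun setT v -> (forall q, 0 <= v q) ->
  (\int[m]_p (W v p)%:E = \int[m]_p (v p)%:E)%E.
Proof.
move=> mv v0; rewrite -[RHS](invariance G_countable Psi phi_loc j0 gibbs)//.
- by apply: eq_integral => p _; rewrite norm_pullback.
- exact/measurable_EFinP.
Qed.

(** Pointwise (W v)^2 <= W (v^2), because a variance is nonnegative; then integrate by
    invariance. *)
Lemma norm_contraction v : measurable_fun setT v -> (sqint m (W v) <= sqint m v)%E.
Proof.
move=> mv; have mv2 : measurable_fun setT (fun q => v q ^+ 2) by exact: measurable_funX.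
rewrite [leRHS](_ : _ = \int[m]_p (W (fun q => v q ^+ 2) p)%:E)%E; last first.
  by rewrite integral_norm// => q; exact: sqr_ge0.
apply: ge0_le_integral => //.
- by move=> p _; rewrite lee_fin sqr_ge0.
- by apply/measurable_EFinP; apply: measurable_funX; exact: measurable_norm.
- by apply/measurable_EFinP; exact: measurable_norm.
move=> p _; rewrite lee_fin; set a := W v p.
have : 0 <= \sum_i pw phi j h i p.1 * (v (ext_branch Psi i p) - a) ^+ 2.
  by apply: sumr_ge0 => i _; rewrite mulr_ge0 ?sqr_ge0// pw0.
have -> : \sum_i pw phi j h i p.1 * (v (ext_branch Psi i p) - a) ^+ 2 =
    W (fun q => v q ^+ 2) p - 2 * a * W v p + a ^+ 2 * \sum_i pw phi j h i p.1.
  transitivity (\sum_i (pw phi j h i p.1 * v (ext_branch Psi i p) ^+ 2) +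
      \sum_i (- (2 * a)) * (pw phi j h i p.1 * v (ext_branch Psi i p)) +
      \sum_i a ^+ 2 * pw phi j h i p.1).
    by rewrite -!big_split/=; apply: eq_bigr => i _; ring.
  by rewrite -!mulr_sumr mulNr.
by rewrite sum_pw -/a; nra.
Qed.

Lemma measurable_koopman u : measurable_fun setT u -> measurable_fun setT (koopman Psi u).
Proof. by move=> mu'; apply: (measurableT_comp mu'); exact: measurable_skew. Qed.

Lemma koopman_isometry u : measurable_fun setT u -> sqint m (koopman Psi u) = sqint m u.
Proof.
move=> mu'; rewrite /sqint -integral_norm.
- apply: eq_integral => p _; congr EFin.
  have := norm_skew (fun q => u q ^+ 2) (fun=> 1) p; rewrite norm1 mulr1 => <-.
  by apply: eq_bigr => i _; rewrite mulr1.
- by apply: measurable_funX; exact: measurable_koopman.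
- by move=> q; exact: sqr_ge0.
Qed.

Lemma L2_norm v : L2 m v -> L2 m (W v).
Proof.
move=> /L2P[mv vf]; apply/L2P; split; first exact: measurable_norm.
exact: le_lt_trans (norm_contraction mv) vf.
Qed.

Lemma L2_koopman u : L2 m u -> L2 m (koopman Psi u).
Proof.
by move=> /L2P[mu' uf]; apply/L2P; rewrite koopman_isometry//; split=> //; exact: measurable_koopman.
Qed.

Lemma L2_mul u v : L2 m u -> L2 m v -> m.-integrable setT (EFin \o (fun p => u p * v p)).
Proof. by move=> Lu Lv; apply/Lfun1_integrable; exact: Lfun2_mul_Lfun1. Qed.

Lemma integrable_norm v : m.-integrable setT (EFin \o v) -> (forall q, 0 <= v q) ->
  m.-integrable setT (EFin \o W v).
Proof.
move=> /integrableP[/measurable_EFinP mv vf] v0; apply/integrableP; split.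
  by apply/measurable_EFinP; exact: measurable_norm.
apply: le_lt_trans vf; rewrite le_eqVlt; apply/orP; left; apply/eqP.
transitivity (\int[m]_p (W v p)%:E)%E.
  by apply: eq_integral => p _ /=; rewrite ger0_norm// norm_ge0.
by rewrite integral_norm//; apply: eq_integral => p _ /=; rewrite ger0_norm.
Qed.

(** Invariance is known for nonnegative functions, so the product is split into its positive and
    negative parts, which are integrable. *)
Lemma koopman_adjoint u v : L2 m u -> L2 m v ->
  (\int[m]_p (koopman Psi u p * v p)%:E = \int[m]_p (u p * W v p)%:E)%E.
Proof.
move=> Lu Lv; pose F q := koopman Psi u q * v q.
have iF : m.-integrable setT (EFin \o F) by apply: L2_mul => //; exact: L2_koopman.
have ia := integrable_funrpos measurableT iF.
have ib := integrable_funrneg measurableT iF.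
have [/measurable_EFinP ma _] := integrableP _ _ _ ia.
have [/measurable_EFinP mb _] := integrableP _ _ _ ib.
have a0 q : 0 <= (F^\+)%R q by exact: funrpos_ge0.
have b0 q : 0 <= (F^\-)%R q by exact: funrneg_ge0.
have FE q : F q = (F^\+)%R q - (F^\-)%R q by have := congr1 (@^~ q) (funrposBneg F); move=> /= <-.
transitivity (\int[m]_p (((F^\+)%R p)%:E - ((F^\-)%R p)%:E))%E.
  by apply: eq_integral => p _; rewrite -EFinB -FE.
rewrite integralB_EFin// -(integral_norm ma a0) -(integral_norm mb b0).
rewrite -integralB_EFin//; [|exact: integrable_norm|exact: integrable_norm].
apply: eq_integral => p _; rewrite -EFinB -norm_skew; congr EFin.
apply/eqP; rewrite subr_eq; apply/eqP.
rewrite -[RHS]big_split/=; apply: eq_bigr => i _.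
by rewrite -mulrDr -/(F _) FE subrK.
Qed.

Lemma L2_sub u v : L2 m u -> L2 m v -> L2 m (fun p => u p - v p).
Proof.
move=> /L2P[mu' uf] /L2P[mv vf]; have mB : measurable_fun setT (fun p => u p - v p).
  exact: measurable_funB.
apply/L2P; split=> //.
pose U p := (2 * u p ^+ 2)%:E; pose V p := (2 * v p ^+ 2)%:E.
have mU : measurable_fun setT U.
  by apply/measurable_EFinP; apply: measurable_funM => //; exact: measurable_funX.
have mV : measurable_fun setT V.
  by apply/measurable_EFinP; apply: measurable_funM => //; exact: measurable_funX.
have U0 p : (0 <= U p)%E by rewrite lee_fin mulr_ge0 ?sqr_ge0.
have V0 p : (0 <= V p)%E by rewrite lee_fin mulr_ge0 ?sqr_ge0.
have fin2 w : measurable_fun setT w -> (sqint m w < +oo)%E ->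
    (\int[m]_p (2 * w p ^+ 2)%:E < +oo)%E.
  move=> mw wf; under eq_integral do rewrite EFinM.
  rewrite ge0_integralZl_EFin//.
  - by rewrite lte_mul_pinfty.
  - by move=> p _; rewrite lee_fin sqr_ge0.
  - by apply/measurable_EFinP; exact: measurable_funX.
apply: (@le_lt_trans _ _ (\int[m]_p (U p + V p))%E); last first.
  by rewrite ge0_integralD// lte_add_pinfty//; exact: fin2.
apply: ge0_le_integral => //.
- by move=> p _; rewrite lee_fin sqr_ge0.
- by apply/measurable_EFinP; exact: measurable_funX.
- exact: emeasurable_funD.
move=> p _; rewrite -EFinD lee_fin; have := sqr_ge0 (u p + v p); nra.
Qed.

Lemma L2_dual_unique g g' : L2 m g -> L2 m g' ->
  (forall u, L2 m u -> (\int[m]_p (u p * g p)%:E = \int[m]_p (u p * g' p)%:E)%E) ->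
  ae_eq m setT g g'.
Proof.
move=> Lg Lg' H; pose u p := g p - g' p; have Lu : L2 m u by exact: L2_sub.
have mu' : measurable_fun setT u by have /L2P[] := Lu.
have : (\int[m]_p `|(u p ^+ 2)%:E| = 0)%E.
  transitivity (\int[m]_p ((u p * g p)%:E - (u p * g' p)%:E))%E.
    by apply: eq_integral => p _; rewrite gee0_abs ?lee_fin ?sqr_ge0// -EFinB -mulrBr.
  rewrite integralB_EFin//; [|exact: L2_mul|exact: L2_mul].
  rewrite H// subee// integrable_fin_num//; exact: L2_mul.
have mu2 : measurable_fun setT (fun p => (u p ^+ 2)%:E).
  by apply/measurable_EFinP; exact: measurable_funX.
move=> /(ae_eq_integral_abs m measurableT mu2); apply: filterS => p /(_ Logic.I) [].
by move=> /eqP; rewrite sqrf_eq0 subr_eq0 => /eqP E _.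
Qed.

Lemma transfer_extE f p :
  transfer_ext f p = lam phi * (W (fun q => f q / h q.1) p * h p.1).
Proof.
rewrite /W /transfer_ext mulr_suml mulr_sumr; apply: eq_bigr => i _.
rewrite /pw /ext_branch /=; move: (h_gt0 p.1) (h_gt0 (consx i p.1)) => a0 b0.
by field; rewrite ?lam_neq0 ?gt_eqF.
Qed.

Let measurable_h1 : measurable_fun setT (fun q : X => h q.1).
Proof. by apply: (measurableT_comp (measurable_h gibbs)); exact: measurable_fst. Qed.

Let measurable_h1V : measurable_fun setT (fun q : X => (h q.1)^-1).
Proof.
rewrite (_ : (fun q : X => _) = (fun q => h q.1 `^ (-1))); last first.
  by apply/funext => q; rewrite powR_inv1// ltW.
exact: (measurableT_comp (measurable_powR (-1)) measurable_h1).
Qed.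

Lemma sqint_divh : exists2 C : R, 0 < C & forall f, measurable_fun setT f ->
    measurable_fun setT (fun q => f q / h q.1) /\
    (sqint m (fun q => f q / h q.1)%R <= (C ^+ 2)%:E * sqint m f)%E.
Proof.
have [d d0 dP] := h_lower; exists d^-1; rewrite ?invr_gt0// => g mg.
have mq : measurable_fun setT (fun q => g q / h q.1) by exact: measurable_funM.
split=> //; apply: sqint_le => // [|q]; first by rewrite invr_ge0 ltW.
rewrite normrM mulrC ler_wpM2r// ger0_norm ?invr_ge0; last exact: ltW.
by rewrite lef_pV2 ?posrE.
Qed.

Lemma sqint_mulh : exists2 C : R, 0 < C & forall f, measurable_fun setT f ->
    measurable_fun setT (fun q => f q * h q.1) /\
    (sqint m (fun q => f q * h q.1)%R <= (C ^+ 2)%:E * sqint m f)%E.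
Proof.
have [d d0 dP] := h_upper; exists d => // g mg.
have mq : measurable_fun setT (fun q => g q * h q.1) by exact: measurable_funM.
split=> //; apply: sqint_le => // [|q]; first exact: ltW.
by rewrite normrM mulrC ler_wpM2r// ger0_norm// ltW.
Qed.

Lemma L2_divh f : L2 m f -> L2 m (fun q => f q / h q.1).
Proof.
have [C _ HC] := sqint_divh; move=> /L2P[mf ff]; have [mq qf] := HC f mf.
apply/L2P; split=> //; apply: le_lt_trans qf _.
by rewrite lte_mul_pinfty ?lee_fin ?sqr_ge0.
Qed.

Lemma L2_mulh f : L2 m f -> L2 m (fun q => f q * h q.1).
Proof.
have [C _ HC] := sqint_mulh; move=> /L2P[mf ff]; have [mq qf] := HC f mf.
apply/L2P; split=> //; apply: le_lt_trans qf _.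
by rewrite lte_mul_pinfty ?lee_fin ?sqr_ge0.
Qed.

Lemma L2_scale a f : L2 m f -> L2 m (fun q => a * f q).
Proof.
move=> /L2P[mf ff]; apply/L2P; split; first exact: measurable_funM.
by rewrite sqintZ// lte_mul_pinfty ?lee_fin ?sqr_ge0.
Qed.

(** [W v] shows that the set from which [adjoint] chooses is inhabited, and any two of its members
    agree almost everywhere. *)
Lemma adjoint_koopman v : L2 m v ->
  L2 m (adjoint m (koopman Psi) v) /\ ae_eq m setT (adjoint m (koopman Psi) v) (W v).
Proof.
move=> Lv; set D := [set g | L2 m g /\ forall u, L2 m u ->
    (\int[m]_x (koopman Psi u x * v x)%:E = \int[m]_x (u x * g x)%:E)%E].
have DW : D (W v) by split; [exact: L2_norm|move=> u Lu; exact: koopman_adjoint].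
have [Lg gP] : D (adjoint m (koopman Psi) v) by exact: (getI (P := D) (x := W v)).
split=> //; apply: L2_dual_unique => //; first exact: L2_norm.
by move=> u Lu; rewrite -gP// koopman_adjoint.
Qed.

Lemma extension_operatorE f : L2 m f -> L2 m (L f) /\ ae_eq m setT (L f) (transfer_ext f).
Proof.
move=> Lf; have [La aP] := adjoint_koopman (L2_divh Lf).
split; first exact/L2_scale/L2_mulh.
by apply: filterS aP => p /(_ Logic.I) E _; rewrite /L /extension_operator E transfer_extE.
Qed.

(** The conclusion is equality at every point: the candidates for the adjoint are defined by
    integrals, so the two sets of candidates coincide and the same element is chosen. This lets
    almost everywhere equality pass through iterates. *)
Lemma extension_operator_congr f f' : L2 m f -> L2 m f' -> ae_eq m setT f f' -> L f = L f'.
Proof.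
move=> Lf Lf' ff'; apply/funext => p; rewrite /L /extension_operator; congr (_ * (_ * _)).
rewrite /adjoint; congr (get _ p); apply/funext => g; apply/propext.
have E u : L2 m u ->
    (\int[m]_x (koopman Psi u x * (f x / h x.1))%:E =
     \int[m]_x (koopman Psi u x * (f' x / h x.1))%:E)%E.
  move=> Lu; have /L2P[mku _] := L2_koopman Lu.
  have /L2P[m1 _] := L2_divh Lf; have /L2P[m2 _] := L2_divh Lf'.
  apply: ae_eq_integral => //.
  - by apply/measurable_EFinP; exact: measurable_funM.
  - by apply/measurable_EFinP; exact: measurable_funM.
  - by apply: filterS ff' => q /(_ Logic.I) E _; rewrite E.
by split=> -[Lg gP]; split=> // u Lu; rewrite -gP// E.
Qed.

Lemma L2_transfer_ext f : L2 m f -> L2 m (transfer_ext f).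
Proof.
move=> Lf; have -> : transfer_ext f = fun p => lam phi * (W (fun q => f q / h q.1) p * h p.1).
  by apply/funext => p; exact: transfer_extE.
exact/L2_scale/L2_mulh/L2_norm/L2_divh.
Qed.

Lemma iter_extension_operator f n : L2 m f ->
  [/\ L2 m (iter n L f), L2 m (iter n transfer_ext f)
    & ae_eq m setT (iter n L f) (iter n transfer_ext f)].
Proof.
move=> Lf; elim: n => [|n [L1 L2' E]] /=; first by split=> //; exact: ae_eq_refl.
split; [exact: (extension_operatorE L1).1|exact: L2_transfer_ext|].
rewrite (extension_operator_congr L1 L2' E); exact: (extension_operatorE L2').2.
Qed.

Lemma sqint_iter f n : L2 m f -> sqint m (iter n L f) = sqint m (iter n transfer_ext f).
Proof. by move=> /(@iter_extension_operator _ n)[/L2P[m1 _] /L2P[m2 _] E]; exact: eq_sqint. Qed.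

Lemma iter_transfer_ext f n p :
  iter n transfer_ext f p = lam phi ^+ n * (iter n W (fun q => f q / h q.1) p * h p.1).
Proof.
elim: n p => [|n IH] p /=; first by rewrite expr0 mul1r divfK// gt_eqF.
rewrite transfer_extE (_ : W _ p = lam phi ^+ n * iter n.+1 W (fun q => f q / h q.1) p).
  by rewrite exprS /=; ring.
rewrite /= {1 3}/W mulr_sumr; apply: eq_bigr => i _; rewrite IH.
by field; rewrite ?gt_eqF.
Qed.

Lemma iter_norm_contraction v n : measurable_fun setT v ->
  measurable_fun setT (iter n W v) /\ (sqint m (iter n W v) <= sqint m v)%E.
Proof.
move=> mv; elim: n => [|n [IHm IH]] //=; split; first exact: measurable_norm.
exact: le_trans (norm_contraction IHm) IH.
Qed.

Lemma transfer_ext_growth : exists2 C, 0 < C & forall n f, L2 m f ->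
  (sqint m (iter n transfer_ext f) <= ((C * lam phi ^+ n) ^+ 2)%:E * sqint m f)%E.
Proof.
have [C C0 HC] := sqint_mulh; have [D D0 HD] := sqint_divh.
exists (C * D); first exact: mulr_gt0.
move=> n f /L2P[mf _]; have [mq qf] := HD f mf.
have [mW Wf] := iter_norm_contraction n mq.
have [mh hf] := HC _ mW.
rewrite (_ : iter n _ f = fun p => lam phi ^+ n * (iter n W (fun q => f q / h q.1) p * h p.1)); last first.
  by apply/funext => p; exact: iter_transfer_ext.
have C2 : (0%E <= (C ^+ 2)%:E)%E by rewrite lee_fin sqr_ge0.
have l2 : (0%E <= ((lam phi ^+ n) ^+ 2)%:E)%E by rewrite lee_fin sqr_ge0.
rewrite sqintZ//; apply: le_trans (lee_wpmul2l l2 hf) _.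
apply: le_trans (lee_wpmul2l l2 (lee_wpmul2l C2 (le_trans Wf qf))) _.
by rewrite !muleA -!EFinM; rewrite (_ : _ * _ * _ = (C * D * lam phi ^+ n) ^+ 2)//; ring.
Qed.

Lemma norm_koopman a u : W (fun q => a * koopman Psi u q) = fun p => a * u p.
Proof.
apply/funext => p; have := norm_skew (fun q => a * u q) (fun=> 1) p.
by rewrite norm1 mulr1 => <-; apply: eq_bigr => i _; rewrite mulr1.
Qed.

Lemma iter_norm_koopman a u n :
  iter n W (fun q => a * iter n (koopman Psi) u q) = fun p => a * u p.
Proof.
elim: n => [|n IH] //; rewrite iterSr -[RHS]IH; congr (iter n W _).
exact: norm_koopman.
Qed.

Lemma iter_koopman_isometry u n : measurable_fun setT u ->
  measurable_fun setT (iter n (koopman Psi) u) /\ sqint m (iter n (koopman Psi) u) = sqint m u.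
Proof.
move=> mu'; elim: n => [|n [mn <-]] //=; split; first exact: measurable_koopman.
exact: koopman_isometry.
Qed.

(** W undoes the Koopman operator, so h times the n-th Koopman iterate of u is mapped to lam^n h u.
    With u the indicator of the fibre over 1, of norm 1, the constant only pays for multiplication
    and division by h. *)
Lemma transfer_ext_witness : exists2 c : R, 0 < c & forall n, exists f,
  [/\ L2 m f, (sqint m f <= 1)%E & (((c * lam phi ^+ n) ^+ 2)%:E <= sqint m (iter n transfer_ext f))%E].
Proof.
have [C C0 HC] := sqint_mulh; have [D D0 HD] := sqint_divh.
exists (C * D)^-1; first by rewrite invr_gt0 mulr_gt0.
move=> n; pose u : X -> R := \1_(setT `*` [set (1%g : discrete_group G)]).
have mu' : measurable_fun setT u.
  by apply: measurable_indic; apply: measurableX.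
have u1 : sqint m u = 1%E.
  rewrite /sqint (product_integral G_countable).
  - rewrite (_ : \esum_(g in _) _ =
        \esum_(g in setT) (if g \in [set (1%g : discrete_group G)] then 1%E else 0%E)).
      by rewrite -(esum_mkcond [set (1%g : discrete_group G)] (fun=> 1%E)) esum_set1.
    apply: eq_esum => g _.
    transitivity (\int[mu_phi]_x cst (\1_[set (1%g : discrete_group G)] g : R)%:E x)%E.
      apply: eq_integral => x _; rewrite /u /= !indicE !in_setX in_setT /=.
      by case: (_ \in _); rewrite ?expr1n ?expr0n.
    rewrite integral_cst//; apply: etrans (congr1 (fun t => _ * t)%E (probability_setT mu_phi)) _.
    rewrite mule1 indicE.
    by case: (_ \in _).
  - by apply/measurable_EFinP; exact: measurable_funX.
  - by move=> p; rewrite lee_fin sqr_ge0.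
pose v := iter n (koopman Psi) u.
have [mv v1] := iter_koopman_isometry n mu'; rewrite -/v u1 in mv v1.
have [mvh vh] := HC v mv; rewrite v1 mule1 in vh.
exists (fun q => C^-1 * (v q * h q.1)).
have mf : measurable_fun setT (fun q => C^-1 * (v q * h q.1)) by exact: measurable_funM.
have C2 : (0%E <= ((C^-1) ^+ 2)%:E)%E by rewrite lee_fin sqr_ge0.
have f1 : (sqint m (fun q => C^-1 * (v q * h q.1))%R <= 1)%E.
  rewrite sqintZ//; apply: le_trans (lee_wpmul2l C2 vh) _.
  by rewrite -EFinM -exprMn mulVf ?gt_eqF// expr1n.
split=> //; first by apply/L2P; split=> //; apply: le_lt_trans f1 (ltry _).
rewrite (_ : iter n _ _ = fun p => lam phi ^+ n * C^-1 * (u p * h p.1)); last first.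
  apply/funext => p; rewrite iter_transfer_ext.
  rewrite (_ : (fun q : X => _) = fun q => C^-1 * v q); last first.
    by apply/funext => q; rewrite mulrA mulfK// gt_eqF.
  by rewrite iter_norm_koopman !mulrA.
have [muh _] := HC u mu'.
have := (HD _ muh).2; rewrite (_ : (fun q : X => _) = u); last first.
  by apply/funext => q; rewrite mulfK// gt_eqF.
rewrite u1 sqintZ// => H.
have l2 : (0%E <= ((lam phi ^+ n * C^-1 * D^-1) ^+ 2)%:E)%E by rewrite lee_fin sqr_ge0.
have := lee_wpmul2l l2 H; rewrite mule1 muleA -EFinM.
rewrite (_ : _ * D ^+ 2 = (lam phi ^+ n * C^-1) ^+ 2); last by field; rewrite ?gt_eqF.
by rewrite (_ : (C * D)^-1 * _ = lam phi ^+ n * C^-1 * D^-1)// invfM; ring.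
Qed.

End transfer.

(** * Norms of the iterates on a subspace *)

Section growth.
Implicit Types f : X -> R.
Local Notation Lx := transfer_ext.

Definition growth (V : set (X -> R)) n : R := fine (operator_norm m V (iter n L)).

Lemma iter_transfer_extZ a f n : iter n Lx (fun p => a * f p) = fun p => a * iter n Lx f p.
Proof.
elim: n => [|n IH] //=; rewrite IH; apply/funext => p; rewrite /transfer_ext mulr_sumr.
by apply: eq_bigr => i _; rewrite mulrCA.
Qed.

Variable V : set (X -> R).
Hypothesis V0 : V (fun=> 0).
Hypothesis VL2 : V `<=` L2 m.

Let sqi n f : V f -> sqint m (iter n L f) = sqint m (iter n Lx f).
Proof.
by move=> /VL2; exact: sqint_iter.
Qed.

Lemma operator_norm_bound n K : 0 <= K ->
  (forall f, V f -> (sqint m f <= 1)%E -> (sqint m (iter n Lx f) <= (K ^+ 2)%:E)%E) ->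
  (operator_norm m V (iter n L) <= K%:E)%E.
Proof. by move=> K0 H; apply: operator_norm_le => // f Vf f1; rewrite sqi// H. Qed.

Lemma operator_norm_geom : exists2 C : R, 0 < C &
  forall n, (operator_norm m V (iter n L) <= (C * lam phi ^+ n)%:E)%E.
Proof.
have [C C0 HC] := transfer_ext_growth.
exists C => // n; have K0 : 0 <= C * lam phi ^+ n by rewrite mulr_ge0 ?exprn_ge0 ?expR_ge0// ltW.
apply: operator_norm_bound => // f /VL2 Lf f1; apply: le_trans (HC n f Lf) _.
by rewrite -[leRHS]mule1; apply: lee_wpmul2l; rewrite // lee_fin sqr_ge0.
Qed.

Lemma growthE n : operator_norm m V (iter n L) = (growth V n)%:E.
Proof.
have [C C0 HC] := operator_norm_geom.
rewrite /growth fineK// ge0_fin_numE; first exact: le_lt_trans (HC n) (ltry _).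
apply: operator_norm_ge0 V0 _; rewrite /sqint (eq_integral (fun=> 0%E)) ?integral0//.
by move=> p _; rewrite expr0n.
Qed.

Lemma growth_ge0 n : 0 <= growth V n.
Proof.
rewrite -lee_fin -growthE; apply: operator_norm_ge0 V0 _.
by rewrite /sqint (eq_integral (fun=> 0%E)) ?integral0// => p _; rewrite expr0n.
Qed.

Lemma growth_geom : exists2 C : R, 0 < C & forall n, growth V n <= C * lam phi ^+ n.
Proof.
by have [C C0 HC] := operator_norm_geom; exists C => // n; rewrite -lee_fin -growthE.
Qed.

Lemma growth_le n K : 0 <= K ->
  (forall f, V f -> (sqint m f <= 1)%E -> (sqint m (iter n Lx f) <= (K ^+ 2)%:E)%E) ->
  growth V n <= K.
Proof. by move=> K0 H; rewrite -lee_fin -growthE operator_norm_bound. Qed.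

Lemma growth_ge n f : V f -> (sqint m f <= 1)%E ->
  (sqint m (iter n Lx f) <= (growth V n ^+ 2)%:E)%E.
Proof.
move=> Vf f1; rewrite -sqi//; apply: operator_norm_ge Vf f1; first exact: growth_ge0.
by rewrite growthE.
Qed.

Lemma growth_apply n f : (forall a, V (fun p => a * f p)) ->
  (sqint m (iter n Lx f) <= (growth V n ^+ 2)%:E * sqint m f)%E.
Proof.
move=> Vf; have Vf1 : V f by have := Vf 1; congr (V _); apply/funext => p; rewrite mul1r.
have /L2P[mf ff] := VL2 Vf1.
have [_ /L2P[mg _] _] := iter_extension_operator n (VL2 Vf1).
apply: (@operator_norm_apply _ _ _ m V (iter n L)) => //.
- exact: growth_ge0.
- by rewrite growthE.
- by move=> a; rewrite sqi// iter_transfer_extZ.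
Qed.

Lemma spectral_radius_growth l : (fun n => growth V n `^ n%:R^-1) @ \oo --> l ->
  spectral_radius m V L = l%:E.
Proof.
move=> ul; rewrite /spectral_radius; apply/cvg_lim => //.
apply: cvg_EFin; first by apply: nearW => n; rewrite growthE poweR_EFin.
rewrite (_ : _ \o _ = fun n => growth V n `^ n%:R^-1)//.
by apply/funext => n /=; rewrite growthE poweR_EFin.
Qed.

End growth.

Lemma L2_zero : L2 m (fun=> 0).
Proof.
apply/L2P; split=> //; rewrite /sqint (eq_integral (fun=> 0%E)) ?integral0//.
by move=> p _; rewrite expr0n.
Qed.

Lemma spectral_radius_L2 :
  spectral_radius m (L2 m) (extension_operator Psi phi h mu_phi) = (lam phi)%:E.
Proof.
have VL : L2 m `<=` L2 m by [].
have ge0 := growth_ge0 L2_zero VL.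
have ap := growth_ge L2_zero VL.
have [C C0 HC] := growth_geom L2_zero VL.
have [c c0 Hc] := transfer_ext_witness.
apply: (spectral_radius_growth L2_zero VL).
apply: (root_squeeze c0 C0); first exact: expR_ge0.
move=> n; rewrite HC andbT; have [f [Lf f1 H]] := Hc n.
have clam : 0 <= c * lam phi ^+ n by rewrite mulr_ge0 ?exprn_ge0 ?expR_ge0// ltW.
by have := le_trans H (ap n f Lf f1); rewrite lee_fin ler_sqr ?nnegrE ?ge0.
Qed.

Let S := state A j.

(** * Functions of finitely many letters as functions on states times the group *)

Section cylinder_functions.
Implicit Types (f : X -> R) (F : S -> G -> R).
Local Notation Lx := transfer_ext.
Local Notation V := (cylinder_space G mu_phi j).
Local Notation T := (transition (@step I A j) (psi Psi) (@jump R I A phi j)).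

Definition lift F (p : X) : R := F (pre j p.1) p.2.

Definition cyl (v : S) : set (shift_space A) := [set x | pre j x = v].

Lemma cylE v : cyl v = cylinder A (val v).
Proof.
have vE : mkseq (letter (rep v)) j = val v by rewrite -[in RHS](repK v).
apply/seteqP; split=> x; rewrite -vE.
  by move=> xv; apply/cylinder_mkseq/preP; rewrite repK.
by move=> /cylinder_mkseq/preP; rewrite repK => ->.
Qed.

Lemma measurable_cyl v : measurable (cyl v).
Proof. by rewrite cylE; exact: measurable_cylinder. Qed.

Let rects := [set B `*` D | B in cylinder_algebra A j & D in @measurable _ (discrete_group G)].

Lemma lift_preimage F (B : set R) : lift F @^-1` B =
  \bigcup_(v in [set: S]) (cyl v `*` [set g : discrete_group G | B (F v g)]).
Proof.
apply/seteqP; split=> [[x g] Bp|[x g] [v _ [/= <-]]] //.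
by exists (pre j x).
Qed.

Lemma measurable_lift F : measurable_fun setT (lift F).
Proof.
move=> _ B _; rewrite setTI lift_preimage; apply: fin_bigcup_measurable => [|v _]; first exact: finite_finset.
by apply: measurableX => //; exact: measurable_cyl.
Qed.

Lemma lift_wrt F : measurable_wrt <<s rects >> (lift F).
Proof.
move=> B _; rewrite lift_preimage.
apply: (@fin_bigcup_measurable _ (g_sigma_algebraType rects)) => [|v _].
  exact: finite_finset.
apply: sub_sigma_algebra; exists (cyl v); last by exists [set g | B (F v g)].
apply: sub_sigma_algebra; rewrite cylE; exists (val v) => //.
by split; [rewrite size_tuple|exact: (valP v)].
Qed.

(** A set generated by the rectangles does not separate (x, g) from (y, g) when x and y share their
    first j letters. *)
Lemma wrt_lift f : measurable_wrt <<s rects >> f -> exists F, f = lift F.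
Proof.
move=> mf; exists (fun v g => f (rep v, g)); apply/funext => -[x g]; rewrite /lift /=.
set y := rep _; have xy : agree j x y by exact: agree_rep.
pose sat := [set B : set X | B (x, g) <-> B (y, g)].
suff H : <<s rects >> `<=` sat.
  have [/(_ erefl) + _] := H _ (mf _ (measurable_set1 (f (x, g)))).
  by move=> /= ->.
apply: smallest_sub; last first.
  move=> _ [B BA [D _ <-]]; split=> -[/= Bx Dg]; split=> //=.
    exact: (cylinder_algebra_saturated BA xy).
  by apply: (cylinder_algebra_saturated BA (x := y)) => // k kj; rewrite xy.
split.
- by [].
- by move=> C [C1 C2]; split=> /= -[_ H]; split=> //; [move/C2|move/C1].
- by move=> E HE; split=> /= -[k _ Fk]; exists k => //; apply/HE.
Qed.

Definition cyl_weight (P : probability (shift_space A) R) (v : S) : R := fine (P (cyl v)).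
Local Notation w := (cyl_weight mu_phi).

Lemma cyl_weightE (P : probability (shift_space A) R) v : P (cyl v) = (cyl_weight P v)%:E.
Proof. by rewrite /cyl_weight fineK// fin_num_measure//; exact: measurable_cyl. Qed.

Lemma cyl_weight_ge0 (P : probability (shift_space A) R) v : 0 <= cyl_weight P v.
Proof. by rewrite -lee_fin -cyl_weightE measure_ge0. Qed.

Lemma integral_pre (P : probability (shift_space A) R) (f : S -> R) : (forall v, 0 <= f v) ->
  (\int[P]_x (f (pre j x))%:E = (\sum_v cyl_weight P v * f v)%:E)%E.
Proof.
move=> f0; transitivity (\int[P]_x \sum_(v : S) ((f v)%:E * (\1_(cyl v) x)%:E))%E.
  apply: eq_integral => x _; rewrite (bigD1 (pre j x))//= big1 => [|v vx].
    by rewrite indicE mem_set// mule1 adde0.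
  rewrite indicE memNset ?mule0// => xv; move: vx; rewrite /cyl /= in xv.
  by rewrite xv eqxx.
rewrite ge0_integral_sum//; first last.
- by move=> v x _; rewrite mule_ge0// lee_fin.
- move=> v; apply: emeasurable_funM => //; apply/measurable_EFinP.
  by apply: measurable_indic; exact: measurable_cyl.
rewrite -sumEFin; apply: eq_bigr => v _.
rewrite ge0_integralZl_EFin//; last first.
  by apply/measurable_EFinP; apply: measurable_indic; exact: measurable_cyl.
rewrite integral_indic//; last exact: measurable_cyl.
rewrite setIT; apply: etrans (congr1 (fun t => _ * t)%E (cyl_weightE P v)) _.
by rewrite -EFinM mulrC.
Qed.

Definition mass_at F g : R := \sum_v w v * F v g ^+ 2.

Lemma mass_at_ge0 F g : 0 <= mass_at F g.
Proof. by apply: sumr_ge0 => v _; rewrite mulr_ge0 ?sqr_ge0 ?cyl_weight_ge0. Qed.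

Lemma sqint_lift F : sqint m (lift F) = (\esum_(g in [set: G]) (mass_at F g)%:E)%E.
Proof.
have mF := measurable_lift F.
rewrite /sqint (product_integral G_countable); first last.
- by move=> p; rewrite lee_fin sqr_ge0.
- by apply/measurable_EFinP; exact: measurable_funX.
apply: eq_esum => g _; rewrite -(integral_pre mu_phi (f := fun v => F v g ^+ 2))//.
by move=> v; exact: sqr_ge0.
Qed.

Lemma esum_seq (f : G -> R) (B : {fset G}) : (forall g, 0 <= f g) -> (forall g, g \notin B -> f g = 0) ->
  (\esum_(g in [set: G]) (f g)%:E = (\sum_(g <- B) f g)%:E)%E.
Proof.
move=> f0 fB; rewrite -sumEFin fsbig_seq ?fset_uniq//.
rewrite -esum_fset => [|//|g _]; last by rewrite lee_fin.
rewrite [RHS]esum_mkcond; apply: eq_esum => g _.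
by rewrite mem_setE; case: ifPn => // /fB ->.
Qed.

Lemma esum_mass F : ffs F -> (\esum_(g in [set: G]) (mass_at F g)%:E = (sqnorm w F)%:E)%E.
Proof.
move=> fF; have [B BP] : exists B : {fset G}, forall v g, g \notin B -> F v g = 0.
  have /choice[B BP] : forall v, exists B : {fset G}, forall g, g \notin B -> F v g = 0.
    by move=> v; exact: fF.
  exists (\bigcup_(v <- enum {: S}) B v)%fset => v g gB; apply: BP; apply: contra gB => gv.
  by apply/bigfcupP; exists v; rewrite // mem_enum.
rewrite (esum_seq (mass_at_ge0 F) (B := B)).
  congr EFin; rewrite /sqnorm exchange_big/=; apply: eq_bigr => v _.
  by rewrite (fsumE (A := B)) ?mulr_sumr// => g /BP ->; rewrite expr0n.
by move=> g gB; rewrite /mass_at big1// => v _; rewrite BP// expr0n mulr0.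
Qed.

Lemma transfer_lift F : Lx (lift F) = lift (T F).
Proof.
apply/funext => -[x g]; rewrite /transfer_ext /lift /transition /=.
by apply: eq_bigr => i _; rewrite pre_consx.
Qed.

Lemma iter_transfer_lift F n : iter n Lx (lift F) = lift (iter n T F).
Proof. by elim: n => [|n IH] //=; rewrite IH transfer_lift. Qed.

Lemma lift_space F a : (sqint m (lift F) < +oo)%E -> V (fun p => a * lift F p).
Proof.
move=> Ff; split; first by apply: L2_scale; apply/L2P; split=> //; exact: measurable_lift.
exists (lift (fun v g => a * F v g)); split; first exact: ae_eq_refl.
exact: lift_wrt.
Qed.

Lemma space_lift f : V f -> exists F, ae_eq m setT f (lift F).
Proof. by move=> [_ [f' [ff' /wrt_lift[F f'E]]]]; exists F; rewrite -f'E. Qed.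

Lemma space_zero : V (fun=> 0).
Proof.
split; first exact: L2_zero.
exists (lift (fun _ _ => 0)); split; [exact: ae_eq_refl|exact: lift_wrt].
Qed.

Lemma space_L2 : V `<=` L2 m. Proof. by move=> f []. Qed.

Lemma sqint_iter_lift f F n : L2 m f -> ae_eq m setT f (lift F) ->
  [/\ sqint m f = sqint m (lift F), (sqint m (lift (iter n T F)) < +oo)%E &
  sqint m (iter n Lx f) = sqint m (lift (iter n T F))].
Proof.
move=> Lf fF; have /L2P[mf ff] := Lf; have mF := measurable_lift F.
have E : sqint m f = sqint m (lift F) by exact: eq_sqint.
have LF : L2 m (lift F) by apply/L2P; rewrite -E.
have it := sqint_iter n.
have fin : (sqint m (lift (iter n T F)) < +oo)%E.
  have [_ /L2P[_ +] _] := iter_extension_operator n LF.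
  by rewrite iter_transfer_lift.
split=> //; rewrite -iter_transfer_lift -(it _ LF) -(it _ Lf).
(* f is a lift only almost everywhere, but one application of the operator turns this into equality;
   hence n = 0 is treated apart. *)
case: n {it fin} => [|n]; first exact: E.
rewrite !iterSr; congr (sqint m (iter n _ _)).
exact: extension_operator_congr.
Qed.

Lemma space_iter f F n : V f -> ae_eq m setT f (lift F) ->
  (sqint m (iter n Lx f) = \esum_(g in [set: G]) (mass_at (iter n T F) g)%:E)%E /\
  (sqint m f = \esum_(g in [set: G]) (mass_at F g)%:E)%E.
Proof. by move=> /space_L2 Lf /(sqint_iter_lift n Lf)[-> _ ->]; rewrite !sqint_lift. Qed.

Let u n := growth V n.

Lemma cyl_growth_ge0 n : 0 <= u n.
Proof.
exact: (growth_ge0 space_zero space_L2).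
Qed.

Lemma cyl_growth_ge F n : ffs F -> sqnorm w (iter n T F) <= u n ^+ 2 * sqnorm w F.
Proof.
move=> fF; have := growth_apply space_zero space_L2 n (f := lift F).
have Ff : (sqint m (lift F) < +oo)%E by rewrite sqint_lift esum_mass// ltry.
move=> /(_ (fun a => lift_space a Ff)).
rewrite iter_transfer_lift !sqint_lift esum_mass; last exact: ffs_iter.
by rewrite esum_mass// -EFinM lee_fin.
Qed.

Lemma iter_local n (B : seq G) : exists B' : {fset G}, forall F F',
  (forall v g, g \in B' -> F v g = F' v g) ->
  forall v g, g \in B -> iter n T F v g = iter n T F' v g.
Proof.
elim: n B => [|n IH] B.
  by exists [fset g in B]%fset => F F' H v g gB; apply: H; rewrite inE.
have [B' HB'] := IH [seq (g * (psi Psi i)^-1)%g | g <- B, i <- enum I].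
exists B' => F F' H v g gB /=; rewrite /transition; apply: eq_bigr => i _; congr (_ * _).
by apply: (HB' F F' H); apply/allpairsP; exists (g, i); rewrite mem_enum.
Qed.

(** Finitely supported functions suffice: on a finite set of group elements the n-th iterate depends
    on F at finitely many group elements only, so F may be truncated there without increasing its
    norm. *)
Lemma cyl_growth_le n K : 0 <= K ->
  (forall F, ffs F -> sqnorm w (iter n T F) <= K ^+ 2 * sqnorm w F) -> u n <= K.
Proof.
move=> K0 H; apply: (growth_le space_zero space_L2) => // f Vf f1.
have [F fF] := space_lift Vf; have [-> f1'] := space_iter n Vf fF; rewrite f1' in f1.
apply: ge_ereal_sup => _ [B [finB _] <-].
have [B' HB'] := iter_local n (fset_set B).
pose F' v g := if g \in B' then F v g else 0.
have fF' : ffs F' by move=> v; exists B' => g /negbTE gB'; rewrite /F' gB'.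
have E : (\sum_(g \in B) (mass_at (iter n T F) g)%:E = \sum_(g \in B) (mass_at (iter n T F') g)%:E)%E.
  apply: eq_fsbigr => g gB; congr EFin; apply: eq_bigr => v _; congr (_ * _ ^+ 2).
  by apply: HB' => [v' g' g'B|]; rewrite /F' ?g'B// in_fset_set.
rewrite E; apply: (@le_trans _ _ (sqnorm w (iter n T F'))%:E).
  rewrite -esum_mass; last exact: ffs_iter.
  by apply: esum_ge; exists B.
apply: (@le_trans _ _ (K ^+ 2 * sqnorm w F')%:E); first by rewrite lee_fin H.
have F1 : ((sqnorm w F')%:E <= 1)%E.
  apply: le_trans f1; rewrite -esum_mass//; apply: le_esum => g _; rewrite lee_fin.
  apply: ler_sum => v _; apply: ler_wpM2l; first exact: cyl_weight_ge0.
  by rewrite /F'; case: ifP => // _; rewrite expr0n sqr_ge0.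
by rewrite lee_fin ler_piMr ?sqr_ge0.
Qed.

Lemma cyl_growth_mul n k : u (n + k)%N <= u n * u k.
Proof.
apply: (growth_le space_zero space_L2).
  by rewrite mulr_ge0 ?cyl_growth_ge0.
move=> f Vf f1; have [F fF] := space_lift Vf.
have ap i F' := growth_apply space_zero space_L2 i (f := lift F').
have Lf := space_L2 Vf.
have [fE _ ->] := sqint_iter_lift (n + k) Lf fF.
have [_ kf _] := sqint_iter_lift k Lf fF.
have [_ zf _] := sqint_iter_lift 0 Lf fF.
have un0 : (0%E <= (u n ^+ 2)%:E)%E by rewrite lee_fin sqr_ge0.
have uk0 : (0%E <= (u k ^+ 2)%:E)%E by rewrite lee_fin sqr_ge0.
have Hn := ap n (iter k T F) (fun a => lift_space a kf).
have Hk := ap k F (fun a => lift_space a zf).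
rewrite iter_transfer_lift -iterD in Hn; rewrite iter_transfer_lift -fE in Hk.
apply: le_trans Hn _; apply: le_trans (lee_wpmul2l un0 Hk) _.
apply: le_trans (lee_wpmul2l un0 (lee_wpmul2l uk0 f1)) _.
by rewrite mule1 -EFinM -exprMn.
Qed.

Lemma cyl_radius : exists2 l : R, [/\ 0 <= l, forall n, (0 < n)%N -> l ^+ n <= u n &
    spectral_radius m V L = l%:E] & (fun n => u n `^ n%:R^-1) @ \oo --> l.
Proof.
have [l [l0 lu] ul] := fekete cyl_growth_ge0 cyl_growth_mul.
exists l => //; split=> //.
exact: (spectral_radius_growth space_zero space_L2).
Qed.

End cylinder_functions.

(** * Perron eigenvectors on states *)

Local Notation nu := (cyl_weight mu).
Local Notation w := (cyl_weight mu_phi).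
Local Notation q := (@jump R I A phi j).
Local Notation s := (@step I A j).
Local Notation T := (transition s (psi Psi) q).

(** Conformality for functions of the first j letters. It is available for nonnegative functions; a
    signed f is first shifted by a constant. *)
Lemma left_eigen (f : S -> R) :
  \sum_v nu v * \sum_i q i v * f (s i v) = lam phi * \sum_v nu v * f v.
Proof.
have pos (f' : S -> R) : (forall v, 0 <= f' v) ->
    \sum_v nu v * \sum_i q i v * f' (s i v) = lam phi * \sum_v nu v * f' v.
  move=> f0; apply: (canRL (mulVKf _)); first by rewrite gt_eqF// lam_gt0.
  apply: EFin_inj; rewrite -(integral_pre mu f0).
  rewrite -(conformal_ge0 phi_loc j0 gibbs); last by move=> x; rewrite lee_fin.
    rewrite mulr_sumr; transitivity (\sum_v nu v * ((lam phi)^-1 * \sum_i q i v * f' (s i v)))%:E.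
      by congr EFin; apply: eq_bigr => v _; rewrite mulrCA.
    rewrite -integral_pre => [|v].
      apply: eq_integral => x _; rewrite /pullback mulr_sumr -sumEFin.
      by apply: eq_bigr => i _; rewrite -EFinM pre_consx// mulrA.
    rewrite mulr_ge0 ?invr_ge0 ?expR_ge0// sumr_ge0// => i _.
    by rewrite mulr_ge0// jump_ge0.
  apply/measurable_EFinP; apply: (@measurable_local _ _ _ j) => x y /preP xy.
  by rewrite xy.
pose c := \sum_v `|f v|.
have fc v : 0 <= f v + c.
  rewrite /c (bigD1 v)//= addrA addr_ge0 ?sumr_ge0//.
  by have := ler_norm (- f v); rewrite normrN; lra.
have c0 : 0 <= c by exact: sumr_ge0.
have := pos _ fc; have := pos (fun=> c) (fun=> c0).
have E0 v : \sum_i q i v * (f (s i v) + c) = \sum_i q i v * f (s i v) + \sum_i q i v * c.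
  transitivity (\sum_i (q i v * f (s i v) + q i v * c)); last exact: big_split.
  by apply: eq_bigr => i _; rewrite mulrDr.
have E1 : \sum_v nu v * \sum_i q i v * (f (s i v) + c) =
    \sum_v nu v * \sum_i q i v * f (s i v) + \sum_v nu v * \sum_i q i v * c.
  transitivity (\sum_v (nu v * (\sum_i q i v * f (s i v)) + nu v * \sum_i q i v * c));
    last exact: big_split.
  by apply: eq_bigr => v _; rewrite E0 mulrDr.
have E2 : \sum_v nu v * (f v + c) = \sum_v nu v * f v + \sum_v nu v * c.
  transitivity (\sum_v (nu v * f v + nu v * c)); last exact: big_split.
  by apply: eq_bigr => v _; rewrite mulrDr.
by rewrite E1 E2 mulrDr => -> /addIr.
Qed.

Lemma positive_path_sorted u v : sorted A (rcons u (letter (rep v) 0)) ->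
  positive_path s q u v.
Proof.
elim: u => [//|i u IH] /appendx_cons[iu /IH su] /=; rewrite su andbT.
rewrite -[X in act _ _ X](repK v) act_pre// (jump_pre phi_loc j0) iu; exact: expR_gt0.
Qed.

Lemma path_connected (u : S) : exists c : G, forall v g, exists w,
  [/\ positive_path s q w v, act s w v = u & wprod (psi Psi) w = (c * g)%g].
Proof.
have [c cP] := step_connected Psi_hom j0 Psi_linked Psi_onto u.
exists c => v g; have [u' [su au pu]] := cP v g; exists u'; split=> //.
exact: positive_path_sorted.
Qed.

(** Some state has positive mass, as the total is 1, and a positive path leads from it to v.
    Positivity is carried along each step by [left_eigen] for the indicator of the next state. *)
Lemma nu_gt0 v : 0 < nu v.
Proof.
have nu0 := @cyl_weight_ge0 mu.
have [v0 v00] : exists v0, 0 < nu v0.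
  have /existsP[v0 v00] : [exists v0, nu v0 != 0].
    apply: contraT => /existsPn H; have := @integral_pre mu (fun=> 1) (fun=> ler01).
    rewrite big1 => [|v' _]; last by have /negPn/eqP -> := H v'; rewrite mul0r.
    rewrite integral_cst// => E.
    have := etrans (esym (congr1 (fun t => 1 * t)%E (probability_setT mu))) E.
    by rewrite mule1 => /eqP; rewrite eqe oner_eq0.
  by exists v0; rewrite lt_def v00 nu0.
have [c cP] := path_connected v; have [u [pu <- _]] := cP v0 1%g.
elim: u pu {cP} => [//|i u IH] /= /andP[qi /IH]; set v1 := act s u v0 in qi * => nu1.
have E := left_eigen (fun v => (v == s i v1)%:R).
have E' : \sum_v nu v * (v == s i v1)%:R = nu (s i v1).
  rewrite (bigD1 (s i v1))//= eqxx mulr1 big1 ?addr0// => v' /negbTE ->.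
  by rewrite mulr0.
rewrite -(pmulr_rgt0 _ (lam_gt0 phi)) -E' -E (bigD1 v1)//=.
apply: ltr_wpDr.
  apply: sumr_ge0 => v' _; rewrite mulr_ge0// sumr_ge0// => i' _.
  by rewrite mulr_ge0// jump_ge0.
apply: mulr_gt0 => //; rewrite (bigD1 i)//= eqxx mulr1; apply: ltr_wpDr => //.
by apply: sumr_ge0 => i' _; rewrite mulr_ge0// jump_ge0.
Qed.

Lemma w_gt0 v : 0 < w v.
Proof.
have [d d0 dP] := h_lower.
have [_ _ mphi] := gibbs.
apply: (@lt_le_trans _ _ (d * nu v)); first by rewrite mulr_gt0// nu_gt0.
have mc := measurable_cyl v.
rewrite -lee_fin -cyl_weightE; apply: le_trans (_ : (\int[mu]_(x in cyl v) (h x)%:E <= _)%E); last first.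
  by rewrite -(mphi _ mc).
rewrite EFinM -cyl_weightE -(integral_cst mu mc); apply: ge0_le_integral => //.
- by move=> x _; rewrite lee_fin ltW.
- by apply/measurable_EFinP; exact: measurable_funS (measurable_h gibbs).
- by move=> x _; rewrite lee_fin.
Qed.

Definition cyl_sup v : R := sup [set h x | x in cyl v].
Local Notation H := cyl_sup.

Lemma cyl_sup_ub x : h x <= H (pre j x).
Proof.
have [d d0 dP] := h_upper.
by apply: ub_le_sup; [exists d => _ [y _ <-]|exists x].
Qed.

Lemma cyl_sup_gt0 v : 0 < H v.
Proof. by rewrite -(repK v); apply: lt_le_trans (cyl_sup_ub _). Qed.

(** Suprema turn the equation for h into an inequality at each state. Both sides have the same sum
    against [nu], and [nu] is positive, so equality holds everywhere. *)
Lemma cyl_sup_eigen v : \sum_i q i v * H (s i v) = lam phi * H v.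
Proof.
have ge v' : lam phi * H v' <= \sum_i q i v' * H (s i v').
  rewrite mulrC -ler_pdivlMr ?lam_gt0//; apply: ge_sup.
    by exists (h (rep v')), (rep v') => //; exact: repK.
  move=> _ [x <- <-]; rewrite eigen mulrC ler_pM2r ?invr_gt0 ?lam_gt0//.
  apply: ler_sum => i _; apply: ler_wpM2l; first exact: jump_ge0.
  by rewrite -pre_consx//; exact: cyl_sup_ub.
have := left_eigen H; rewrite mulr_sumr => /eqP; rewrite -subr_eq0 -sumrB.
under eq_bigr do rewrite mulrCA -mulrBr.
rewrite psumr_eq0 => [/allP/(_ v)|v' _]; last first.
  by rewrite mulr_ge0 ?subr_ge0 ?ge// ltW// nu_gt0.
rewrite mem_index_enum => /(_ erefl) /=; rewrite mulf_eq0 gt_eqF ?nu_gt0//=.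
by rewrite subr_eq0 => /eqP.
Qed.

Local Notation gam := (fun (n0 : nat) (w : n0.-tuple I) => wprod (psi Psi) w).
Local Notation Z := (weight (ew phi) gam).
Let u n := growth (cylinder_space G mu_phi j) n.

Let u_ge0 n : 0 <= u n.
Proof. exact: cyl_growth_ge0. Qed.

Let u_ge F n : ffs F -> sqnorm w (iter n T F) <= u n ^+ 2 * sqnorm w F.
Proof. exact: cyl_growth_ge. Qed.

Let u_le n K : 0 <= K ->
  (forall F, ffs F -> sqnorm w (iter n T F) <= K ^+ 2 * sqnorm w F) -> u n <= K.
Proof. exact: cyl_growth_le. Qed.

Let w0 v : 0 < w v.
Proof. exact: w_gt0. Qed.

Let nu0 v : 0 < nu v.
Proof. exact: nu_gt0. Qed.

Let H0 v : 0 < H v.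
Proof. exact: cyl_sup_gt0. Qed.

Let eigH v : \sum_i q i v * H (s i v) = lam phi * H v.
Proof. exact: cyl_sup_eigen. Qed.

Let sum_gt0 (f : S -> R) : (forall v, 0 < f v) -> 0 < \sum_v f v.
Proof.
move=> f0; rewrite (bigD1 (pre j (point : shift_space A)))//=.
by apply: ltr_wpDr => //; apply: sumr_ge0 => v _; exact: ltW.
Qed.

Let e0 n (v : n.-tuple I) : 0 <= ew phi v.
Proof. exact: ew_ge0. Qed.

Let Z0 n g : 0 <= Z n g.
Proof. by apply: weight_ge0 => n' w'; exact: ew_ge0. Qed.

Lemma weightE n g : (0 < n)%N ->
  Z n g = \sum_(w : n.-tuple I | sorted A w && (Psi w == g)) expR (word_sum phi w).
Proof.
move=> n0; rewrite /weight [LHS]big_mkcond [RHS]big_mkcond; apply: eq_bigr => v _.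
have v0 : (v : seq I) <> [::] by move=> /(congr1 size); rewrite size_tuple => n00; rewrite n00 in n0.
by rewrite (wprodE Psi_hom v0) /ew; case: (Psi v == g); case: (sorted A v).
Qed.

Lemma partition_kernel n : (0 < n)%N -> partition phi (kernel_words A Psi) n = Z n 1%g.
Proof.
move=> n0; rewrite weightE//; apply: eq_bigl => v.
have v0 : (v : seq I) <> [::] by move=> /(congr1 size); rewrite size_tuple => n00; rewrite n00 in n0.
apply/idP/idP => [/set_mem[/= vP [_ ->]]|/andP[sv /eqP vP]]; first by rewrite vP eqxx.
exact/mem_set.
Qed.

(** * Bounds for the spectral radius *)

Section radius_bounds.
Variable l : R.
Hypothesis l0 : 0 <= l.
Hypothesis l_le : forall n, (0 < n)%N -> l ^+ n <= u n.
Hypothesis l_lim : (fun n => u n `^ n%:R^-1) @ \oo --> l.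

Lemma kernel_growth : exists2 C : R, 0 < C & forall n, Z n 1%g <= C * u n.
Proof.
pose K := (\sum_v (w v)^-1) * \sum_v w v.
have K0 : 0 < K by rewrite mulr_gt0// sum_gt0// => v; rewrite invr_gt0.
exists (expR (distortion phi j) * Num.sqrt K); first by rewrite mulr_gt0 ?expR_gt0// sqrtr_gt0.
move=> n; have := sqnorm_kernel_ge Psi phi_loc j0 w0 n.
have := u_ge n (unit_fun_ffs R G (j := j)); rewrite sqnorm_unit_fun => H1 H2.
have : (expR (- distortion phi j) * Z n 1%g) ^+ 2 <= (Num.sqrt K * u n) ^+ 2.
  apply: le_trans H2 _; rewrite exprMn sqr_sqrtr ?(ltW K0)// /K -mulrA ler_pM2l; last first.
    by apply: sum_gt0 => v; rewrite invr_gt0.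
  by rewrite mulrC.
rewrite ler_sqr ?nnegrE ?mulr_ge0 ?expR_ge0 ?sqrtr_ge0// expRN => H3.
by rewrite -mulrA -ler_pdivrMl ?expR_gt0.
Qed.

Lemma kernel_pressure_le : (pressure phi (kernel_words A Psi) <= lne l%:E)%E.
Proof.
have [C C0 HC] := kernel_growth.
apply: le_lne => // t lt.
have : (fun n => (C * u n) `^ n%:R^-1) @ \oo --> l.
  rewrite -[X in _ --> X]mul1r (_ : (fun n => _) = fun n => C `^ n%:R^-1 * u n `^ n%:R^-1).
    by apply: cvgM => //; exact: root_cvg1.
  by apply/funext => n; rewrite powRM// ltW.
move=> /cvgrPdist_lt/(_ (expR t - l)).
rewrite subr_gt0 => /(_ lt)[N _ HN]; apply: (@pressure_le _ _ _ _ _ _ N) => n Nn n0.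
rewrite partition_kernel//; apply: le_trans (HC n) _.
have Cu0 : 0 <= C * u n by rewrite mulr_ge0// ltW.
rewrite -(rootK n0 Cu0) expRM_natr lerXn2r ?nnegrE ?powR_ge0 ?expR_ge0//.
by have := HN n Nn; rewrite /= ltr_distlC => /andP[_]; rewrite addrC subrK => /ltW.
Qed.

Lemma radius_le : l <= lam phi.
Proof.
have V0 : cylinder_space G mu_phi j (fun=> 0) by exact: space_zero.
have VL2 : cylinder_space G mu_phi j `<=` L2 (extension_measure G mu_phi) by exact: space_L2.
have [C C0 HC] := growth_geom
  V0 VL2.
apply: (@le_of_subexponential _ _ _ (fun=> C)) => //.
- by move=> n _; exact: ltW.
- exact: root_cvg1.
- exact: expR_ge0.
- by move=> n n0; apply: le_trans (l_le n0) _; exact: HC.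
Qed.

Lemma amenable_radius : amenable R G -> lam phi <= l.
Proof.
move=> am; have lm0 : 0 <= lam phi by exact: expR_ge0.
(* [amenable_transition] bounds lam^(2n) by twice the square of [u n]; the square root of 2 is
   rounded up to 2. *)
apply: (@root_lim_ge _ u 2^-1 (lam phi) l) => // n.
have [|F [fF F0 HF]] := amenable_transition (psi Psi) (fun v => ltW (w0 v)) eigH n am.
  by exists (pre j (point : shift_space A)); rewrite w0 gt_eqF.
have := le_trans HF (ler_wpM2l (ler0n _ 2) (u_ge n fF)).
rewrite mulrA ler_pM2r// => H1; rewrite mulrC ler_pdivrMr//.
rewrite -ler_sqr ?nnegrE ?mulr_ge0 ?exprn_ge0//; apply: le_trans H1 _.
by rewrite exprMn; have := sqr_ge0 (u n); nra.
Qed.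

Lemma sqnorm_scale (a b k : S -> R) C (F : S -> G -> R) : ffs F ->
  (forall v, a v * k v ^+ 2 <= C * b v) ->
  sqnorm a (fun v g => k v * F v g) <= C * sqnorm b F.
Proof.
move=> fF ab; rewrite /sqnorm mulr_sumr; apply: ler_sum => v _.
rewrite (@eq_fsum _ _ _ (fun g => k v ^+ 2 * F v g ^+ 2)) => [|g]; last by rewrite exprMn.
rewrite fsumZ mulrA [leRHS]mulrA; apply: ler_wpM2r; last exact: ab.
by apply: fsum_ge0 => g; exact: sqr_ge0.
Qed.

(** The Doob transform of the state weights by the right eigenvector. The product of the left and
    the right eigenvector is stationary for it. *)
Definition markov i v : R := q i v * H (s i v) / (lam phi * H v).
Definition stationary v : R := nu v * H v.
Local Notation Q := (transition s (psi Psi) markov).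

Lemma transition_markov F n :
  iter n T F = fun v g => lam phi ^+ n * H v * iter n Q (fun v g => (H v)^-1 * F v g) v g.
Proof.
elim: n => [|n IH].
  by apply/funext => v; apply/funext => g /=; rewrite expr0 mul1r mulVKf// gt_eqF.
apply/funext => v; apply/funext => g; rewrite !iterS IH /transition mulr_sumr.
apply: eq_bigr => i _; rewrite /markov exprS; set y := iter n _ _ _ _.
have := lam_gt0 phi; have := H0 v => a b.
by field; rewrite ?gt_eqF.
Qed.

(** If [walk_amenable] did not apply, some Q^N would divide all square norms by 4. Then T^(kN) has
    norm at most a constant times lam^(kN) 2^-k, whereas lam^(kN) <= l^(kN) <= [u (k * N)]; for
    large k this is impossible. *)
Lemma radius_amenable : lam phi <= l -> amenable R G.
Proof.
move=> lam_l; have lm0 := lam_gt0 phi; have om0 v : 0 < stationary v by rewrite mulr_gt0.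
have p0 i v : 0 <= markov i v.
  rewrite /markov mulr_ge0 ?invr_ge0 ?mulr_ge0 ?jump_ge0 ?expR_ge0//; exact: ltW.
apply: (@walk_amenable _ _ _ _ s (psi Psi) markov stationary) => //.
- move=> v; rewrite /markov -mulr_suml eigH divff// gt_eqF// mulr_gt0//.
- move=> f; have E := left_eigen (fun v => H v * f v).
  apply: (mulfI (lt0r_neq0 lm0)); transitivity (lam phi * \sum_v nu v * (H v * f v)); last first.
    by congr (_ * _); apply: eq_bigr => v _; rewrite /stationary mulrA.
  rewrite -E mulr_sumr; apply: eq_bigr => v _; rewrite /stationary mulrCA -!mulrA; congr (_ * _).
  rewrite !mulr_sumr; apply: eq_bigr => i _; rewrite /markov.
  by have := H0 v => a; field; rewrite ?gt_eqF.
- move=> c0; have [c cP] := path_connected c0.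
  exists c => v g; have [x [px ax xx]] := cP v g; exists x; split=> //.
  elim: x px {ax xx} => [//|i x IH] /= /andP[qi /IH ->]; rewrite andbT /markov.
  by rewrite divr_gt0// mulr_gt0.
apply: contrapT => /existsNP[N HN].
have {}HN F : ffs F -> 4 * sqnorm stationary (iter N Q F) <= sqnorm stationary F.
  by move=> fF; rewrite leNgt; apply/negP => F4; apply: HN; exists F.
have sq0 F := sqnorm_ge0 (fun v => ltW (om0 v)) F.
have HNk k F : ffs F -> 4 ^+ k * sqnorm stationary (iter (k * N) Q F) <= sqnorm stationary F.
  move=> fF; elim: k => [|k IH]; first by rewrite mul0n expr0 mul1r.
  apply: le_trans IH; rewrite exprSr -mulrA ler_pM2l ?exprn_gt0//.
  rewrite mulSn iterD; apply: HN; exact: ffs_iter.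
have N0 : (0 < N)%N.
  case: N HN {HNk} => // HN; have := HN _ (unit_fun_ffs R G (j := j)).
  by rewrite sqnorm_unit_fun /=; have := sum_gt0 om0; nra.
(* Q is contracted in the stationary weights and acts on F / H, while [u] is a norm in the weights
   [w]. C1 and C2 bound the two changes of weight; they are finite sums over states. *)
pose C1 := \sum_v w v * H v ^+ 2 / stationary v.
pose C2 := \sum_v stationary v * (H v)^-1 ^+ 2 / w v.
have le_sum (f : S -> R) v : (forall v, 0 <= f v) -> f v <= \sum_v f v.
  by move=> f0; rewrite (bigD1 v)//= lerDl sumr_ge0.
have C10 : 0 < C1 by apply: sum_gt0 => v; rewrite divr_gt0// mulr_gt0// exprn_gt0.
have C20 : 0 < C2 by apply: sum_gt0 => v; rewrite divr_gt0// mulr_gt0// exprn_gt0// invr_gt0.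
have HC1 v : w v * H v ^+ 2 <= C1 * stationary v.
  rewrite -ler_pdivrMr//; apply: (le_sum (fun v => w v * H v ^+ 2 / stationary v)) => v'.
  by rewrite divr_ge0 ?mulr_ge0 ?exprn_ge0// ltW.
have HC2 v : stationary v * (H v)^-1 ^+ 2 <= C2 * w v.
  rewrite -ler_pdivrMr//; apply: (le_sum (fun v => stationary v * (H v)^-1 ^+ 2 / w v)) => v'.
  by rewrite divr_ge0 ?mulr_ge0 ?exprn_ge0 ?invr_ge0// ltW.
have ukN k : u (k * N) <= Num.sqrt (C1 * C2) * lam phi ^+ (k * N) / 2 ^+ k.
  apply: u_le => [|F fF].
    by rewrite divr_ge0 ?mulr_ge0 ?sqrtr_ge0 ?exprn_ge0// ltW.
  pose F' v g := (H v)^-1 * F v g.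
  have fF' : ffs F' by move=> v; apply: fsuppMr; exact: fF.
  rewrite transition_markov (@eq_sqnorm _ _ _ _ _ (fun v g => lam phi ^+ (k * N) * (H v * iter (k * N) Q F' v g))); last first.
    by move=> v g; rewrite mulrA.
  rewrite sqnormZ.
  have b1 := sqnorm_scale (ffs_iter s (psi Psi) markov (k * N) fF') HC1.
  have b2 := HNk k F' fF'.
  have b3 := sqnorm_scale fF HC2.
  set a := sqnorm _ _ in b1 *; set b := sqnorm _ _ in b1 b2; set c := sqnorm stationary F' in b2.
  rewrite -/F' -/c in b3; set d := sqnorm _ _ in b3 *.
  have -> : (Num.sqrt (C1 * C2) * lam phi ^+ (k * N) / 2 ^+ k) ^+ 2 =
      (lam phi ^+ (k * N)) ^+ 2 * (C1 * C2 / 4 ^+ k).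
    have e4 : ((2 : R) ^+ k)^-1 ^+ 2 = (4 ^+ k)^-1.
      by rewrite exprVn -exprM mulnC exprM; congr ((_ ^+ k)^-1); ring.
    have C12 : 0 <= C1 * C2 by rewrite mulr_ge0// ltW.
    rewrite !exprMn e4 sqr_sqrtr//; ring.
  rewrite -[leRHS]mulrA ler_pM2l ?exprn_gt0//; apply: le_trans b1 _.
  rewrite (_ : C1 * C2 / 4 ^+ k * d = C1 * ((4 ^+ k)^-1 * (C2 * d))); last by ring.
  by rewrite ler_pM2l// mulrC ler_pdivlMr ?exprn_gt0// mulrC; exact: le_trans b2 b3.
have pow k : (0 < k)%N -> 2 ^+ k <= Num.sqrt (C1 * C2).
  move=> k0; have kN : (0 < k * N)%N by rewrite muln_gt0 k0.
  have := le_trans (le_trans (lerXn2r (k * N) (expR_ge0 _) l0 lam_l) (l_le kN)) (ukN k).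
  rewrite mulrAC -ler_pdivrMr ?exprn_gt0// divff ?gt_eqF ?exprn_gt0//.
  by rewrite ler_pdivlMr ?exprn_gt0// mul1r.
pose k := (Num.bound (Num.sqrt (C1 * C2))).+1.
have := pow k erefl; apply/negP; rewrite -ltNge.
apply: lt_trans (archi_boundP (sqrtr_ge0 _)) _; rewrite -natrX ltr_nat.
by apply: ltn_trans (ltn_expl _ (ltnSn 1)); exact: ltnSn.
Qed.

End radius_bounds.

Lemma kernel_start : exists C1 l0, [/\ (0 < l0)%N, 0 <= C1 & 1 <= C1 * Z l0 1%g].
Proof.
have [al [al0 sal] Pal] : (Psi @` words A) 1%g by rewrite Psi_onto.
have al0' : (0 < size al)%N by case: al al0 {sal Pal}.
exists (expR (word_sum phi al))^-1, (size al); split=> //.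
rewrite -(mulVf (x := expR (word_sum phi al))); last by rewrite gt_eqF// expR_gt0.
rewrite ler_pM2l ?invr_gt0 ?expR_gt0// weightE//.
rewrite (bigD1 (in_tuple al))/=; last by rewrite sal Pal eqxx.
by rewrite lerDl; apply: sumr_ge0 => v _; exact: expR_ge0.
Qed.

(** The pressure controls large n only; the finitely many smaller n are absorbed into M. *)
Lemma kernel_bound t : (pressure phi (kernel_words A Psi) < t%:E)%E ->
  exists M, forall n, (0 < n)%N -> Z n 1%g <= M * expR t ^+ n.
Proof.
move=> /pressure_lt[N HN]; pose f n := Z n 1%g / expR t ^+ n.
have f0 n : 0 <= f n by rewrite divr_ge0 ?exprn_ge0 ?expR_ge0//; exact: weight_ge0.
have E0 n : 0 < expR t ^+ n by rewrite exprn_gt0// expR_gt0.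
exists (1 + \sum_(n < N) f n) => n n0; rewrite -ler_pdivrMr//.
have [Nn|nN] := leqP N n.
  apply: (@le_trans _ _ 1); last by rewrite lerDl sumr_ge0.
  rewrite ler_pdivrMr// mul1r -expRM_natr -partition_kernel//; exact: HN.
by rewrite (bigD1 (Ordinal nN))//= addrCA lerDl addr_ge0// sumr_ge0.
Qed.

(** A bound valid for E on either side of 1, and harmless to nth roots when N is o(n). *)
Lemma geometric_sum_le (E : R) N : 0 <= E -> \sum_(i < N.+1) E ^+ i <= (1 + E) ^+ N.
Proof.
move=> E0; elim: N => [|N IH]; first by rewrite big_ord1 expr0.
rewrite big_ord_recr/= [leRHS]exprS mulrDl mul1r; apply: lerD => //.
rewrite exprS ler_wpM2l// lerXn2r ?nnegrE ?addr_ge0//.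
by rewrite lerDr.
Qed.

(** With E = exp t, [conv_norm_le] bounds the square of [u n] by a constant times [theta n], that is
    by E^(2n) up to the factors c_n and (1 + E)^(N_n), which are subexponential by asymptotic
    symmetry. Hence l^2 <= E^2. *)
Lemma symmetric_radius l : asymptotically_symmetric Psi phi -> 0 <= l ->
  (forall n, (0 < n)%N -> l ^+ n <= u n) -> 
  forall t, (pressure phi (kernel_words A Psi) < t%:E)%E -> l <= expR t.
Proof.
move=> [c [N [c0 c1 N1 sym]]] l0 l_le t /kernel_bound[M HM].
have [C1 [l1 [l10 C10 HC1]]] := kernel_start.
set E := expR t in HM *; have E0 : 0 < E by exact: expR_gt0.
pose rho := (longest_link Psi_hom Psi_linked).+1.
pose C := glue_const phi j Psi_hom Psi_linked; have C0 : 0 < C by exact: expR_gt0.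
pose K := C * \sum_(r < rho) E ^+ r.
have K0 : 0 < K.
  rewrite mulr_gt0// /rho big_ord_recl/= expr0 ltr_wpDr// sumr_ge0// => i _.
  by rewrite exprn_ge0// ltW.
pose theta n := c n * \sum_(i < (N n).+1) (K * E ^+ (n + i)) * (K * E ^+ n).
have th0 n : (0 < n)%N -> 0 < theta n.
  by move=> n0; apply: (theta_gt0 E0 C0 (rho := rho)) => //; exact: c0.
pose B := (\sum_v w v) * (\sum_v (w v)^-1).
have B0' : 0 < B by rewrite mulr_gt0// sum_gt0// => v; rewrite invr_gt0.
have Bth n : (0 < n)%N -> 0 <= B * theta n by move=> n0; exact: ltW (mulr_gt0 B0' (th0 n n0)).
have un n : (0 < n)%N -> u n <= Num.sqrt (B * theta n).
  move=> n0; apply: cyl_growth_le.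
    exact: sqrtr_ge0.
  move=> F fF; rewrite sqr_sqrtr ?Bth//.
  apply: (sqnorm_transition_le phi_loc j0 w0 fF) => [f ff|]; last exact: ltW (th0 n n0).
  apply: (conv_norm_le e0 E0 C0 (rho := rho) erefl _ n0 (ltn0Sn _) (c0 n n0) _ HM l10 C10 HC1 ff).
    by move=> a b g; exact: ew_glue.
  move=> g; have := sym g n n0; rewrite big_mkord weightE//.
  move=> H; apply: le_trans H _; rewrite ler_pM2l ?c0//; apply: ler_sum => i _.
  by rewrite weightE// addn_gt0 n0.
pose D := 1 + E; have D0 : 0 < D by rewrite addr_gt0.
(* The subexponential part of the bound, separated from E^(2n). *)
pose v n := B * K ^+ 2 * c n * D ^+ N n.
have BK0 : 0 < B * K ^+ 2 by rewrite mulr_gt0// exprn_gt0.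
rewrite -(@ler_pXn2r _ 2)// ?nnegrE//; last exact: ltW.
apply: (@le_of_subexponential _ _ _ v).
- move=> k k0; have ck := c0 k k0; rewrite /v; apply: mulr_ge0; last by rewrite exprn_ge0// ltW.
  by apply: mulr_ge0; exact: ltW.
- have DN : (fun n => D `^ ((N n)%:R / n%:R)) @ \oo --> (1 : R) by exact: powR_cvg1.
  have lim : (fun n => (B * K ^+ 2) `^ n%:R^-1 * c n `^ n%:R^-1 * D `^ ((N n)%:R / n%:R)) @ \oo --> (1 : R).
    have lim1 : (fun n => (B * K ^+ 2) `^ n%:R^-1 * c n `^ n%:R^-1) @ \oo --> (1 : R).
      by rewrite -[X in _ --> X]mulr1; apply: cvgM => //; exact: root_cvg1.
    by rewrite -[X in _ --> X]mulr1; exact: cvgM.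
  apply: cvg_trans lim; apply: near_eq_cvg; exists 1%N => // n /= n0.
  have cn0 := ltW (c0 n n0).
  have BK := ltW BK0; have A0 : 0 <= B * K ^+ 2 * c n by exact: mulr_ge0.
  have B0 : 0 <= D ^+ N n by rewrite exprn_ge0// ltW.
  rewrite /v (powRM _ A0 B0) (powRM _ BK cn0).
  by rewrite powRrM powR_mulrn// ltW.
- by rewrite exprn_ge0// ltW.
- by rewrite exprn_ge0.
move=> n n0; have thn := ltW (th0 n n0).
have := le_trans (l_le n n0) (un n n0).
rewrite -(@ler_pXn2r _ 2)// ?nnegrE ?exprn_ge0 ?sqrtr_ge0//.
rewrite sqr_sqrtr ?Bth// -!exprM mulnC => H; apply: le_trans H _.
rewrite (_ : v n * _ = B * (c n * (K ^+ 2 * E ^+ (2 * n) * D ^+ N n))); last by rewrite /v; ring.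
have -> : theta n = c n * (K ^+ 2 * E ^+ (2 * n) * \sum_(i < (N n).+1) E ^+ i).
  rewrite /theta; congr (_ * _); rewrite mulr_sumr; apply: eq_bigr => i _.
  by rewrite exprD mul2n -addnn exprD; ring.
apply: ler_wpM2l; first exact: ltW.
apply: ler_wpM2l; first exact: ltW (c0 n n0).
apply: ler_wpM2l; first by rewrite mulr_ge0 ?exprn_ge0// ltW.
exact: geometric_sum_le (ltW E0).
Qed.

End gibbs_extension.

Theorem theorem3p21 (R : realType) (I : finType) (A : incidence_matrix I)
    (G : groupType) (G_countable : countable [set: G])
    (Psi : seq I -> G) (Psi_hom : semigroup_hom Psi) (Psi_linked : linked A Psi)
    (Psi_onto : Psi @` words A = [set: G])
    (phi : shift_space A -> R) (k : nat)
    (phi_meas : measurable_wrt (cylinder_algebra A k) phi)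
    (mu : probability (shift_space A) R) (h : shift_space A -> R)
    (mu_phi : probability (shift_space A) R)
    (mu_gibbs : gibbs_measure phi mu h mu_phi)
    (j : nat) (j_gt0 : (0 < j)%N) (k_le_j : (k <= j.+1)%N) :
  let m := extension_measure G mu_phi in
  let L := extension_operator Psi phi h mu_phi in
  let log_rho_V := lne (spectral_radius m (cylinder_space G mu_phi j) L) in
  let log_rho := lne (spectral_radius m (L2 m) L) in
  let P_ker := pressure phi (kernel_words A Psi) in
  let P := pressure phi (words A) in
  [/\ [/\ (P_ker <= log_rho_V)%E, (log_rho_V <= log_rho)%E & log_rho = P],
      log_rho_V = log_rho <-> amenable R G
    & asymptotically_symmetric Psi phi ->
        P_ker = log_rho_V /\ (amenable R G <-> P_ker = P)].
Proof.
move=> m L log_rho_V log_rho P_ker P.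
(* This is where j >= k - 1 enters: [phi] depends on at most j + 1 letters, one more than a state
   records. *)
have phi_loc (x y : shift_space A) : agree j.+1 x y -> phi x = phi y.
  move=> xy; apply: (measurable_wrt_local phi_meas) => i ik; apply: xy.
  exact: leq_trans k_le_j.
have rhoE := spectral_radius_L2 G_countable Psi_hom Psi_linked Psi_onto phi_loc j_gt0 mu_gibbs.
have [l [l0 l_le rhoV] l_lim] :=
  cyl_radius G_countable Psi_hom Psi_linked Psi_onto phi_loc j_gt0 mu_gibbs.
have logV : log_rho_V = lne l%:E by rewrite /log_rho_V rhoV.
have logL : log_rho = lne (lam phi)%:E by rewrite /log_rho rhoE.
have l_lam := radius_le G_countable Psi_hom Psi_linked Psi_onto phi_loc j_gt0 mu_gibbs l0 l_le.
have ker := kernel_pressure_le G_countable Psi_hom Psi_linked Psi_onto phi_loc j_gt0 mu_gibbs l0 l_lim.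
have lnn (x : R) : 0 <= x -> x%:E \in `[0%E, +oo%E] by move=> x0; rewrite in_itv /= lee_fin x0 leey.
have lam0 : 0 <= lam phi by exact: expR_ge0.
have LP : log_rho = P.
  by rewrite logL /P (pressure_finite phi_loc) lne_EFin ?lam_gt0// expRK.
have am : log_rho_V = log_rho <-> amenable R G.
  rewrite logV logL; split=> [/lne_inj|am].
    move=> /(_ (lnn _ l0) (lnn _ lam0)) [ll].
    apply: (radius_amenable G_countable Psi_hom Psi_linked Psi_onto phi_loc j_gt0 mu_gibbs l0 l_le).
    by rewrite ll.
  congr (lne _%:E); apply/eqP; rewrite eq_le l_lam /=.
  exact: (amenable_radius G_countable Psi_hom Psi_linked Psi_onto phi_loc j_gt0 mu_gibbs l_lim).
split=> //.
  by split=> //; rewrite ?logV ?logL// lee_lne ?lnn// lee_fin.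
move=> sym.
have PV : P_ker = log_rho_V.
  apply/eqP; rewrite eq_le logV ker /=; apply: lne_le => // t.
  exact: (symmetric_radius G_countable Psi_hom Psi_linked Psi_onto phi_loc j_gt0 mu_gibbs sym l0 l_le).
by split=> //; rewrite PV -LP -am.
Qed.
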